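(* There is a universal constant $c>0$ such that the following holds. Let $(X,dx)$ be a measure space of finite total measure $|X|\in(0,\infty)$, let $(T^t)_{t\ge 0}$ be a symmetric Markovian semigroup on $L^2(X,dx)$ (conditions 1–4 of the context), let $M$ be a bounded Borel function on $(0,\infty)$, and let $T_m$ be the associated spectral multiplier operator of Laplace transform type. Then, for every $f\in L^2(X,dx)$, $$\|T_m f\|_1\le c\,|X|\,\|M\|_\infty\,\|f\|_{L\log L},$$ where $\|\cdot\|_1$ is the norm of $L^1(X,dx)$ and $\|\cdot\|_{L\log L}$ is the $L\log L$ norm with respect to the normalized probability measure $dx/|X|$.
   Context: Functions are complex-valued. $(T^t)_{t\ge 0}$ is a strongly continuous semigroup of linear operators on $L^2(X,dx)$ (with $T^0=\mathrm{Id}$) satisfying: 1. (contraction) $\|T^t f\|_p \le \|f\|_p$ for all $1\le p\le\infty$, $t\ge 0$ and $f\in L^2\cap L^p(X,dx)$; 2. (symmetry) $T^t$ is self-adjoint on $L^2(X,dx)$ for every $t\ge 0$; 3. (positivity) $T^t f\ge 0$ if $f\ge 0$; 4. (conservation of mass) $T^t 1 = 1$, where $T^t 1 := \sup_n T^t I_{A_n}$ for a sequence of measurable sets $A_n\uparrow X$ with indicator functions $I_{A_n}\in L^2(X,dx)$. The generator is $Af = \lim_{t\downarrow 0} \frac{f - T^t f}{t}$, with domain $D(A)$ the set of $f\in L^2(X,dx)$ for which the limit exists in $L^2(X,dx)$. It is self-adjoint, non-negative and densely defined, $T^t=e^{-tA}$, and $(E(\lambda))_{\lambda\in\mathbb{R}}$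 denotes the resolution of the identity associated to $A$. For a bounded Borel function $M$ on $(0,\infty)$, put $\|M\|_\infty=\sup_{t>0}|M(t)|$, and define $$m(\lambda) = -\lambda\int_0^\infty M(t)e^{-t\lambda}\,dt \quad (\lambda>0),\qquad m(0)=0.$$ One has $\sup_\lambda|m(\lambda)|\le\|M\|_\infty$. The operator $T_m = m(A)$ on $L^2(X,dx)$ is defined by spectral calculus: $T_m f = \int_{[0,\infty)} m(\lambda)\,dE(\lambda)f$. The $L\log L$ norm is the Luxemburg norm $$\|f\|_{L\log L}=\inf\left\{\kappa>0:\ \frac{1}{|X|}\int_X \frac{|f|}{\kappa}\log\left(e+\frac{|f|}{\kappa}\right)dx\le 1\right\}.$$ *)

(* Defs.v *)
From HB Require Import structures.
From mathcomp Require Import all_boot all_order all_algebra.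
From mathcomp Require Import all_classical all_reals all_analysis.
From mathcomp Require Export complex.
Set Implicit Arguments.
Unset Strict Implicit.
Unset Printing Implicit Defensive.
Import Order.TTheory GRing.Theory Num.Theory.
Import numFieldNormedType.Exports.
Local Open Scope classical_set_scope.
Local Open Scope ring_scope.
Local Open Scope complex_scope.

(* Elements of L^2(X, dx) are represented by functions [X -> R[i]]; equality in
   L^2 is equality almost everywhere. *)

Section ComplexFunctions.
Context d (X : measurableType d) (R : realType).
Implicit Types (mu : {measure set X -> \bar R}) (f g : X -> R[i]).

Definition cmeasurable (D : set X) f :=
  measurable_fun D (fun x => complex.Re (f x)) /\
  measurable_fun D (fun x => complex.Im (f x)).

Definition cLnorm mu (p : \bar R) f : \bar R :=
  Lnorm mu p (fun x => (Normc.normc (f x))%:E).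

Definition inLp mu (p : \bar R) f :=
  cmeasurable setT f /\ (cLnorm mu p f < +oo)%E.

Definition cintegral mu (D : set X) f : R[i] :=
  (\int[mu]_(x in D) complex.Re (f x)) +i* (\int[mu]_(x in D) complex.Im (f x)).

Definition cinner mu f g : R[i] := cintegral mu setT (fun x => f x * (g x)^*).

Definition cindic (A : set X) : X -> R[i] := fun x => (\1_A x)%:C.

(* [0 <= z] in [R[i]] says that [z] is real and nonnegative. *)
Definition ae_nonneg mu f := {ae mu, forall x, 0 <= f x}.

Record L2_operator mu (S : (X -> R[i]) -> (X -> R[i])) : Prop := {
  L2op_stable : forall f, inLp mu 2%:E f -> inLp mu 2%:E (S f) ;
  L2op_ae : forall f g, inLp mu 2%:E f -> inLp mu 2%:E g ->
    f = g %[ae mu] -> S f = S g %[ae mu] ;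
  L2op_linear : forall (a : R[i]) f g, inLp mu 2%:E f -> inLp mu 2%:E g ->
    S (fun x => a * f x + g x) = (fun x => a * S f x + S g x) %[ae mu] }.

(* For an everywhere defined operator, symmetric and self-adjoint are the same
   thing (and such an operator is automatically bounded). *)
Definition L2_selfadjoint mu (S : (X -> R[i]) -> (X -> R[i])) :=
  forall f g, inLp mu 2%:E f -> inLp mu 2%:E g ->
    cinner mu (S f) g = cinner mu f (S g).

Definition LlogL_norm mu f : \bar R :=
  ereal_inf [set kappa%:E | kappa in [set kappa : R | 0 < kappa /\
    ((fine (mu setT))^-1%:E *
      \int[mu]_x ((Normc.normc (f x) / kappa) *
                  ln (expR 1 + Normc.normc (f x) / kappa))%:E <= 1)%E]].

End ComplexFunctions.

Section Semigroup.
Context d (X : measurableType d) (R : realType).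
Variables (mu : {measure set X -> \bar R}) (T : R -> (X -> R[i]) -> (X -> R[i])).

(* Only the values [T t] with [0 <= t] are meaningful. *)
Record strongly_continuous_semigroup : Prop := {
  sg_operator : forall t : R, 0 <= t -> L2_operator mu (T t) ;
  sg_zero : forall f, inLp mu 2%:E f -> T 0 f = f %[ae mu] ;
  sg_add : forall (s t : R) f, 0 <= s -> 0 <= t -> inLp mu 2%:E f ->
    T (s + t) f = T s (T t f) %[ae mu] ;
  sg_continuous : forall f (t : R), inLp mu 2%:E f -> 0 <= t ->
    cLnorm mu 2%:E (fun x => T s f x - T t f x)
      @[s --> within [set s : R | 0 <= s] (nbhs t)] --> 0%E }.

Record symmetric_markovian_semigroup : Prop := {
  smsg_semigroup : strongly_continuous_semigroup ;
  smsg_contraction : forall (p : \bar R) (t : R) f, (1 <= p)%E -> 0 <= t ->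
    inLp mu 2%:E f -> inLp mu p f -> (cLnorm mu p (T t f) <= cLnorm mu p f)%E ;
  smsg_symmetry : forall t : R, 0 <= t -> L2_selfadjoint mu (T t) ;
  smsg_positivity : forall (t : R) f, 0 <= t -> inLp mu 2%:E f ->
    ae_nonneg mu f -> ae_nonneg mu (T t f) ;
  (* [T t (cindic (A n))] is a.e. real by positivity, so the supremum is that
     of the real parts. *)
  smsg_conservation : forall t : R, 0 <= t -> exists A : nat -> set X,
    [/\ forall n, measurable (A n),
        forall n, A n `<=` A n.+1,
        \bigcup_n A n = setT,
        forall n, inLp mu 2%:E (cindic R (A n)) &
        {ae mu, forall x, ereal_sup (range (fun n =>
          (complex.Re (T t (cindic R (A n)) x))%:E)) = 1%E}] }.

(* [generator f g]: f is in D(A) and Af = g, with the sign convention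
   A f = lim (f - T^t f) / t. *)
Definition generator (f g : X -> R[i]) :=
  [/\ inLp mu 2%:E f, inLp mu 2%:E g &
      cLnorm mu 2%:E (fun x => (f x - T t f x) / t%:C - g x)
        @[t --> 0^'+] --> 0%E].

End Semigroup.

Section SpectralCalculus.
Context d (X : measurableType d) (R : realType).
Variables (mu : {measure set X -> \bar R}) (E : R -> (X -> R[i]) -> (X -> R[i])).

Record resolution_of_identity : Prop := {
  roi_operator : forall l, L2_operator mu (E l) ;
  roi_selfadjoint : forall l, L2_selfadjoint mu (E l) ;
  roi_mul : forall k l f, inLp mu 2%:E f ->
    E k (E l f) = E (Num.min k l) f %[ae mu] ;
  roi_right_continuous : forall l f, inLp mu 2%:E f ->
    cLnorm mu 2%:E (fun x => E k f x - E l f x) @[k --> l^'+] --> 0%E ;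
  roi_ninfty : forall f, inLp mu 2%:E f ->
    cLnorm mu 2%:E (E l f) @[l --> -oo] --> 0%E ;
  roi_pinfty : forall f, inLp mu 2%:E f ->
    cLnorm mu 2%:E (fun x => E l f x - f x) @[l --> +oo] --> 0%E }.

(* An element (c, (a, b)) of the list stands for the step c 1_(a,b]; it
   contributes nothing when b <= a. *)
Definition step_fun (s : seq (R[i] * (R * R))) (l : R) : R[i] :=
  \sum_(q <- s | q.2.1 < l <= q.2.2) q.1.

Definition step_integral (s : seq (R[i] * (R * R))) (f : X -> R[i]) (x : X) : R[i] :=
  \sum_(q <- s | q.2.1 < q.2.2) q.1 * (E q.2.2 f x - E q.2.1 f x).

(* [spectral_integral phi f u]: f is in the domain of int phi dE, which is
   { f | phi in L^2(R, d||E f||^2) }, and u = int phi(l) dE(l) f.  The integral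
   is the extension by the isometry L^2(R, d||E f||^2) -> L^2(X, dx) from step
   functions.  The monotone function F of the definition exists, and is
   unique, for every resolution of the identity E. *)
Definition spectral_integral (phi : R -> R[i]) (f u : X -> R[i]) :=
  [/\ inLp mu 2%:E f, inLp mu 2%:E u &
    exists F : cumulative R R,
      (forall l, F l = fine (cLnorm mu 2%:E (E l f)) ^+ 2) /\
      exists s : nat -> seq (R[i] * (R * R)),
        (\int[lebesgue_stieltjes_measure F]_l
           ((Normc.normc (phi l - step_fun (s n) l)) ^+ 2)%:E)%E
             @[n --> \oo] --> 0%E /\
        cLnorm mu 2%:E (fun x => step_integral (s n) f x - u x)
             @[n --> \oo] --> 0%E].

(* A = int l dE(l), as an equality of unbounded operators. *)
Definition resolution_of_generator (T : R -> (X -> R[i]) -> (X -> R[i])) :=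
  resolution_of_identity /\
  forall f g, generator mu T f g <-> spectral_integral (fun l => l%:C) f g.

Definition spectral_multiplier (phi : R -> R[i])
    (S : (X -> R[i]) -> (X -> R[i])) :=
  forall f, inLp mu 2%:E f -> spectral_integral phi f (S f).

End SpectralCalculus.

Section LaplaceMultiplier.
Context (R : realType).
Implicit Types M : R -> R[i].

(* Only the values of M on (0, oo) matter. *)
Definition bounded_borel M :=
  cmeasurable (`]0, +oo[ : set R) M /\
  exists K : R, forall t : R, 0 < t -> Normc.normc (M t) <= K.

Definition sup_norm M : R := sup [set Normc.normc (M t) | t in `]0, +oo[].

(* Extended by 0 to the negative half-line: the spectral integral over
   [0, oo) is then the one over the whole line. *)
Definition laplace_multiplier M (l : R) : R[i] :=
  if 0 < l then
    - (l%:C * cintegral lebesgue_measure (`]0, +oo[ : set R)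
                (fun t => M t * (expR (- (t * l)))%:C))
  else 0.

End LaplaceMultiplier.

(* Main.v *)
Require Import Defs.
From HB Require Import structures.
From mathcomp Require Import all_boot all_order all_algebra.
From mathcomp Require Import all_classical all_reals all_analysis.
From mathcomp Require Import measurable_realfun ess_sup_inf ring lra.
(** Write [nu_f] for the spectral measure of [f], whose distribution function is
    [l |-> |E(l) f|^2].  Since [m(l) = int_0^oo M(t) d(exp(- t l))], the operator
    is formally [T_m f = int_0^oo M(t) d(T^t f)], a superposition of increments
    of the semigroup with coefficients bounded by [K = |M|_oo].  Its [L^1] norm
    is thus controlled, by duality with functions [|v| <= 1], by the variation
    of [t |-> <T^t f, v>], and the point is that this variation is at most an
    [L log L] quantity in [f].

    The variation ([markov_variation]).  Take a bounded [w >= 0], put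
    [u = 1 + w] and let [P = T^(h/2)], so that [<T^(k h) w, v>] differs from
    [int (P^k u) (P^k v)] by a term independent of [k].  The function
    [B(x, y) = 15 (x ln x - x) + x y^2] is such that [B(x, y) + x y] and
    [B(x, y) - x y] are both convex for [x > 0] and [|y| <= 1]
    ([bellman_tangent_le]).  Jensen's inequality for the Markov operator [P],
    followed by integration, which [P] preserves, gives
    [|int u v - int Pu Pv| <= int B(u, v) - int B(Pu, Pv)] ([bellman_step]).
    Along the iterates of [P] the right-hand sides telescope, and
    [- 15 <= B(x, y) <= 15 x ln x] for [x >= 1] leaves
    [15 int u ln u + 15 |X|].  Choosing for [v] the sign of the sum of weighted
    increments gives the [L^1] bound ([variation_L1]).  As
    [(1 + w) ln (1 + w) <= 2 w ln (e + w)], a [w] of Luxemburg norm at most [1]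
    yields [45 K |X|]; the real and imaginary parts of [M] double the constant
    and the four nonnegative pieces of a complex [f] quadruple it, hence [360].
    Unbounded [f] are reached by truncation.

    The superposition ([riemann_op_cvg]).  Only the integral against [dE] is
    given, so [T_m f] is obtained as the [L^2] limit of the finite sums
    [R_n f = sum_k c_k (T^((k+1) h) f - T^(k h) f)], with [c_k] the average of
    [M] over the cell of index [k] and [h = 1 / (n + 1)].  The Laplace integral
    [m(l)] is the limit, boundedly, of the multipliers of [R_n]
    ([laplace_riemann_sum]), and the isometry between [L^2(nu_f)] and [L^2(X)]
    underlying the spectral integral ([nrm_step_integral],
    [spectral_integral_dist]) turns this into convergence in [L^2(X)].  What is
    left is [T^t f = int exp(- t l) dE(l) f] ([semigroup_spectral]), from the
    hypothesis that [int l dE(l)] is the generator [A] of the semigroup.  A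
    vector [p] in the range of [E(b) - E(a)] is an approximate eigenvector,
    [|A p - c p| <= (b - a) |p|] for [c] in [[a, b]] ([band_spectral_id], which
    needs the completeness of [L^2]); by the Gronwall inequality
    [|T^t p - exp(- t c) p| <= t (b - a) |p|] when [c >= 0]
    ([semigroup_approx_eigenvector]), and summing this over a fine subdivision
    of the half-line gives the formula.  The spectrum is nonnegative because
    [T^t] contracts ([resolution_neg]). *)

Set Implicit Arguments.
Unset Strict Implicit.
Unset Printing Implicit Defensive.
Import Order.TTheory GRing.Theory Num.Theory.
Import numFieldNormedType.Exports.
Local Open Scope classical_set_scope.
Local Open Scope ring_scope.
Local Open Scope complex_scope.
Import Normc.

Local Notation Re := complex.Re.
Local Notation Im := complex.Im.

(** * Complex numbers and complex functions *)

Section ComplexNumbers.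
Context (R : realType).
Implicit Types z w : R[i].

Lemma cReD z w : Re (z + w) = Re z + Re w. Proof. by case: z w => ? ? []. Qed.
Lemma cImD z w : Im (z + w) = Im z + Im w. Proof. by case: z w => ? ? []. Qed.
Lemma cReN z : Re (- z) = - Re z. Proof. by case: z. Qed.
Lemma cImN z : Im (- z) = - Im z. Proof. by case: z. Qed.
Lemma cReM z w : Re (z * w) = Re z * Re w - Im z * Im w.
Proof. by case: z w => ? ? []. Qed.
Lemma cImM z w : Im (z * w) = Re z * Im w + Im z * Re w.
Proof. by case: z w => ? ? []. Qed.
Lemma cRe_conj z : Re z^* = Re z. Proof. by case: z. Qed.
Lemma cIm_conj z : Im z^* = - Im z. Proof. by case: z. Qed.
Definition ReImE := (cReD, cImD, cReN, cImN, cReM, cImM, cRe_conj, cIm_conj).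

Lemma Re_mulrC z (x : R) : Re (z * x%:C) = Re z * x.
Proof. by rewrite cReM /= mulr0 subr0. Qed.
Lemma Im_mulrC z (x : R) : Im (z * x%:C) = Im z * x.
Proof. by rewrite cImM /= mulr0 add0r. Qed.

Lemma Re_sum I (s : seq I) (P : pred I) (F : I -> R[i]) :
  Re (\sum_(i <- s | P i) F i) = \sum_(i <- s | P i) Re (F i).
Proof. exact: (big_morph _ cReD erefl). Qed.
Lemma Im_sum I (s : seq I) (P : pred I) (F : I -> R[i]) :
  Im (\sum_(i <- s | P i) F i) = \sum_(i <- s | P i) Im (F i).
Proof. exact: (big_morph _ cImD erefl). Qed.

Lemma complexP z w : Re z = Re w -> Im z = Im w -> z = w.
Proof. by case: z w => ? ? [? ?] /= -> ->. Qed.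

Lemma normcE z : normc z = Num.sqrt (Re z ^+ 2 + Im z ^+ 2).
Proof. by case: z. Qed.

Lemma normc_ge0 z : 0 <= normc z.
Proof. by rewrite normcE sqrtr_ge0. Qed.

Lemma sqr_normcE z : normc z ^+ 2 = Re z ^+ 2 + Im z ^+ 2.
Proof. by rewrite normcE sqr_sqrtr// addr_ge0// sqr_ge0. Qed.

Lemma normcN z : normc (- z) = normc z.
Proof. by rewrite !normcE !ReImE !sqrrN. Qed.

Lemma normcC (x : R) : normc x%:C = `|x|.
Proof. by rewrite normcE/= expr0n addr0 sqrtr_sqr. Qed.

Lemma normcD z w : normc (z + w) <= normc z + normc w.
Proof.
rewrite -(@ler_sqr _ (normc _)) ?nnegrE ?addr_ge0 ?normc_ge0//.
rewrite sqrrD !sqr_normcE !ReImE.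
have : Re z * Re w + Im z * Im w <= normc z * normc w.
  rewrite (le_trans (ler_norm _))//.
  rewrite -(@ler_sqr _ (`|_|)) ?nnegrE ?mulr_ge0 ?normc_ge0//.
  rewrite -normrX ger0_norm ?sqr_ge0// exprMn !sqr_normcE.
  rewrite -subr_ge0; set t := (t in 0 <= t).
  suff -> : t = (Re z * Im w - Im z * Re w) ^+ 2 by exact: sqr_ge0.
  by rewrite /t; ring.
by move=> H; rewrite mulr2n; lra.
Qed.

Lemma ler_Re_normc z : `|Re z| <= normc z.
Proof. by rewrite normcE -[`|_|]sqrtr_sqr ler_wsqrtr// lerDl sqr_ge0. Qed.

Lemma ler_Im_normc z : `|Im z| <= normc z.
Proof. by rewrite normcE -[`|_|]sqrtr_sqr ler_wsqrtr// lerDr sqr_ge0. Qed.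

Lemma normc_le_ReIm z : normc z <= `|Re z| + `|Im z|.
Proof.
rewrite -(@ler_sqr _ (normc _)) ?nnegrE ?addr_ge0 ?normc_ge0//.
rewrite sqr_normcE sqrrD -!normrX !(@ger0_norm _ (_ ^+ 2)) ?sqr_ge0//.
have : 0 <= `|Re z| * `|Im z| by rewrite mulr_ge0.
by move=> H; rewrite mulr2n; nra.
Qed.

Lemma sqr_normcD z w : normc (z + w) ^+ 2 <= 2 * (normc z ^+ 2 + normc w ^+ 2).
Proof.
rewrite !sqr_normcE !ReImE.
have := sqr_ge0 (Re z - Re w); have := sqr_ge0 (Im z - Im w).
by rewrite !sqrrB; lra.
Qed.

End ComplexNumbers.

Section ComplexMeasurable.
Context d (X : measurableType d) (R : realType).
Implicit Types (f g : X -> R[i]) (D : set X).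

Lemma cmeasurable_cst D (c : R[i]) : cmeasurable D (fun=> c).
Proof. by split; exact: measurable_cst. Qed.

Lemma cmeasurableD D f g : cmeasurable D f -> cmeasurable D g ->
  cmeasurable D (fun x => f x + g x).
Proof.
move=> [f1 f2] [g1 g2]; split.
  by under eq_fun do rewrite cReD; exact: measurable_funD.
by under eq_fun do rewrite cImD; exact: measurable_funD.
Qed.

Lemma cmeasurableM D f g : cmeasurable D f -> cmeasurable D g ->
  cmeasurable D (fun x => f x * g x).
Proof.
move=> [f1 f2] [g1 g2]; split.
  by under eq_fun do rewrite cReM; apply: measurable_funB; exact: measurable_funM.
by under eq_fun do rewrite cImM; apply: measurable_funD; exact: measurable_funM.
Qed.

Lemma cmeasurableN D f : cmeasurable D f -> cmeasurable D (fun x => - f x).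
Proof.
move=> [f1 f2]; split.
  by under eq_fun do rewrite cReN; exact: measurable_funN.
by under eq_fun do rewrite cImN; exact: measurable_funN.
Qed.

Lemma cmeasurableB D f g : cmeasurable D f -> cmeasurable D g ->
  cmeasurable D (fun x => f x - g x).
Proof. by move=> mf mg; apply: cmeasurableD => //; exact: cmeasurableN. Qed.

Lemma cmeasurable_conj D f : cmeasurable D f -> cmeasurable D (fun x => (f x)^*).
Proof.
move=> [f1 f2]; split.
  by under eq_fun do rewrite cRe_conj.
by under eq_fun do rewrite cIm_conj; exact: measurable_funN.
Qed.

Lemma cmeasurable_real D (u : X -> R) : measurable_fun D u ->
  cmeasurable D (fun x => (u x)%:C).
Proof. by move=> mu; split => //=; exact: measurable_cst. Qed.

Lemma measurable_normc D f : cmeasurable D f ->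
  measurable_fun D (fun x => normc (f x)).
Proof.
move=> [f1 f2]; under eq_fun do rewrite normcE.
apply: (measurableT_comp (continuous_measurable_fun (@sqrt_continuous R))).
by apply: measurable_funD; exact: measurable_funX.
Qed.

Lemma cmeasurable_sum D I (s : seq I) (P : pred I) (F : I -> X -> R[i]) :
  (forall i, cmeasurable D (F i)) ->
  cmeasurable D (fun x => \sum_(i <- s | P i) F i x).
Proof.
move=> mF; elim: s => [|i s IH].
  by under eq_fun do rewrite big_nil; exact: cmeasurable_cst.
under eq_fun do rewrite big_cons; case: (P i) => //.
exact: cmeasurableD.
Qed.

End ComplexMeasurable.

(** * The space of square-integrable complex functions *)

Section L2.
Context d (X : measurableType d) (R : realType) (mu : {measure set X -> \bar R}).
Implicit Types (f g h : X -> R[i]).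

Local Notation L2 := (inLp mu 2%:E).

Definition nrm f : R := fine (cLnorm mu 2%:E f).

Lemma cLnorm2E f :
  cLnorm mu 2%:E f = ((\int[mu]_x (normc (f x) ^+ 2)%:E) `^ 2^-1)%E.
Proof.
rewrite /cLnorm unlock; congr (_ `^ _)%E; apply: eq_integral => x _.
by rewrite abse_EFin poweR_EFin powR_mulrn// ger0_norm ?normc_ge0.
Qed.

Lemma measurable_sqnormc f : cmeasurable setT f ->
  measurable_fun setT (fun x => normc (f x) ^+ 2).
Proof. by move=> /measurable_normc; exact: measurable_funX. Qed.

Lemma inL2P f : L2 f <-> cmeasurable setT f /\
  mu.-integrable setT (fun x => (normc (f x) ^+ 2)%:E).
Proof.
rewrite /inLp cLnorm2E; split=> -[mf fi]; split=> //.
  apply/integrableP; split; first exact/measurable_EFinP/measurable_sqnormc.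
  under eq_integral do rewrite abse_EFin ger0_norm ?sqr_ge0//.
  by move: fi; apply: lty_poweRy; rewrite invr_eq0.
apply: poweR_lty; move/integrableP : fi => [_].
by under eq_integral do rewrite abse_EFin ger0_norm ?sqr_ge0//.
Qed.

Lemma inL2_meas f : L2 f -> cmeasurable setT f. Proof. by case. Qed.

Lemma cLnormE f : L2 f -> cLnorm mu 2%:E f = (nrm f)%:E.
Proof.
by move=> [_ fi]; rewrite /nrm fineK// ge0_fin_numE// Lnorm_ge0.
Qed.

Lemma nrm_ge0 f : 0 <= nrm f.
Proof. by rewrite /nrm fine_ge0// Lnorm_ge0. Qed.

Lemma sqr_nrm f : L2 f -> nrm f ^+ 2 = \int[mu]_x (normc (f x) ^+ 2).
Proof.
move=> /inL2P [mf fi]; rewrite /nrm cLnorm2E /Rintegral.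
have /fineK <- : (\int[mu]_x (normc (f x) ^+ 2)%:E)%E \is a fin_num.
  exact: integrable_fin_num.
rewrite poweR_EFin/= powR12_sqrt ?fine_ge0 ?integral_ge0//.
  rewrite sqr_sqrtr ?fine_ge0 ?integral_ge0// => x _.
  by rewrite lee_fin sqr_ge0.
by move=> x _; rewrite lee_fin sqr_ge0.
Qed.

Lemma sqr_nrmE f : L2 f -> ((nrm f ^+ 2)%:E = \int[mu]_x (normc (f x) ^+ 2)%:E)%E.
Proof.
move=> fL; rewrite sqr_nrm// /Rintegral fineK//.
by apply: integrable_fin_num => //; case/inL2P : fL.
Qed.

Lemma inL2_le f (h : X -> R) : cmeasurable setT f ->
  mu.-integrable setT (EFin \o h) -> (forall x, normc (f x) ^+ 2 <= h x) -> L2 f.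
Proof.
move=> mf hi fh; apply/inL2P; split => //.
apply: le_integrable hi => //; first exact/measurable_EFinP/measurable_sqnormc.
move=> x _ /=; rewrite lee_fin ger0_norm ?sqr_ge0//.
exact: le_trans (fh x) (ler_norm _).
Qed.

Lemma inL2_0 : L2 (fun=> 0).
Proof.
apply/inL2P; split; first exact: cmeasurable_cst.
under eq_fun do rewrite normc0 expr0n.
exact: integrable0.
Qed.

Lemma inL2D f g : L2 f -> L2 g -> L2 (fun x => f x + g x).
Proof.
move=> /inL2P [mf fi] /inL2P [mg gi].
apply: (@inL2_le _ (fun x => 2 * (normc (f x) ^+ 2 + normc (g x) ^+ 2))).
- exact: cmeasurableD.
- rewrite (_ : _ \o _ = fun x => (2%:E * ((normc (f x) ^+ 2)%:E + (normc (g x) ^+ 2)%:E))%E).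
    by apply: integrableZl => //; exact: integrableD.
  by apply/funext => x.
- by move=> x; exact: sqr_normcD.
Qed.

Lemma inL2Z c f : L2 f -> L2 (fun x => c * f x).
Proof.
move=> /inL2P [mf fi]; apply: (@inL2_le _ (fun x => normc c ^+ 2 * normc (f x) ^+ 2)).
- by apply: cmeasurableM => //; exact: cmeasurable_cst.
- by rewrite (_ : _ \o _ = fun x => ((normc c ^+ 2)%:E * (normc (f x) ^+ 2)%:E)%E) //;
    apply: integrableZl.
- by move=> x; rewrite normcM exprMn.
Qed.

Lemma inL2N f : L2 f -> L2 (fun x => - f x).
Proof.
move=> /(@inL2Z (- 1)); congr (L2 _).
by apply/funext => x; rewrite mulN1r.
Qed.

Lemma inL2B f g : L2 f -> L2 g -> L2 (fun x => f x - g x).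
Proof. by move=> fL /inL2N; exact: inL2D. Qed.

Lemma inL2_sum I (s : seq I) (P : pred I) (F : I -> X -> R[i]) :
  (forall i, L2 (F i)) -> L2 (fun x => \sum_(i <- s | P i) F i x).
Proof.
move=> LF; elim: s => [|i s IH].
  by under eq_fun do rewrite big_nil; exact: inL2_0.
by under eq_fun do rewrite big_cons; case: (P i) => //; exact: inL2D.
Qed.

Lemma measurable_comp_powR (u : X -> R) p : measurable_fun setT u ->
  measurable_fun setT (fun x => u x `^ p).
Proof. exact: (measurableT_comp (measurable_powR p)). Qed.

Lemma ae_eq_Lnorm p f g : f = g %[ae mu] -> cmeasurable setT f -> cmeasurable setT g ->
  cLnorm mu p%:E f = cLnorm mu p%:E g.
Proof.
move=> fg mf mg; rewrite /cLnorm unlock; congr (_ `^ _)%E.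
apply: ge0_ae_eq_integral => //.
- under eq_fun do rewrite abse_EFin poweR_EFin.
  apply/measurable_EFinP/measurable_comp_powR.
  by apply: measurableT_comp => //; exact: measurable_normc.
- under eq_fun do rewrite abse_EFin poweR_EFin.
  apply/measurable_EFinP/measurable_comp_powR.
  by apply: measurableT_comp => //; exact: measurable_normc.
- by move=> x _; exact: poweR_ge0.
- by move=> x _; exact: poweR_ge0.
- by apply: filterS fg => x /= /[apply] ->.
Qed.

Lemma nrm_ae f g : L2 f -> L2 g -> f = g %[ae mu] -> nrm f = nrm g.
Proof. by move=> [mf _] [mg _] fg; rewrite /nrm (ae_eq_Lnorm 2 fg). Qed.

Lemma nrm0 : nrm (fun=> 0) = 0.
Proof.
apply/eqP; rewrite -sqrf_eq0 sqr_nrm; last exact: inL2_0.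
rewrite /Rintegral; under eq_integral do rewrite normc0 expr0n.
by rewrite integral0.
Qed.

Lemma nrm_eq0 f : L2 f -> nrm f = 0 -> f = (fun=> 0) %[ae mu].
Proof.
move=> fL f0; have := cLnormE fL; rewrite f0 => /Lnorm_eq0_eq0.
have /[swap]/[apply] : measurable_fun setT (fun x => (normc (f x))%:E).
  by apply/measurable_EFinP/measurable_normc; exact: inL2_meas.
move/(_ ltac:(by rewrite lte_fin)).
by apply: filterS => x /= /(_ I) [] /eq0_normc.
Qed.

Lemma nrmZ c f : L2 f -> nrm (fun x => c * f x) = normc c * nrm f.
Proof.
move=> fL; apply/eqP; rewrite -(@eqrXn2 _ 2)// ?mulr_ge0 ?nrm_ge0 ?normc_ge0//.
rewrite exprMn !sqr_nrm//; last exact: inL2Z.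
rewrite -RintegralZl//; last by case/inL2P : fL.
by apply/eqP; apply: eq_Rintegral => x _; rewrite normcM exprMn.
Qed.

Lemma nrmN f : nrm (fun x => - f x) = nrm f.
Proof.
by rewrite /nrm /cLnorm; do 2 f_equal; apply/funext => x; rewrite normcN.
Qed.

Lemma nrmD f g : L2 f -> L2 g -> nrm (fun x => f x + g x) <= nrm f + nrm g.
Proof.
move=> fL gL; rewrite -lee_fin EFinD -!cLnormE//; last exact: inL2D.
apply: (@le_trans _ _ (Lnorm mu 2%:E (EFin \o
    ((fun x => normc (f x)) \+ (fun x => normc (g x)))%R))).
  rewrite cLnorm2E unlock; apply: gt0_ler_poweR.
  - by rewrite invr_ge0.
  - rewrite in_itv/= leey andbT.
    by apply: integral_ge0 => x _; rewrite lee_fin sqr_ge0.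
  - rewrite in_itv/= leey andbT.
    by apply: integral_ge0 => x _; rewrite lee_fin powR_ge0.
  apply: ge0_le_integral => //.
  - by move=> x _; rewrite lee_fin sqr_ge0.
  - apply/measurable_EFinP/measurable_sqnormc.
    by apply: cmeasurableD; exact: inL2_meas.
  - under eq_fun do rewrite abse_EFin poweR_EFin.
    apply/measurable_EFinP/measurable_comp_powR/measurableT_comp => //.
    by apply: measurable_funD; apply: measurable_normc; exact: inL2_meas.
  - move=> x _; rewrite ?poweR_EFin lee_fin powR_mulrn//.
    rewrite ger0_norm ?addr_ge0 ?normc_ge0// ler_sqr ?nnegrE ?addr_ge0 ?normc_ge0//.
    exact: normcD.
apply: minkowski_EFin; last by rewrite ler1n.
- by apply: measurable_normc; exact: inL2_meas.
- by apply: measurable_normc; exact: inL2_meas.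
Qed.

Lemma nrmB f g : L2 f -> L2 g -> nrm (fun x => f x - g x) <= nrm f + nrm g.
Proof. by move=> fL gL; rewrite -(nrmN g); apply: nrmD => //; exact: inL2N. Qed.

Lemma nrm_dist f g h : L2 f -> L2 g -> L2 h ->
  nrm (fun x => f x - h x) <= nrm (fun x => f x - g x) + nrm (fun x => g x - h x).
Proof.
move=> fL gL hL; have := nrmD (inL2B fL gL) (inL2B gL hL).
by congr (nrm _ <= _); apply/funext => x; rewrite addrA subrK.
Qed.

Lemma nrm_distC f g : nrm (fun x => f x - g x) = nrm (fun x => g x - f x).
Proof. by rewrite -nrmN; congr nrm; apply/funext => x; rewrite opprB. Qed.

Lemma nrm_sum I (s : seq I) (F : I -> X -> R[i]) :
  (forall i, L2 (F i)) -> nrm (fun x => \sum_(i <- s) F i x) <= \sum_(i <- s) nrm (F i).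
Proof.
move=> LF; elim: s => [|i s IH].
  by rewrite big_nil; under eq_fun do rewrite big_nil; rewrite nrm0.
rewrite big_cons; under eq_fun do rewrite big_cons.
by rewrite (le_trans (nrmD _ _))// ?lerD2l//; exact: inL2_sum.
Qed.

End L2.

Section InnerProduct.
Context d (X : measurableType d) (R : realType) (mu : {measure set X -> \bar R}).
Implicit Types (f g h : X -> R[i]).

Local Notation L2 := (inLp mu 2%:E).

Definition cintegrable f :=
  mu.-integrable setT (EFin \o (fun x => Re (f x))) /\
  mu.-integrable setT (EFin \o (fun x => Im (f x))).

Lemma cintegrableM f g : L2 f -> L2 g -> cintegrable (fun x => f x * g x).
Proof.
move=> /inL2P [mf fi] /inL2P [mg gi]; have [m1 m2] := cmeasurableM mf mg.
have I := integrableD measurableT fi gi.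
have le (z w : R[i]) : normc (z * w) <= normc z ^+ 2 + normc w ^+ 2.
  rewrite normcM; have := sqr_ge0 (normc z - normc w).
  have := mulr_ge0 (normc_ge0 z) (normc_ge0 w).
  by rewrite sqrrB mulr2n; lra.
have le0 (z w : R[i]) : 0 <= normc z ^+ 2 + normc w ^+ 2.
  by rewrite addr_ge0// sqr_ge0.
split; apply: le_integrable I => //; try exact/measurable_EFinP.
- move=> x _ /=; rewrite lee_fin (ger0_norm (le0 _ _)) (le_trans _ (le _ _))//.
  exact: ler_Re_normc.
- move=> x _ /=; rewrite lee_fin (ger0_norm (le0 _ _)) (le_trans _ (le _ _))//.
  exact: ler_Im_normc.
Qed.

Lemma inL2_conj f : L2 f -> L2 (fun x => (f x)^*).
Proof.
move=> /inL2P [mf fi]; apply/inL2P; split; first exact: cmeasurable_conj.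
apply: eq_integrable fi => // x _.
by rewrite !sqr_normcE cRe_conj cIm_conj sqrrN.
Qed.

Lemma cintegrable_ip f g : L2 f -> L2 g -> cintegrable (fun x => f x * (g x)^*).
Proof. by move=> fL gL; apply: cintegrableM => //; exact: inL2_conj. Qed.

Lemma cintegralD f g : cintegrable f -> cintegrable g ->
  cintegral mu setT (fun x => f x + g x) = cintegral mu setT f + cintegral mu setT g.
Proof.
move=> [f1 f2] [g1 g2]; apply: complexP; rewrite /= -RintegralD//.
  by apply: eq_Rintegral => x _; rewrite cReD.
by apply: eq_Rintegral => x _; rewrite cImD.
Qed.

Lemma cintegralZ c f : cintegrable f ->
  cintegral mu setT (fun x => c * f x) = c * cintegral mu setT f.
Proof.
move=> [f1 f2]; apply: complexP; rewrite /= ?cReM ?cImM /= -!RintegralZl//.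
  rewrite -RintegralB//; first by apply: eq_Rintegral => x _; rewrite cReM.
  - by rewrite (_ : _ \o _ = fun x => ((Re c)%:E * (Re (f x))%:E)%E) //;
      apply: integrableZl.
  - by rewrite (_ : _ \o _ = fun x => ((Im c)%:E * (Im (f x))%:E)%E) //;
      apply: integrableZl.
rewrite -RintegralD//; first by apply: eq_Rintegral => x _; rewrite cImM.
- by rewrite (_ : _ \o _ = fun x => ((Re c)%:E * (Im (f x))%:E)%E) //;
    apply: integrableZl.
- by rewrite (_ : _ \o _ = fun x => ((Im c)%:E * (Re (f x))%:E)%E) //;
    apply: integrableZl.
Qed.

Lemma cinnerDl f g h : L2 f -> L2 g -> L2 h ->
  cinner mu (fun x => f x + g x) h = cinner mu f h + cinner mu g h.
Proof.
move=> fL gL hL; rewrite /cinner -cintegralD; [|exact: cintegrable_ip..].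
by congr cintegral; apply/funext => x; rewrite mulrDl.
Qed.

Lemma cinnerZl c f g : L2 f -> L2 g ->
  cinner mu (fun x => c * f x) g = c * cinner mu f g.
Proof.
move=> fL gL; rewrite /cinner -cintegralZ; last exact: cintegrable_ip.
by congr cintegral; apply/funext => x; rewrite mulrA.
Qed.

Lemma cinnerC f g : L2 f -> L2 g -> cinner mu g f = (cinner mu f g)^*.
Proof.
move=> fL gL; have [_ i2] := cintegrable_ip fL gL.
apply: complexP; rewrite ?cRe_conj ?cIm_conj /=.
  by apply: eq_Rintegral => x _; rewrite !ReImE; ring.
rewrite -mulN1r -RintegralZl//; apply: eq_Rintegral => x _.
by rewrite !ReImE; ring.
Qed.

Lemma cinnerBl f g h : L2 f -> L2 g -> L2 h ->
  cinner mu (fun x => f x - g x) h = cinner mu f h - cinner mu g h.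
Proof.
move=> fL gL hL; rewrite -mulN1r -cinnerZl// -cinnerDl//; last exact: inL2Z.
by congr cinner; apply/funext => x; rewrite mulN1r.
Qed.

Lemma cinnerBr f g h : L2 f -> L2 g -> L2 h ->
  cinner mu h (fun x => f x - g x) = cinner mu h f - cinner mu h g.
Proof.
move=> fL gL hL; rewrite cinnerC//; last exact: inL2B.
by rewrite cinnerBl// rmorphB /= (cinnerC fL hL) (cinnerC gL hL).
Qed.

Lemma cinnerZr c f g : L2 f -> L2 g ->
  cinner mu f (fun x => c * g x) = c^* * cinner mu f g.
Proof.
move=> fL gL; rewrite cinnerC//; last exact: inL2Z.
by rewrite cinnerZl// rmorphM/= (cinnerC gL fL).
Qed.

Lemma cinner_suml I (s : seq I) (F : I -> X -> R[i]) g :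
  (forall i, L2 (F i)) -> L2 g ->
  cinner mu (fun x => \sum_(i <- s) F i x) g = \sum_(i <- s) cinner mu (F i) g.
Proof.
move=> LF gL; elim: s => [|i s IH].
  rewrite big_nil (_ : (fun _ => _) = (fun x => 0 * g x)).
    by rewrite cinnerZl// mul0r.
  by apply/funext => x; rewrite big_nil mul0r.
rewrite big_cons -IH -cinnerDl//; last exact: inL2_sum.
by congr cinner; apply/funext => x; rewrite big_cons.
Qed.

Lemma cinner_sumr I (s : seq I) (F : I -> X -> R[i]) g :
  (forall i, L2 (F i)) -> L2 g ->
  cinner mu g (fun x => \sum_(i <- s) F i x) = \sum_(i <- s) cinner mu g (F i).
Proof.
move=> LF gL; rewrite cinnerC//; last exact: inL2_sum.
rewrite cinner_suml// rmorph_sum/=; apply: eq_bigr => i _.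
by rewrite [RHS]cinnerC.
Qed.

Lemma cinner_self f : L2 f -> cinner mu f f = (nrm mu f ^+ 2)%:C.
Proof.
move=> fL; apply: complexP => /=.
  rewrite sqr_nrm//; apply: eq_Rintegral => x _.
  by rewrite sqr_normcE !ReImE; ring.
rewrite (@eq_Rintegral _ _ _ _ _ (cst 0)); first by rewrite Rintegral_cst// mul0r.
by move=> x _; rewrite !ReImE /=; ring.
Qed.

Lemma cinner_ael f f' g : L2 f -> L2 f' -> L2 g -> f = f' %[ae mu] ->
  cinner mu f g = cinner mu f' g.
Proof.
move=> fL fL' gL ff'.
have [/(measurable_int mu) i1 /(measurable_int mu) i2] := cintegrable_ip fL gL.
have [/(measurable_int mu) i3 /(measurable_int mu) i4] := cintegrable_ip fL' gL.
apply: complexP; rewrite /= /Rintegral; congr fine.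
  by apply: ae_eq_integral => //; apply: filterS ff' => x /= /[apply] ->.
by apply: ae_eq_integral => //; apply: filterS ff' => x /= /[apply] ->.
Qed.

Lemma sqr_nrmB f g : L2 f -> L2 g ->
  nrm mu (fun x => f x - g x) ^+ 2 =
  nrm mu f ^+ 2 + nrm mu g ^+ 2 - 2 * Re (cinner mu f g).
Proof.
move=> fL gL; have fgL := inL2B fL gL.
have -> z : nrm mu z ^+ 2 = Re (nrm mu z ^+ 2)%:C by [].
rewrite -[in LHS]cinner_self// cinnerBl// !cinnerBr// !cinner_self// (cinnerC fL gL).
by rewrite !ReImE /=; ring.
Qed.

End InnerProduct.

(** Two families with the same Gram matrix span isometric spaces; the two
    families may live in different [L^2] spaces. *)
Lemma nrm_sum_gram d (X : measurableType d) d' (Y : measurableType d')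
    (R : realType) (mu : {measure set X -> \bar R}) (nu : {measure set Y -> \bar R})
    (I : Type) (s : seq I) (c : I -> R[i])
    (u : I -> X -> R[i]) (v : I -> Y -> R[i]) :
  (forall i, inLp mu 2%:E (u i)) -> (forall i, inLp nu 2%:E (v i)) ->
  (forall i j, cinner mu (u i) (u j) = cinner nu (v i) (v j)) ->
  nrm mu (fun x => \sum_(i <- s) c i * u i x) =
  nrm nu (fun y => \sum_(i <- s) c i * v i y).
Proof.
move=> Lu Lv uv.
have Lcu i : inLp mu 2%:E (fun x => c i * u i x) by exact: inL2Z.
have Lcv i : inLp nu 2%:E (fun x => c i * v i x) by exact: inL2Z.
have Su := inL2_sum s xpredT Lcu; have Sv := inL2_sum s xpredT Lcv.
apply/eqP; rewrite -(@eqrXn2 _ 2)// ?nrm_ge0//; apply/eqP.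
apply: (@complexI R); rewrite -!cinner_self//.
rewrite cinner_suml// [RHS]cinner_suml//; apply: eq_bigr => i _.
rewrite cinner_sumr// [RHS]cinner_sumr//; apply: eq_bigr => j _.
by rewrite !cinnerZl// !cinnerZr// uv.
Qed.

(** * Comparison of norms on a finite measure space *)

Section FiniteMeasure.
Context d (X : measurableType d) (R : realType) (mu : {measure set X -> \bar R}).
Hypothesis mu_fin : (mu setT < +oo)%E.
Implicit Types (f g h : X -> R[i]).

Local Notation L2 := (inLp mu 2%:E).

Lemma integrable_cst_fin (k : R) : mu.-integrable setT (EFin \o cst k).
Proof.
apply: measurable_bounded_integrable => //.
by exists `|k|; split; [rewrite num_real|move=> ? /ltW le x _ /=].
Qed.

Lemma inL2_bounded f K : cmeasurable setT f ->
  {ae mu, forall x, normc (f x) <= K} -> L2 f.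
Proof.
move=> mf fK; split => //; rewrite cLnorm2E; apply: poweR_lty.
apply: (@le_lt_trans _ _ (\int[mu]_x (K ^+ 2)%:E)%E).
  apply: ae_ge0_le_integral => //.
  - by move=> x _; rewrite lee_fin sqr_ge0.
  - exact/measurable_EFinP/measurable_sqnormc.
  - by move=> x _; rewrite lee_fin sqr_ge0.
  - apply: filterS fK => x fK _; rewrite lee_fin.
    by rewrite ler_sqr ?nnegrE ?normc_ge0// (le_trans _ fK) ?normc_ge0.
by rewrite integral_cst// lte_mul_pinfty// lee_fin sqr_ge0.
Qed.

Lemma nrm_le_bounded f K : cmeasurable setT f ->
  {ae mu, forall x, normc (f x) <= K} ->
  nrm mu f ^+ 2 <= K ^+ 2 * fine (mu setT).
Proof.
move=> mf fK; have fL := inL2_bounded mf fK.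
rewrite -lee_fin sqr_nrmE// EFinM fineK ?ge0_fin_numE// -integral_cst//.
apply: ae_ge0_le_integral => //.
- by move=> x _; rewrite lee_fin sqr_ge0.
- exact/measurable_EFinP/measurable_sqnormc.
- by move=> x _; rewrite lee_fin sqr_ge0.
- apply: filterS fK => x fK _; rewrite lee_fin.
  by rewrite ler_sqr ?nnegrE ?normc_ge0// (le_trans _ fK) ?normc_ge0.
Qed.

Lemma integrable_normc f : L2 f -> mu.-integrable setT (EFin \o (fun x => normc (f x))).
Proof.
move=> /inL2P [mf fi].
have I := integrableD measurableT (integrable_cst_fin 1) fi.
apply: le_integrable I => //; first exact/measurable_EFinP/measurable_normc.
move=> x _ /=; rewrite lee_fin (ger0_norm (normc_ge0 _)) ger0_norm.
  by have := sqr_ge0 (normc (f x) - 1); have := normc_ge0 (f x); rewrite sqrrB1; nra.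
by rewrite addr_ge0// sqr_ge0.
Qed.

Lemma integral_normc_le f : L2 f ->
  \int[mu]_x normc (f x) <= Num.sqrt (fine (mu setT)) * nrm mu f.
Proof.
move=> fL; rewrite -lee_fin EFinM -cLnormE//.
have mf := measurable_normc (inL2_meas fL).
have := @hoelder _ _ _ mu (fun x => normc (f x)) (cst 1) 2 2 mf
  (measurable_cst _) ltac:(by []) ltac:(by []).
have -> : (2^-1 + 2^-1 : R) = 1 by rewrite [RHS]splitr !div1r.
move=> /(_ erefl); rewrite Lnorm_cst1 Lnorm1 muleC.
have <- : (mu setT `^ 2^-1 = (Num.sqrt (fine (mu setT)))%:E)%E.
  by rewrite -[in LHS](@fineK _ (mu setT)) ?ge0_fin_numE// poweR_EFin powR12_sqrt// fine_ge0.
apply: le_trans; rewrite /Rintegral fineK; last exact: integrable_fin_num (integrable_normc fL).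
apply: ge0_le_integral => //=.
- by move=> x _; rewrite lee_fin normc_ge0.
- exact/measurable_EFinP.
- by do 2 apply: measurableT_comp => //; apply: measurable_funM.
- by move=> x _; rewrite mulr1 lee_fin ler_norm.
Qed.

End FiniteMeasure.

(** * Convergence in norm *)

Lemma ler_cvg0 (R : realType) (a b : R) (e : nat -> R) :
  e n @[n --> \oo] --> (0 : R) -> (forall n, a <= b + e n) -> a <= b.
Proof.
move=> e0 ab; have : b + e n @[n --> \oo] --> b + 0.
  by apply: cvgD => //; exact: cvg_cst.
by rewrite addr0 => /cvgr_to_ge; apply; exact: nearW.
Qed.

Section Convergence.
Context d (X : measurableType d) (R : realType) (mu : {measure set X -> \bar R}).
Local Notation L2 := (inLp mu 2%:E).

Lemma cvg_cLnormP I (F : set_system I) {FF : Filter F} (g : I -> X -> R[i]) :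
  (\forall i \near F, L2 (g i)) ->
  (cLnorm mu 2%:E (g i) @[i --> F] --> 0%E) <-> (nrm mu (g i) @[i --> F] --> (0 : R)).
Proof.
move=> gL; rewrite fine_cvgP; split=> [[_]//|g0]; split => //.
by apply: filterS gL => i gL; rewrite cLnormE.
Qed.

Lemma cvg_sqr0 I (F : set_system I) {FF : Filter F} (u : I -> R) :
  (u i ^+ 2 @[i --> F] --> (0 : R)) <-> (u i @[i --> F] --> (0 : R)).
Proof.
split=> [u0|u0]; last first.
  rewrite -[X in _ --> X](mulr0 (0 : R)); under eq_fun do rewrite expr2.
  exact: cvgM.
apply/cvgr0Pnorm_lt => e e0.
have e20 : 0 < e ^+ 2 by rewrite exprn_gt0.
apply: filterS ((cvgr0Pnorm_lt _).1 u0 _ e20) => i.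
by rewrite normrX ltr_sqr// nnegrE// ltW.
Qed.

Lemma cvg_sqnormcP I (F : set_system I) {FF : Filter F} (g : I -> X -> R[i]) :
  (\forall i \near F, L2 (g i)) ->
  ((\int[mu]_x (normc (g i x) ^+ 2)%:E)%E @[i --> F] --> 0%E) <->
  (nrm mu (g i) @[i --> F] --> (0 : R)).
Proof.
move=> gL; rewrite -cvg_sqr0 fine_cvgP; split=> [[_]|] H.
  apply: cvg_trans H; apply: near_eq_cvg; apply: filterS gL => i gL.
  by rewrite /= -sqr_nrmE.
split; first by apply: filterS gL => i gL; rewrite -sqr_nrmE.
apply: cvg_trans H; apply: near_eq_cvg; apply: filterS gL => i gL.
by rewrite /= -sqr_nrmE.
Qed.

Lemma inL2_lty f : cmeasurable setT f ->
  (\int[mu]_x (normc (f x) ^+ 2)%:E < +oo)%E -> L2 f.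
Proof.
move=> mf fi; apply/inL2P; split => //; apply/integrableP; split.
  exact/measurable_EFinP/measurable_sqnormc.
by under eq_integral do rewrite abse_EFin ger0_norm ?sqr_ge0//.
Qed.

Lemma sub_inL2 f g : L2 (fun x => f x - g x) -> L2 g -> L2 f.
Proof.
move=> fgL gL; have := inL2D fgL gL; congr (L2 _).
by apply/funext => x; rewrite subrK.
Qed.

End Convergence.

(** * The spectral measure of a vector *)

Section Resolution.
Context d (X : measurableType d) (R : realType) (mu : {measure set X -> \bar R}).
Variable E : R -> (X -> R[i]) -> (X -> R[i]).
Hypothesis resE : resolution_of_identity mu E.
Implicit Types (f g u v : X -> R[i]) (k l : R).
Local Notation L2 := (inLp mu 2%:E).

Lemma resolution_inL2 l f : L2 f -> L2 (E l f).
Proof. exact/L2op_stable/roi_operator. Qed.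

Local Hint Resolve resolution_inL2 : core.

Lemma cinner_resolutionr l f : L2 f ->
  cinner mu (E l f) f = (nrm mu (E l f) ^+ 2)%:C.
Proof.
move=> fL; rewrite -cinner_self//; last exact: resolution_inL2.
have EL := resolution_inL2 l fL; rewrite -(roi_selfadjoint resE)//.
apply: cinner_ael => //; first exact: resolution_inL2.
by apply: filterS (roi_mul resE l l fL) => x /= /[apply] ->; rewrite minxx.
Qed.

Lemma cinner_resolution k l f : L2 f ->
  cinner mu (E k f) (E l f) = (nrm mu (E (Num.min k l) f) ^+ 2)%:C.
Proof.
move=> fL; rewrite -cinner_resolutionr//.
have EL := resolution_inL2 k fL; rewrite -(roi_selfadjoint resE)//.
apply: cinner_ael => //; [exact: resolution_inL2..|].
by rewrite minC; exact: roi_mul.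
Qed.

Lemma nrm_resolution_le l f : L2 f -> nrm mu (E l f) <= nrm mu f.
Proof.
move=> fL; rewrite -ler_sqr ?nnegrE ?nrm_ge0//.
have EL := resolution_inL2 l fL.
have := sqr_ge0 (nrm mu (fun x => E l f x - f x)).
by rewrite sqr_nrmB// cinner_resolutionr//=; lra.
Qed.

(** The [E l] being increasing orthogonal projections, this is Pythagoras. *)
Lemma nrm_resolutionB k l f : L2 f -> k <= l ->
  nrm mu (fun x => E l f x - E k f x) ^+ 2 =
  nrm mu (E l f) ^+ 2 - nrm mu (E k f) ^+ 2.
Proof.
move=> fL kl; rewrite sqr_nrmB ?cinner_resolution//; [|exact: resolution_inL2..].
by rewrite (min_idPr kl)/=; lra.
Qed.

Lemma spectral_cumulative f : L2 f ->
  exists F : cumulative R R, forall l, F l = nrm mu (E l f) ^+ 2.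
Proof.
move=> fL; pose F l : R := nrm mu (E l f) ^+ 2.
have ndF : {homo F : x y / x <= y}.
  move=> k l kl; rewrite /F -subr_ge0 -nrm_resolutionB//; exact: sqr_ge0.
have rcF : forall l, F @ l^'+ --> F l.
  move=> l; rewrite -[X in _ --> X]addr0.
  have : F l + nrm mu (fun x => E k f x - E l f x) ^+ 2 @[k --> l^'+] --> F l + 0.
    apply: cvgD; first exact: cvg_cst.
    apply/cvg_sqr0; apply/cvg_cLnormP; last exact: roi_right_continuous.
    by near=> k; apply: inL2B; exact: resolution_inL2.
  apply: cvg_trans; apply: near_eq_cvg; near=> k.
  rewrite nrm_resolutionB// ?subrKC//.
pose mF := isCumulative.Build R _ R F ndF rcF.
by exists (HB.pack_for (cumulative R R) F mF).
Unshelve. all: by end_near. Qed.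

End Resolution.

(** The monotonicity and continuity proofs bundled in a distribution function
    do not distinguish it, so that the existentially quantified one in the
    definition of the spectral integral can be replaced by any other. *)
Lemma cumulative_eq (R : realType) (F G : cumulative R R) :
  (forall l, F l = G l) -> F = G.
Proof.
case: F G => [F [[n1 r1]]] [G [[n2 r2]]] /= /funext FG; rewrite {}FG in n1 r1 *.
by rewrite (Prop_irrelevance n1 n2) (Prop_irrelevance r1 r2).
Qed.

Section SpectralMeasure.
Context d (X : measurableType d) (R : realType) (mu : {measure set X -> \bar R}).
Variable E : R -> (X -> R[i]) -> (X -> R[i]).
Hypothesis resE : resolution_of_identity mu E.
Variable f : X -> R[i].
Hypothesis fL : inLp mu 2%:E f.
Variable F : cumulative R R.
Hypothesis FE : forall l, F l = nrm mu (E l f) ^+ 2.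
Local Notation L2 := (inLp mu 2%:E).
Local Notation nu := (lebesgue_stieltjes_measure F).

Lemma spectral_cdf_ninfty : F l @[l --> -oo] --> (0 : R).
Proof.
under eq_fun do rewrite FE; apply/cvg_sqr0/cvg_cLnormP; last exact: roi_ninfty.
by near=> l; exact: resolution_inL2.
Unshelve. all: by end_near. Qed.

Lemma spectral_cdf_pinfty : F l @[l --> +oo] --> nrm mu f ^+ 2.
Proof.
under eq_fun do rewrite FE.
have H : nrm mu (fun x => E l f x - f x) @[l --> +oo] --> (0 : R).
  apply/cvg_cLnormP; last exact: roi_pinfty.
  by near=> l; apply: inL2B => //; exact: resolution_inL2.
suff : nrm mu (E l f) @[l --> +oo] --> nrm mu f.
  by move=> ?; rewrite expr2; under eq_fun do rewrite expr2; exact: cvgM.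
apply: (@squeeze_cvgr _ _ _ _ (fun l => nrm mu f - nrm mu (fun x => E l f x - f x))
  (fun=> nrm mu f)); last exact: cvg_cst.
  near=> l; rewrite nrm_resolution_le// andbT lerBlDr.
  have EL := resolution_inL2 resE l fL.
  have := nrmB EL (inL2B EL fL); congr (nrm _ _ <= _).
  by apply/funext => x; rewrite opprB addrCA subrr addr0.
rewrite -[X in _ --> X]subr0; apply: cvgB => //; exact: cvg_cst.
Unshelve. all: by end_near. Qed.

Lemma stieltjes_itv (a b : R) : a <= b -> nu `]a, b]%classic = (F b - F a)%:E.
Proof.
move=> ab; rewrite /lebesgue_stieltjes_measure /measure_extension/=.
by rewrite measurable_mu_extE/= ?wlength_itv_bnd//; exact: is_ocitv.
Qed.

Lemma stieltjes_halfline (b : R) : nu `]-oo, b]%classic = (F b)%:E.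
Proof.
rewrite itvNybndEbigcup.
have : nu `]- n%:R, b]%classic @[n --> \oo] --> (F b)%:E.
  suff : ((F b)%:E - (F (- n%:R))%:E)%E @[n --> \oo] --> (F b)%:E.
    apply: cvg_trans; apply: near_eq_cvg; near=> n.
    by rewrite stieltjes_itv// lerNl; near: n; exact: nbhs_infty_ger.
  rewrite -[X in _ --> X](sube0 (F b)%:E); apply: (cvgeB _ (cvg_cst _)) => //.
  apply: cvg_EFin; first by near=> n.
  apply: (cvg_comp _ _ _ spectral_cdf_ninfty).
  by apply: (cvg_comp _ _ cvgr_idn); rewrite ninfty.
have : nu `]- n%:R, b]%classic @[n --> \oo] --> nu (\bigcup_n `]- n%:R, b]%classic).
  apply: nondecreasing_cvg_mu => //; first exact: bigcup_measurable.
  by move=> *; apply/subsetPset/subset_itv; rewrite leBSide//= lerN2 ler_nat.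
exact: cvg_unique.
Unshelve. all: by end_near. Qed.

Lemma stieltjes_setT : nu setT = (nrm mu f ^+ 2)%:E.
Proof.
have -> : [set: R] = \bigcup_n `]-oo, n%:R]%classic.
  apply/seteqP; split => // x _; exists (Num.truncn `|x|).+1 => //=.
  by rewrite in_itv/= (le_trans (ler_norm _))// ltW// truncnS_gt.
have : nu `]-oo, n%:R]%classic @[n --> \oo] --> (nrm mu f ^+ 2)%:E.
  under eq_fun do rewrite stieltjes_halfline.
  apply: cvg_EFin; first by near=> n.
  exact: (cvg_comp _ _ cvgr_idn spectral_cdf_pinfty).
have : nu `]-oo, n%:R]%classic @[n --> \oo] --> nu (\bigcup_n `]-oo, n%:R]%classic).
  apply: nondecreasing_cvg_mu => //; first exact: bigcup_measurable.
  by move=> *; apply/subsetPset/subset_itv; rewrite// leBSide//= ler_nat.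
exact: cvg_unique.
Unshelve. all: by end_near. Qed.

Lemma stieltjes_fin : (nu setT < +oo)%E.
Proof. by rewrite stieltjes_setT ltry. Qed.

(** The half-lines are the model of the vectors [E b f] in [L^2(nu)]. *)
Definition halfline (b l : R) : R[i] := (\1_(`]-oo, b]%classic : set R) l)%:C.

Lemma halfline_inL2 b : inLp nu 2%:E (halfline b).
Proof.
apply: (@inL2_bounded _ _ _ _ stieltjes_fin _ 1).
  by apply: cmeasurable_real; exact: measurable_indic.
by apply: aeW => l; rewrite normcC indicE; case: (_ \in _); rewrite ?normr1 ?normr0.
Qed.

Lemma cinner_halfline a b :
  cinner nu (halfline a) (halfline b) = (F (Num.min a b))%:C.
Proof.
have E1 l : halfline a l * (halfline b l)^* = halfline (Num.min a b) l.
  apply: complexP; rewrite !ReImE /= ?(oppr0, mulr0, mul0r, addr0, subr0)//.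
  rewrite -[RHS](congr1 (fun A => \1_A l) (_ : `]-oo, a] `&` `]-oo, b] = _)).
    by rewrite indicI.
  by apply/seteqP; split => x /=; rewrite !in_itv/= le_min => /andP.
rewrite /cinner (_ : (fun _ => _) = halfline (Num.min a b)); last exact/funext.
apply: complexP => /=; last by rewrite Rintegral_cst// mul0r.
rewrite /Rintegral integral_indic// setIT.
exact: (congr1 fine (stieltjes_halfline (Num.min a b))).
Qed.

End SpectralMeasure.

(** * The isometry of the spectral integral *)

Section StepFunctions.
Context (R : realType).
Implicit Types (s : seq (R[i] * (R * R))).

Definition scale_steps (c : R[i]) s := [seq (c * q.1, q.2) | q <- s].

Lemma step_fun_cat s s' l : step_fun (s ++ s') l = step_fun s l + step_fun s' l.
Proof. by rewrite /step_fun big_cat. Qed.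

Lemma step_fun_scale c s l : step_fun (scale_steps c s) l = c * step_fun s l.
Proof. by rewrite /step_fun big_map/= mulr_sumr. Qed.

Lemma halflineE b l : halfline b l = (if l <= b then 1 else 0) :> R[i].
Proof. by rewrite /halfline indicE mem_setE in_itv/=; case: ifP. Qed.

Lemma step_fun_halfline s l : step_fun s l =
  \sum_(q <- s) (if q.2.1 < q.2.2 then q.1 else 0) *
                (halfline q.2.2 l - halfline q.2.1 l).
Proof.
rewrite /step_fun [LHS]big_mkcond; apply: eq_bigr => -[c [a b]] _ /=.
rewrite !halflineE; case: (leP l a) => [la|al] /=.
  case: ifPn => ab; last by rewrite mul0r.
  by rewrite (le_trans la (ltW ab)) subrr mulr0.
case: (leP l b) => [lb|bl] /=; last by rewrite subrr mulr0.
by rewrite (lt_le_trans al lb) subr0 mulr1.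
Qed.

Lemma cmeasurable_step_fun s : cmeasurable setT (step_fun s).
Proof.
rewrite (funext (step_fun_halfline s)); apply: cmeasurable_sum => q.
apply: cmeasurableM; first exact: cmeasurable_cst.
by apply: cmeasurableB; apply: cmeasurable_real; exact: measurable_indic.
Qed.

Context d (X : measurableType d) (E : R -> (X -> R[i]) -> (X -> R[i])).
Implicit Types f : X -> R[i].

Lemma step_integral_cat s s' f x :
  step_integral E (s ++ s') f x = step_integral E s f x + step_integral E s' f x.
Proof. by rewrite /step_integral big_cat. Qed.

Lemma step_integral_scale c s f x :
  step_integral E (scale_steps c s) f x = c * step_integral E s f x.
Proof.
by rewrite /step_integral big_map/= mulr_sumr; apply: eq_bigr => q _; rewrite mulrA.
Qed.

Lemma step_integralE s f x : step_integral E s f x =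
  \sum_(q <- s) (if q.2.1 < q.2.2 then q.1 else 0) * (E q.2.2 f x - E q.2.1 f x).
Proof.
rewrite /step_integral [LHS]big_mkcond; apply: eq_bigr => q _.
by case: ifPn => // _; rewrite mul0r.
Qed.

End StepFunctions.

Section SpectralIsometry.
Context d (X : measurableType d) (R : realType) (mu : {measure set X -> \bar R}).
Variable E : R -> (X -> R[i]) -> (X -> R[i]).
Hypothesis resE : resolution_of_identity mu E.
Local Notation L2 := (inLp mu 2%:E).

Lemma step_integral_inL2 s f : L2 f -> L2 (step_integral E s f).
Proof.
move=> fL; apply: inL2_sum => q; apply: inL2Z.
by apply: inL2B; exact: resolution_inL2.
Qed.

Section FixedVector.
Variable f : X -> R[i].
Hypothesis fL : L2 f.
Variable F : cumulative R R.
Hypothesis FE : forall l, F l = nrm mu (E l f) ^+ 2.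
Local Notation nu := (lebesgue_stieltjes_measure F).

Lemma step_fun_inL2 s : inLp nu 2%:E (step_fun s).
Proof.
rewrite (funext (step_fun_halfline s)); apply: inL2_sum => q.
by apply: inL2Z; apply: inL2B; exact: (halfline_inL2 resE fL FE).
Qed.

(** The isometry behind the spectral integral: the vectors [E a f] and the
    indicators of the half-lines ending at [a] have the same Gram matrix,
    namely [F (Num.min a b)]. *)
Lemma nrm_step_integral s : nrm mu (step_integral E s f) = nrm nu (step_fun s).
Proof.
rewrite (funext (step_fun_halfline s)) (funext (step_integralE E s f)).
have EL l := resolution_inL2 resE l fL; have HL := halfline_inL2 resE fL FE.
have EBL (q : R[i] * (R * R)) := inL2B (EL q.2.2) (EL q.2.1).
have HBL (q : R[i] * (R * R)) := inL2B (HL q.2.2) (HL q.2.1).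
apply: (nrm_sum_gram _ _ EBL HBL) => p q.
rewrite (cinnerBl (EL _) (EL _) (EBL _)) !(cinnerBr (EL _) (EL _) (EL _)).
rewrite [RHS](cinnerBl (HL _) (HL _) (HBL _)) ![in RHS](cinnerBr (HL _) (HL _) (HL _)).
by rewrite !(cinner_halfline resE fL FE) !cinner_resolution// !FE.
Qed.

Lemma nrm_step_integralB s s' :
  nrm mu (fun x => step_integral E s f x - step_integral E s' f x) =
  nrm nu (fun l => step_fun s l - step_fun s' l).
Proof.
have := nrm_step_integral (s ++ scale_steps (- 1) s'); congr (_ = _).
  by congr nrm; apply/funext => x; rewrite step_integral_cat step_integral_scale mulN1r.
by congr nrm; apply/funext => x; rewrite step_fun_cat step_fun_scale mulN1r.
Qed.

(** The definition of the spectral integral, for the distribution function at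
    hand and in terms of real norms. *)
Lemma spectral_integralP (phi : R -> R[i]) u : inLp nu 2%:E phi ->
  spectral_integral mu E phi f u <-> L2 u /\
  exists s : nat -> seq (R[i] * (R * R)),
    nrm nu (fun l => phi l - step_fun (s n) l) @[n --> \oo] --> (0 : R) /\
    nrm mu (fun x => step_integral E (s n) f x - u x) @[n --> \oo] --> (0 : R).
Proof.
move=> phiL.
have nuL (s : nat -> seq (R[i] * (R * R))) :
    \forall n \near \oo, inLp nu 2%:E (fun l => phi l - step_fun (s n) l).
  by apply: nearW => n; apply: inL2B => //; exact: step_fun_inL2.
have muL (s : nat -> seq (R[i] * (R * R))) : L2 u ->
    \forall n \near \oo, L2 (fun x => step_integral E (s n) f x - u x).
  by move=> uL; apply: nearW => n; apply: inL2B => //; exact: step_integral_inL2.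
split.
  move=> [_ uL [G [GE [s [s1 s2]]]]]; split=> //; exists s.
  have GF : G = F by apply: cumulative_eq => l; rewrite GE FE.
  by subst G; split; [exact: (cvg_sqnormcP (nuL s)).1
                     |exact: (cvg_cLnormP (muL s uL)).1].
move=> [uL [s [s1 s2]]]; split=> //; exists F; split; first by move=> l; rewrite FE.
by exists s; split; [exact: (cvg_sqnormcP (nuL s)).2
                    |exact: (cvg_cLnormP (muL s uL)).2].
Qed.

(** The isometry, extended from step functions to their limits. *)
Lemma spectral_integral_dist (phi psi : R -> R[i]) u v :
  inLp nu 2%:E phi -> inLp nu 2%:E psi ->
  spectral_integral mu E phi f u -> spectral_integral mu E psi f v ->
  nrm mu (fun x => u x - v x) <= nrm nu (fun l => phi l - psi l).
Proof.
move=> phiL psiL /(spectral_integralP _ phiL)[uL [s [s1 s2]]].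
move=> /(spectral_integralP _ psiL)[vL [s' [s1' s2']]].
have lim0 : (nrm mu (fun x => step_integral E (s n) f x - u x) +
    nrm nu (fun l => phi l - step_fun (s n) l)) +
   (nrm mu (fun x => step_integral E (s' n) f x - v x) +
    nrm nu (fun l => psi l - step_fun (s' n) l)) @[n --> \oo] --> (0 + 0 + (0 + 0) : R).
  by apply: cvgD; exact: cvgD.
rewrite !addr0 in lim0.
apply: (ler_cvg0 lim0) => n.
have SL t := step_integral_inL2 t fL; have FL := step_fun_inL2.
have h1 := nrm_dist uL (SL (s n)) vL.
have h2 := nrm_dist (SL (s n)) (SL (s' n)) vL.
have h3 := nrm_dist (FL (s n)) phiL (FL (s' n)).
have h4 := nrm_dist phiL psiL (FL (s' n)).
move: h1 h2 h3 h4; rewrite nrm_step_integralB.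
rewrite (nrm_distC mu u (step_integral E (s n) f)) (nrm_distC nu (step_fun (s n)) phi) => h1 h2 h3 h4.
lra.
Qed.

End FixedVector.
End SpectralIsometry.

(** * Completeness *)

Lemma limn_einf_le (R : realType) (u : (\bar R)^nat) (c : \bar R) :
  (forall n, u n <= c)%E -> (limn_einf u <= c)%E.
Proof.
move=> uc; rewrite limn_einf_lim; apply: lime_le; first exact: is_cvg_einfs.
apply: nearW => n; apply: le_trans (uc n).
by apply: ereal_inf_lbound; exists n => /=.
Qed.

Section RieszFischer.
Context d (X : measurableType d) (R : realType) (mu : {measure set X -> \bar R}).
Hypothesis mu_fin : (mu setT < +oo)%E.
Local Notation L2 := (inLp mu 2%:E).
Variables (u : nat -> X -> R[i]) (K : R).
Hypothesis uL : forall n, L2 (u n).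
Hypothesis uK : forall n,
  nrm mu (fun x => u n.+1 x - u n x) <= K / (2 ^ n.+1)%:R.

Let nrm_tail n m : nrm mu (fun x => u (n + m) x - u n x) <= K / (2 ^ n)%:R.
Proof.
suff : nrm mu (fun x => u (n + m) x - u n x) <= K / (2 ^ n)%:R - K / (2 ^ (n + m))%:R.
  move/le_trans; apply; rewrite gerBl divr_ge0//.
  have := le_trans (nrm_ge0 _ _) (uK 0).
  by rewrite pmulr_lge0// invr_gt0 ltr0n expn_gt0.
elim: m => [|m IH].
  rewrite addn0 subrr; under eq_fun do rewrite subrr.
  by rewrite nrm0.
rewrite addnS; apply: le_trans (nrm_dist (uL _) (uL (n + m)) (uL _)) _.
apply: le_trans (lerD (uK _) IH) _.
rewrite expnS natrM invfM !mulrA; set a := (_ / (2 ^ n)%:R).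
by rewrite -[K / 2 / _]mulrA (mulrC 2^-1) mulrA; set b := (_ / (2 ^ (n + m))%:R); lra.
Qed.

Let G x := (\sum_(0 <= n <oo) (normc (u n.+1 x - u n x))%:E)%E.

Let mincr n : measurable_fun setT (fun x => (normc (u n.+1 x - u n x))%:E).
Proof. by apply/measurable_EFinP/measurable_normc; case: (inL2B (uL n.+1) (uL n)). Qed.

Let G_fin : {ae mu, forall x, G x \is a fin_num}.
Proof.
have mG : measurable_fun setT G.
  by apply: ge0_emeasurable_sum => // n x _ _; rewrite lee_fin normc_ge0.
have G0 x : (0 <= G x)%E by apply: nneseries_ge0 => n _ _; rewrite lee_fin normc_ge0.
suff GI : mu.-integrable setT G.
  by apply: filterS (integrable_ae measurableT GI) => x; exact.
apply/integrableP; split => //; under eq_integral do rewrite gee0_abs//.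
rewrite integral_nneseries//; last by move=> n x _; rewrite lee_fin normc_ge0.
set C := Num.sqrt (fine (mu setT)).
apply: (@le_lt_trans _ _ (\sum_(0 <= n <oo) ((C * K) / (2 ^ (n + 1))%:R)%:E)%E).
  apply: lee_nneseries => n _; first by move=> _; apply: integral_ge0 => x _; rewrite lee_fin normc_ge0.
  have uuL := inL2B (uL n.+1) (uL n).
  have := integral_normc_le mu_fin uuL; rewrite -lee_fin /Rintegral fineK.
    move/le_trans; apply; rewrite lee_fin -mulrA ler_wpM2l ?sqrtr_ge0//.
    by rewrite addn1; exact: uK.
  exact: integrable_fin_num (integrable_normc mu_fin uuL).
by rewrite (cvg_lim _ (@cvg_geometric_eseries_half _ (C * K) 0))// ltry.
Qed.

(** Completeness of [L^2] for sequences with geometric increments: such a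
    sequence is almost everywhere absolutely summable, and Fatou's lemma turns
    the pointwise limit into a limit in norm. *)
Lemma geometric_cvg_L2 :
  exists2 v, L2 v & nrm mu (fun x => u n x - v x) @[n --> \oo] --> (0 : R).
Proof.
have mG : measurable_fun setT G.
  by apply: ge0_emeasurable_sum => // n x _ _; rewrite lee_fin normc_ge0.
pose A := [set x | G x \is a fin_num].
have mA : measurable A by have := emeasurable_fin_num measurableT mG; rewrite setTI.
pose w n x : R[i] := u n x * (\1_A x)%:C.
have wu n : w n = u n %[ae mu].
  apply: filterS G_fin => x Gx _; rewrite /w indicE mem_set//.
  by rewrite mulr1.
have mw n : cmeasurable setT (w n).
  apply: cmeasurableM; first exact: inL2_meas (uL n).
  by apply: cmeasurable_real; exact: measurable_indic.
have wL n : L2 (w n).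
  case: (uL n) => mu_ ufin; split => //.
  by rewrite (ae_eq_Lnorm 2 (wu n)).
have cvgw (h : R[i] -> R) : (forall z z', h (z - z') = h z - h z') ->
    (forall z, `|h z| <= normc z) -> h 0 = 0 -> forall x, cvgn (fun n => h (w n x)).
  move=> hB hle h0 x; have [Ax|nAx] := boolP (x \in A); last first.
    rewrite (_ : (fun n => _) = fun=> 0); first exact: is_cvg_cst.
    by apply/funext => n; rewrite /w indicE (negbTE nAx) mulr0.
  rewrite (_ : (fun n => _) = fun n => h (u n x)); last first.
    by apply/funext => n; rewrite /w indicE Ax mulr1.
  have : cvgn (series (fun n => h (u n.+1 x) - h (u n x))).
    apply: normed_cvg; apply: nnseries_is_cvg => [n|/=]; first exact: normr_ge0.
    apply: (@le_lt_trans _ _ (G x)); last first.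
      by rewrite -ge0_fin_numE; [exact: set_mem Ax|apply: nneseries_ge0 => n _ _; rewrite lee_fin normc_ge0].
    apply: lee_nneseries => n _; first by move=> _; rewrite lee_fin.
    by rewrite lee_fin -hB.
  move=> /cvg_ex[l sl]; apply/cvg_ex; exists (h (u 0 x) + l).
  rewrite (_ : (fun n => _) = fun n =>
     h (u 0 x) + series (fun n => h (u n.+1 x) - h (u n x)) n); last first.
    by apply/funext => n; rewrite /series/= telescope_sumr// addrC subrK.
  by apply: cvgD => //; exact: cvg_cst.
have cvgRe := cvgw (@complex.Re R) _ (@ler_Re_normc R) erefl.
have cvgIm := cvgw (@complex.Im R) _ (@ler_Im_normc R) erefl.
have {}cvgRe x : cvgn (fun n => Re (w n x)) by apply: cvgRe => z z'; rewrite cReD cReN.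
have {}cvgIm x : cvgn (fun n => Im (w n x)) by apply: cvgIm => z z'; rewrite cImD cImN.
pose v x := limn (fun n => Re (w n x)) +i* limn (fun n => Im (w n x)).
have mv : cmeasurable setT v.
  split => /=.
    apply: (@measurable_fun_cvg _ _ _ _ (fun n x => Re (w n x))) => [n|x _].
      by case: (mw n).
    exact: cvgRe.
  apply: (@measurable_fun_cvg _ _ _ _ (fun n x => Im (w n x))) => [n|x _].
    by case: (mw n).
  exact: cvgIm.
have vw n : L2 (fun x => v x - w n x) /\ nrm mu (fun x => v x - w n x) <= K / (2 ^ n)%:R.
  have mvw : cmeasurable setT (fun x => v x - w n x) by exact: cmeasurableB.
  have bnd : (\int[mu]_x (normc (v x - w n x) ^+ 2)%:E <= ((K / (2 ^ n)%:R) ^+ 2)%:E)%E.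
    pose g m x := ((normc (w (n + m)%N x - w n x)) ^+ 2)%:E.
    have gv x : limn_einf (g ^~ x) = ((normc (v x - w n x)) ^+ 2)%:E.
      suff : g m x @[m --> \oo] --> ((normc (v x - w n x)) ^+ 2)%:E.
        by move/cvg_limn_einf_sup => [].
      apply: cvg_EFin; first by near=> m.
      rewrite (_ : fine \o _ = fun m => (Re (w (n + m)%N x) - Re (w n x)) ^+ 2 +
          (Im (w (n + m)%N x) - Im (w n x)) ^+ 2); last first.
        by apply/funext => m /=; rewrite sqr_normcE !ReImE.
      rewrite sqr_normcE.
      have sh (a : nat -> R) : cvgn a -> a (n + m)%N @[m --> \oo] --> limn a.
        by move=> ca; exact: (cvg_comp _ _ (cvg_addnl n) ca).
      rewrite !ReImE; apply: cvgD.
        rewrite expr2; under eq_fun do rewrite expr2.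
        by apply: cvgM; apply: cvgB; [exact: sh|exact: cvg_cst|exact: sh|exact: cvg_cst].
      rewrite expr2; under eq_fun do rewrite expr2.
      by apply: cvgM; apply: cvgB; [exact: sh|exact: cvg_cst|exact: sh|exact: cvg_cst].
    under eq_integral do rewrite -gv.
    apply: le_trans (fatou mu measurableT _ _) _.
    - by move=> m; apply/measurable_EFinP/measurable_sqnormc; exact: cmeasurableB.
    - by move=> m x _; rewrite lee_fin sqr_ge0.
    apply: limn_einf_le => m; rewrite -sqr_nrmE; last exact: inL2B.
    rewrite lee_fin (@nrm_ae _ _ _ _ _ (fun x => u (n + m) x - u n x)).
    - by rewrite ler_sqr ?nnegrE ?nrm_ge0// (le_trans _ (nrm_tail n m)) ?nrm_ge0.
    - exact: inL2B.
    - exact: inL2B.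
    by apply: filterS2 (wu n) (wu (n + m)) => x /(_ I) -> /(_ I) ->.
  have vwL : L2 (fun x => v x - w n x).
    by apply: inL2_lty => //; exact: le_lt_trans bnd (ltry _).
  split => //; move: bnd; rewrite -sqr_nrmE// lee_fin ler_sqr ?nnegrE ?nrm_ge0//.
  exact: le_trans (nrm_ge0 _ _) (nrm_tail n 0).
have vL : L2 v by apply: sub_inL2 (vw 0).1 (wL 0).
exists v => //.
apply: (@squeeze_cvgr _ _ _ _ (fun=> 0) (fun n => K / (2 ^ n)%:R)).
- apply: nearW => n; rewrite nrm_ge0/= (@nrm_ae _ _ _ _ _ (fun x => w n x - v x)).
  + by rewrite nrm_distC; exact: (vw n).2.
  + exact: inL2B.
  + exact: inL2B.
  by apply: filterS (wu n) => x /(_ I) ->.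
- exact: cvg_cst.
rewrite -(mulr0 K); apply: cvgM; first exact: cvg_cst.
under eq_fun do rewrite natrX -exprVn.
by apply: cvg_expr; rewrite ger0_norm ?invf_lt1 ?ltr1n.
Unshelve. all: by end_near. Qed.

End RieszFischer.

(** * Step functions on a grid and dominated convergence *)

Section RealFacts.
Context (R : realType).
Implicit Types x y : R.

Lemma expRN_le_quad x : 0 <= x -> `|1 - x - expR (- x)| <= x ^+ 2.
Proof.
move=> x0; have h1 := expR_ge1Dx (- x); have h2 := expR_ge1Dx x.
rewrite ler0_norm; last by lra.
have e0 := expR_gt0 x.
have : expR (- x) <= 1 - x + x ^+ 2; last by lra.
rewrite expRN -div1r ler_pdivrMr//.
have : 0 <= 1 - x + x ^+ 2 by nra.
move=> q0; apply: le_trans (ler_wpM2l q0 h2).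
have -> : (1 - x + x ^+ 2) * (1 + x) = 1 + x ^+ 3 by ring.
by rewrite lerDl exprn_ge0.
Qed.

Lemma expRN_lip x y : 0 <= x -> x <= y -> `|expR (- x) - expR (- y)| <= y - x.
Proof.
move=> x0 xy; rewrite ger0_norm; last by rewrite subr_ge0 ler_expR; lra.
have -> : expR (- y) = expR (- x) * expR (- (y - x)) by rewrite -expRD; congr expR; ring.
have h1 := expR_ge1Dx (- (y - x)).
have h2 : expR (- x) <= 1 by rewrite -expR0 ler_expR; lra.
have h3 := expR_gt0 (- x); have h4 := expR_gt0 (- (y - x)).
nra.
Qed.

Lemma expRN_le1 x : 0 <= x -> expR (- x) <= 1.
Proof. by move=> x0; rewrite -expR0 ler_expR; lra. Qed.

End RealFacts.

Section Grid.
Context (R : realType) (x : nat -> R).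
Hypothesis x_incr : forall i, x i < x i.+1.
Variable v : nat -> R[i].
Implicit Types (i k : nat) (l : R).

Definition grid k : seq (R[i] * (R * R)) := [seq (v i, (x i, x i.+1)) | i <- iota 0 k].

Let x_le i j : (i <= j)%N -> x i <= x j.
Proof. by apply: (homo_leq (@lexx _ _) (@le_trans _ _)) => k; exact: ltW. Qed.

Lemma step_fun_gridS k l : step_fun (grid k.+1) l =
  step_fun (grid k) l + (if x k < l <= x k.+1 then v k else 0).
Proof.
have E : iota 0 k.+1 = iota 0 k ++ [:: k] by rewrite -addn1 iotaD.
rewrite /grid E map_cat step_fun_cat; congr (_ + _).
by rewrite /step_fun big_cons big_nil/=; case: ifP => _; rewrite ?addr0.
Qed.

Lemma step_fun_grid_right k l : x k < l -> step_fun (grid k) l = 0.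
Proof.
elim: k => [|k IH] kl; first by rewrite /step_fun big_nil.
rewrite step_fun_gridS (leNgt l) kl andbF addr0 IH//.
exact: lt_trans kl.
Qed.

Lemma step_fun_grid_left k l : l <= x 0 -> step_fun (grid k) l = 0.
Proof.
move=> l0; elim: k => [|k IH]; first by rewrite /step_fun big_nil.
rewrite step_fun_gridS IH add0r [x k < l]ltNge.
by rewrite (le_trans l0 (x_le (leq0n k))).
Qed.

Lemma step_fun_grid k l : x 0 < l <= x k ->
  exists2 i, (i < k)%N & x i < l <= x i.+1 /\ step_fun (grid k) l = v i.
Proof.
elim: k => [|k IH] /andP[x0l lxk].
  by move: (lt_le_trans x0l lxk); rewrite ltxx.
rewrite step_fun_gridS; have [lk|kl] := leP l (x k).
  have [|i ik [xi ->]] := IH; first by rewrite x0l.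
  by exists i; [exact: ltnW|rewrite addr0].
exists k => //; split; first by rewrite kl.
by rewrite lxk step_fun_grid_right// add0r.
Qed.

Lemma step_fun_grid_bounded k l (C : R) :
  0 <= C -> (forall i, (i < k)%N -> normc (v i) <= C) ->
  normc (step_fun (grid k) l) <= C.
Proof.
move=> C0 vC; have [l0|x0] := leP l (x 0).
  by rewrite step_fun_grid_left// normc0.
have [lk|kl] := leP l (x k); last by rewrite step_fun_grid_right// normc0.
by have [|i ik [_ ->]] := @step_fun_grid k l; [rewrite x0|exact: vC].
Qed.

Lemma step_integral_grid d (X : measurableType d) (E : R -> (X -> R[i]) -> (X -> R[i])) f k y :
  step_integral E (grid k) f y = \sum_(0 <= i < k) v i * (E (x i.+1) f y - E (x i) f y).
Proof.
rewrite /step_integral /grid big_map /= big_mkcond /= /index_iota subn0.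
by apply: eq_bigr => i _; rewrite x_incr.
Qed.

End Grid.

Lemma nrm_dominated_cvg d (X : measurableType d) (R : realType)
    (mu : {measure set X -> \bar R}) (g : nat -> X -> R[i]) (G : X -> R) :
  (forall n, cmeasurable setT (g n)) ->
  mu.-integrable setT (EFin \o (fun x => G x ^+ 2)) ->
  {ae mu, forall x n, normc (g n x) <= G x} ->
  {ae mu, forall x, normc (g n x) @[n --> \oo] --> (0 : R)} ->
  nrm mu (g n) @[n --> \oo] --> (0 : R).
Proof.
move=> mg iG gG g0.
have gG2 : {ae mu, forall x n, normc (g n x) ^+ 2 <= G x ^+ 2}.
  apply: filterS gG => x gx n.
  have Gx : 0 <= G x := le_trans (normc_ge0 _) (gx n).
  by rewrite ler_sqr ?nnegrE ?normc_ge0.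
have gL n : inLp mu 2%:E (g n).
  apply: inL2_lty => //; move/integrableP : iG => [mG]; apply: le_lt_trans.
  apply: ae_ge0_le_integral => //.
  - by move=> x _; rewrite lee_fin sqr_ge0.
  - exact/measurable_EFinP/measurable_sqnormc.
  - exact: measurableT_comp.
  - apply: filterS gG2 => x gx _; rewrite /= lee_fin.
    exact: le_trans (gx n) (ler_norm _).
have nL : \forall n \near \oo, inLp mu 2%:E (g n) by exact: nearW.
apply: (cvg_sqnormcP nL).1.
have [] := @dominated_convergence _ _ _ mu setT measurableT
  (fun n x => (normc (g n x) ^+ 2)%:E) (cst 0%E) (fun x => (G x ^+ 2)%:E).
- by move=> n; apply/measurable_EFinP/measurable_sqnormc.
- exact: measurable_cst.
- apply: filterS g0 => x gx _; apply: cvg_EFin; first exact: nearW.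
  exact/cvg_sqr0.
- exact: iG.
- apply: filterS gG2 => x gx n _.
  by rewrite abse_EFin lee_fin ger0_norm ?sqr_ge0.
by move=> _ _; rewrite integral0.
Qed.

(** * Linear operators defined up to null sets *)

Section Operators.
Context d (X : measurableType d) (R : realType) (mu : {measure set X -> \bar R}).
Local Notation L2 := (inLp mu 2%:E).
Variable S : (X -> R[i]) -> (X -> R[i]).
Hypothesis opS : L2_operator mu S.

Lemma L2op_add f g : L2 f -> L2 g ->
  S (fun x => f x + g x) = (fun x => S f x + S g x) %[ae mu].
Proof.
move=> fL gL; have := L2op_linear opS 1 fL gL.
rewrite (_ : (fun x => 1 * f x + g x) = (fun x => f x + g x)).
  by apply: filterS => x /= /[apply] ->; rewrite mul1r.
by apply/funext => x; rewrite mul1r.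
Qed.

Lemma L2op_sub f g : L2 f -> L2 g ->
  S (fun x => f x - g x) = (fun x => S f x - S g x) %[ae mu].
Proof.
move=> fL gL; have := L2op_linear opS (- 1) gL fL.
rewrite (_ : (fun x => - 1 * g x + f x) = (fun x => f x - g x)).
  by apply: filterS => x /= /[apply] ->; rewrite mulN1r addrC.
by apply/funext => x; rewrite mulN1r addrC.
Qed.

Lemma L2op0 : S (fun=> 0) = (fun=> 0) %[ae mu].
Proof.
have := L2op_sub (inL2_0 mu) (inL2_0 mu).
rewrite (_ : (fun x => 0 - 0) = (fun=> 0)); last by apply/funext => x; rewrite subrr.
by apply: filterS => x /= /[apply] ->; rewrite subrr.
Qed.

Lemma L2op_scale c f : L2 f -> S (fun x => c * f x) = (fun x => c * S f x) %[ae mu].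
Proof.
move=> fL; have := L2op_linear opS c fL (inL2_0 mu).
rewrite (_ : (fun x => c * f x + 0) = (fun x => c * f x)).
  by apply: filterS2 L2op0 => x /= /(_ I) -> /[apply] ->; rewrite addr0.
by apply/funext => x; rewrite addr0.
Qed.

End Operators.

(** * Approximate eigenvectors of the generator *)

Lemma ae_stieltjesS (R : realType) (F : cumulative R R) (P Q : R -> Prop) :
  (forall l, P l -> Q l) -> {ae lebesgue_stieltjes_measure F, forall l, P l} ->
  {ae lebesgue_stieltjes_measure F, forall l, Q l}.
Proof.
exact: (@filterS _ _ (ae_filter_ringOfSetsType (lebesgue_stieltjes_measure F))).
Qed.

Section SpectralSubspace.
Context d (X : measurableType d) (R : realType) (mu : {measure set X -> \bar R}).
Variable E : R -> (X -> R[i]) -> (X -> R[i]).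
Hypothesis resE : resolution_of_identity mu E.
Local Notation L2 := (inLp mu 2%:E).
Implicit Types f g : X -> R[i].

Definition band (a b : R) f x := E b f x - E a f x.

Lemma band_inL2 a b f : L2 f -> L2 (band a b f).
Proof. by move=> fL; apply: inL2B; exact: resolution_inL2. Qed.

Lemma resolution_band a b l f : L2 f ->
  E l (band a b f) = (fun x => E (Num.min l b) f x - E (Num.min l a) f x) %[ae mu].
Proof.
move=> fL; have EL k := resolution_inL2 resE k fL.
have H := L2op_sub (roi_operator resE l) (EL b) (EL a).
have Hb := roi_mul resE l b fL; have Ha := roi_mul resE l a fL.
by apply: filterS3 H Hb Ha => x H Hb Ha _; rewrite (H I) (Hb I) (Ha I).
Qed.

Lemma nrm_resolution_band_left a b l f : L2 f -> l <= a -> a <= b ->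
  nrm mu (E l (band a b f)) = 0.
Proof.
move=> fL la ab; have EL k := resolution_inL2 resE k fL.
rewrite -(nrm0 mu); apply: nrm_ae.
- exact/resolution_inL2/band_inL2.
- exact: inL2_0.
- apply: filterS (resolution_band a b l fL) => x /(_ I) -> _.
  by rewrite !min_l ?subrr// (le_trans la).
Qed.

Lemma resolution_band_right a b l f : L2 f -> a <= b -> b <= l ->
  E l (band a b f) = band a b f %[ae mu].
Proof.
move=> fL ab bl; apply: filterS (resolution_band a b l fL) => x /(_ I) -> _.
by rewrite !min_r// (le_trans ab).
Qed.

(** [F] vanishes at [a] and has reached the total mass at [b], because
    [E a] kills [E b f - E a f] and [E b] fixes it. *)
Lemma ae_band a b f (F : cumulative R R) : L2 f -> a <= b ->
  (forall l, F l = nrm mu (E l (band a b f)) ^+ 2) ->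
  {ae lebesgue_stieltjes_measure F, forall l : R, a < l <= b}.
Proof.
move=> fL ab FE; have pL := band_inL2 a b fL.
have na := stieltjes_halfline resE pL FE a.
have nb := stieltjes_halfline resE pL FE b.
have nT := stieltjes_setT resE pL FE.
rewrite FE nrm_resolution_band_left// expr0n in na.
have nbT : nrm mu (E b (band a b f)) = nrm mu (band a b f).
  apply: nrm_ae => //; first exact: resolution_inL2.
  exact: resolution_band_right.
rewrite FE nbT -nT in nb.
have nC : lebesgue_stieltjes_measure F (~` `]-oo, b]%classic) = 0%E.
  have H : (lebesgue_stieltjes_measure F (setT `\` `]-oo, b]%classic) =
    lebesgue_stieltjes_measure F setT -
      lebesgue_stieltjes_measure F (setT `&` `]-oo, b]%classic))%E.
    by apply: measureD => //; exact: stieltjes_fin FE.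
  by rewrite -setTD H setTI nb subee// nT.
have nU : (lebesgue_stieltjes_measure F (`]-oo, a]%classic `|` ~` `]-oo, b]%classic) <=
    lebesgue_stieltjes_measure F `]-oo, a]%classic +
    lebesgue_stieltjes_measure F (~` `]-oo, b]%classic))%E.
  by apply: measureU2 => //; apply: measurableC.
rewrite na nC adde0 in nU.
exists (`]-oo, a]%classic `|` ~` `]-oo, b]%classic); split.
- by apply: measurableU => //; apply: measurableC.
- by apply/eqP; rewrite eq_le measure_ge0 andbT; exact: nU.
- move=> l /= /negP; rewrite negb_and -leNgt -ltNge => /orP[la|bl]; [left|right].
    by rewrite in_itv.
  by rewrite in_itv/=; apply/negP; rewrite -ltNge.
Qed.

End SpectralSubspace.

Section ApproximateEigenvector.
Context d (X : measurableType d) (R : realType) (mu : {measure set X -> \bar R}).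
Hypothesis mu_fin : (mu setT < +oo)%E.
Variable E : R -> (X -> R[i]) -> (X -> R[i]).
Hypothesis resE : resolution_of_identity mu E.
Local Notation L2 := (inLp mu 2%:E).
Local Notation LS := (@lebesgue_stieltjes_measure R).

Let dyad (a b : R) n i := a + (b - a) * i%:R / (2 ^ n)%:R.

Let dyad_lt a b n i : a < b -> dyad a b n i < dyad a b n i.+1.
Proof.
move=> ab; rewrite /dyad ltrD2l ltr_pM2r ?invr_gt0 ?ltr0n ?expn_gt0//.
by rewrite ltr_pM2l ?subr_gt0// ltr_nat.
Qed.

Let dyad_step a b n i : dyad a b n i.+1 - dyad a b n i = (b - a) / (2 ^ n)%:R.
Proof. by rewrite /dyad -natr1; ring. Qed.

Let dyad0 a b n : dyad a b n 0 = a.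
Proof. by rewrite /dyad mulr0 mul0r addr0. Qed.

Let dyad_last a b n : dyad a b n (2 ^ n) = b.
Proof. by rewrite /dyad mulfK ?subrKC// pnatr_eq0 -lt0n expn_gt0. Qed.

(** On the range of [E b - E a] the spectral measures live between [a] and [b],
    where the identity is a uniform limit of dyadic step functions and is within
    [b - a] of the constant [c].  The integrals of these step functions have
    geometric increments, and their limit [q] is the value of [int l dE(l)]. *)
Lemma band_spectral_id a b f : L2 f -> a < b ->
  exists2 q, spectral_integral mu E (fun l => l%:C) (band E a b f) q &
    forall c, a <= c <= b ->
      nrm mu (fun x => q x - c%:C * band E a b f x) <= (b - a) * nrm mu (band E a b f).
Proof.
move=> fL ab; set p := band E a b f; have pL : L2 p := band_inL2 resE a b fL.
have [F FE] := spectral_cumulative resE pL.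
have nu_fin : ((LS F) setT < +oo)%E := stieltjes_fin resE pL FE.
have nuT : fine ((LS F) setT) = nrm mu p ^+ 2 := congr1 fine (stieltjes_setT resE pL FE).
have aeab : {ae (LS F), forall l : R, a < l <= b} by exact: ae_band resE _ _ _ _ fL (ltW ab) FE.
pose D (n : nat) := (b - a) / (2 ^ n)%:R.
have D0 n : 0 <= D n by rewrite divr_ge0// subr_ge0 ltW.
pose s n := grid (dyad a b n) (fun i => (dyad a b n i)%:C) (2 ^ n).
have sl n l : a < l <= b -> exists2 y, a <= y <= b /\ `|l - y| <= D n & step_fun (s n) l = y%:C.
  move=> /andP[al lb]; have [|i ik [/andP[xl lx] ->]] :=
    @step_fun_grid _ _ (fun i => @dyad_lt a b n i ab) (fun i => (dyad a b n i)%:C) (2 ^ n) l.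
    by rewrite dyad0 dyad_last al.
  exists (dyad a b n i) => //; split; last first.
    by rewrite ger0_norm ?subr_ge0 ?(ltW xl)// /D -(dyad_step a b n i) lerB.
  rewrite (ltW (lt_le_trans xl lb)) andbT lerDl divr_ge0//.
  by rewrite mulr_ge0// subr_ge0 ltW.
have nrm_nu (g : R -> R[i]) K : cmeasurable setT g -> 0 <= K ->
    (forall l, a < l <= b -> normc (g l) <= K) -> nrm (LS F) g <= K * nrm mu p.
  move=> mg K0 gK; rewrite -ler_sqr ?nnegrE ?mulr_ge0 ?nrm_ge0//.
  rewrite exprMn -nuT; apply: nrm_le_bounded => //.
  by move: aeab; apply: ae_stieltjesS => l; exact: gK.
have ms t := @cmeasurable_step_fun R t.
have mid : cmeasurable setT (fun l : R => l%:C) by apply: cmeasurable_real.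
pose u n := step_integral E (s n) p.
have uL n : L2 (u n) by exact: step_integral_inL2.
have [q qL uq] : exists2 q, L2 q & nrm mu (fun x => u n x - q x) @[n --> \oo] --> (0 : R).
  apply: (@geometric_cvg_L2 _ _ _ _ mu_fin u (4 * (b - a) * nrm mu p)) => // n.
  rewrite (nrm_step_integralB resE pL FE).
  rewrite (_ : _ / _ = 2 * D n * nrm mu p); last first.
    by rewrite /D expnS natrM invfM; field; rewrite pnatr_eq0 -lt0n expn_gt0.
  apply: nrm_nu => [||l lab]; first exact: cmeasurableB.
    by rewrite mulr_ge0.
  have [y [_ ly] ->] := sl n.+1 l lab; have [z [_ lz] ->] := sl n l lab.
  rewrite -rmorphB normcC.
  have -> : y - z = (l - z) - (l - y) by ring.
  apply: le_trans (ler_normB _ _) _; rewrite mulr2n mulrDl mul1r lerD//.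
  apply: le_trans ly _; rewrite /D expnS natrM invfM mulrA.
  by rewrite ler_wpM2r ?invr_ge0// ler_pdivrMr// ler_peMr ?ler1n// subr_ge0 ltW.
exists q.
  apply/(spectral_integralP resE pL FE).
    apply: (inL2_bounded nu_fin mid (K := `|a| + `|b|)).
    move: aeab; apply: ae_stieltjesS => l /andP[al lb]; rewrite normcC.
    by rewrite ler_norml; have := ler_norm (- a); have := ler_norm b;
      have := normr_ge0 a; have := normr_ge0 b; rewrite normrN; lra.
  split => //; exists s; split => //.
  apply: (@squeeze_cvgr _ _ _ _ (fun=> 0) (fun n => D n * nrm mu p)).
  - apply: nearW => n; rewrite nrm_ge0/=; apply: nrm_nu => // [|l lab].
      exact: cmeasurableB.
    by have [y [_ ly] ->] := sl n l lab; rewrite -rmorphB normcC.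
  - exact: cvg_cst.
  rewrite -(mul0r (nrm mu p)); apply: cvgM; last exact: cvg_cst.
  rewrite -(mulr0 (b - a)); apply: cvgM; first exact: cvg_cst.
  under eq_fun do rewrite natrX -exprVn.
  by apply: cvg_expr; rewrite ger0_norm ?invf_lt1 ?ltr1n.
move=> c /andP[ac cb]; pose t := [:: (c%:C, (a, b))].
have tl (l : R) : a < l <= b -> step_fun t l = c%:C.
  by move=> lab; rewrite /step_fun /t big_cons big_nil/= lab addr0.
have tp : step_integral E t p = (fun x => c%:C * p x) %[ae mu].
  have Ea : E a p = (fun=> 0) %[ae mu].
    apply: nrm_eq0; first exact: resolution_inL2.
    by rewrite nrm_resolution_band_left// ltW.
  have Eb : E b p = p %[ae mu] by apply: resolution_band_right => //; exact: ltW.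
  apply: filterS2 Ea Eb => x /(_ I) Ea /(_ I) Eb _.
  by rewrite /step_integral /t big_cons big_nil/= ab Ea Eb subr0 addr0.
apply: (ler_cvg0 uq) => n.
have cpL := inL2Z c%:C pL; have tL := step_integral_inL2 resE t pL.
apply: le_trans (nrm_dist qL (uL n) cpL) _; rewrite nrm_distC addrC lerD2r.
have -> : nrm mu (fun x => u n x - c%:C * p x) =
          nrm mu (fun x => u n x - step_integral E t p x).
  apply: nrm_ae; [exact: inL2B|exact: inL2B|].
  by apply: filterS tp => x /(_ I) ->.
rewrite (nrm_step_integralB resE pL FE); apply: nrm_nu => [||l lab].
- exact: cmeasurableB.
- by rewrite subr_ge0 ltW.
have [y [/andP[ay yb] _] ->] := sl n l lab; rewrite tl// -rmorphB normcC.
by rewrite ler_norml; lra.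
Qed.

End ApproximateEigenvector.

(** * The semigroup on approximate eigenvectors *)

Section SemigroupSpectrum.
Context d (X : measurableType d) (R : realType) (mu : {measure set X -> \bar R}).
Variable T : R -> (X -> R[i]) -> (X -> R[i]).
Hypothesis markovT : symmetric_markovian_semigroup mu T.
Local Notation L2 := (inLp mu 2%:E).
Implicit Types f g p q : X -> R[i].

Lemma semigroup_op t : 0 <= t -> L2_operator mu (T t).
Proof. exact/sg_operator/smsg_semigroup. Qed.

Lemma semigroup_inL2 t f : 0 <= t -> L2 f -> L2 (T t f).
Proof. by move=> t0; exact/L2op_stable/semigroup_op. Qed.

Lemma nrm_semigroup t f : 0 <= t -> L2 f -> nrm mu (T t f) <= nrm mu f.
Proof.
move=> t0 fL; rewrite -lee_fin -!cLnormE//; last exact: semigroup_inL2.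
by apply: (smsg_contraction markovT) => //; rewrite lee_fin ler1n.
Qed.

Lemma nrm_semigroupB t f g : 0 <= t -> L2 f -> L2 g ->
  nrm mu (fun x => T t f x - T t g x) <= nrm mu (fun x => f x - g x).
Proof.
move=> t0 fL gL; apply: le_trans (nrm_semigroup t0 (inL2B fL gL)).
have TL := @semigroup_inL2 t _ t0.
rewrite le_eqVlt; apply/orP; left; apply/eqP; apply: nrm_ae.
- by apply: inL2B; exact: TL.
- exact/TL/inL2B.
by apply: filterS (L2op_sub (semigroup_op t0) fL gL) => x /(_ I) ->.
Qed.

Section ApproximateEigenvectors.
Variables (p q : X -> R[i]) (c kappa : R).
Hypothesis pq : generator mu T p q.
Hypothesis qc : nrm mu (fun x => q x - c%:C * p x) <= kappa.

Let pL : L2 p. Proof. by case: pq. Qed.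
Let qL : L2 q. Proof. by case: pq. Qed.

Let diffq (h : R) := nrm mu (fun x => (p x - T h p x) / h%:C - q x).

Let quotL h : 0 < h -> L2 (fun x => (p x - T h p x) / h%:C).
Proof.
move=> h0; rewrite (_ : (fun _ => _) = (fun x => h%:C^-1 * (p x - T h p x))).
  by apply/inL2Z/inL2B => //; apply: semigroup_inL2 => //; exact: ltW.
by apply/funext => x; rewrite mulrC.
Qed.

(** The sequence [t / n.+1] is the one along which [T t] is split into [n.+1]
    equal time steps below. *)
Lemma generator_diffq_cvg t : 0 < t -> diffq (t / n.+1%:R) @[n --> \oo] --> (0 : R).
Proof.
move=> t0; case: pq => _ _.
have nL : \forall h \near 0^'+, L2 (fun x => (p x - T h p x) / h%:C - q x).
  near=> h; apply: inL2B => //; exact: quotL.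
move=> /(cvg_cLnormP nL).1 /cvg_at_rightP; apply; split.
  by move=> n; rewrite divr_gt0.
rewrite -(mulr0 t); apply: cvgM; first exact: cvg_cst.
exact: cvg_harmonic.
Unshelve. all: by end_near. Qed.

Let T_near h (a : R) : 0 < h ->
  nrm mu (fun x => T h p x - a%:C * p x) <=
  h * diffq h + h * kappa + `|1 - h * c - a| * nrm mu p.
Proof.
move=> h0; have h0' : h%:C != 0 :> R[i] by rewrite eq_complex/= eqxx andbT gt_eqF.
have dL := inL2B (quotL h0) qL; have eL := inL2B qL (inL2Z c%:C pL).
have -> : (fun x => T h p x - a%:C * p x) = (fun x =>
    ((- h)%:C * ((p x - T h p x) / h%:C - q x) + (- h)%:C * (q x - c%:C * p x)) +
    (1 - h * c - a)%:C * p x).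
  apply/funext => x; rewrite rmorphN/= !rmorphB/= rmorphM/= rmorph1.
  by field.
apply: le_trans (nrmD (inL2D (inL2Z _ dL) (inL2Z _ eL)) (inL2Z _ pL)) _.
rewrite nrmZ// normcC lerD2r.
apply: le_trans (nrmD (inL2Z _ dL) (inL2Z _ eL)) _.
rewrite !nrmZ// normcC normrN (gtr0_norm h0) lerD2l ler_wpM2l//; exact: ltW.
Qed.

Let phi h := nrm mu (fun x => T h p x - (expR (- (h * c)))%:C * p x).

Let phiD s h : 0 <= c -> 0 <= s -> 0 <= h -> phi (s + h) <= phi s + phi h.
Proof.
move=> c0 s0 h0; have TsL := semigroup_inL2 s0; have ThL := semigroup_inL2 h0 pL.
pose e (r : R) : R[i] := (expR (- (r * c)))%:C.
have epL r := inL2Z (e r) pL.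
have E1 : phi (s + h) = nrm mu (fun x => (T s (T h p) x - T s (fun y => e h * p y) x) +
                          e h * (T s p x - e s * p x)).
  apply: nrm_ae.
  - by apply: inL2B; [apply: semigroup_inL2 => //; exact: addr_ge0|exact: inL2Z].
  - apply: inL2D; first by apply: inL2B; exact: TsL.
    by apply/inL2Z/inL2B => //; exact: TsL.
  have H1 := sg_add (smsg_semigroup markovT) s0 h0 pL.
  have H2 := L2op_scale (semigroup_op s0) (e h) pL.
  apply: filterS2 H1 H2 => x /(_ I) -> /(_ I) -> _.
  rewrite /e mulrDl opprD expRD rmorphM/=; ring.
rewrite E1 addrC.
apply: le_trans (nrmD (inL2B (TsL _ ThL) (TsL _ (epL h))) (inL2Z _ (inL2B (TsL _ pL) (epL s)))) _.
apply: lerD; first exact: (nrm_semigroupB s0 ThL (epL h)).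
rewrite nrmZ; last by apply: inL2B => //; exact: TsL.
rewrite normcC gtr0_norm ?expR_gt0// ler_piMl ?nrm_ge0//.
by apply: expRN_le1; exact: mulr_ge0.
Qed.

Let phi0 : phi 0 = 0.
Proof.
rewrite -[RHS](nrm0 mu); apply: nrm_ae.
- by apply: inL2B; [exact: (semigroup_inL2 (lexx 0))|exact: inL2Z].
- exact: inL2_0.
apply: filterS (sg_zero (smsg_semigroup markovT) pL) => x /(_ I) -> _.
by rewrite mul0r oppr0 expR0 mul1r subrr.
Qed.

Let phi_iter n h : 0 <= c -> 0 <= h -> phi (n%:R * h) <= n%:R * phi h.
Proof.
move=> c0 h0; elim: n => [|n IH]; first by rewrite !mul0r phi0.
rewrite -natr1 !mulrDl !mul1r.
by apply: le_trans (phiD c0 _ h0) _; rewrite ?mulr_ge0// lerD2r.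
Qed.

(** Gronwall: the defect [T h p - expR (- h c) p] is subadditive in [h], and
    of size at most [h kappa] up to [o(h)], so it never exceeds [t kappa]. *)
Lemma semigroup_approx_eigenvector t : 0 <= c -> 0 <= t ->
  nrm mu (fun x => T t p x - (expR (- (t * c)))%:C * p x) <= t * kappa.
Proof.
move=> c0; rewrite le_eqVlt => /predU1P[<-|t0]; first by rewrite [leLHS]phi0 mul0r.
have lim : t * diffq (t / n.+1%:R) + (t * c) ^+ 2 * nrm mu p * n.+1%:R^-1
    @[n --> \oo] --> (t * 0 + (t * c) ^+ 2 * nrm mu p * 0 : R).
  apply: cvgD; apply: cvgM; [exact: cvg_cst| |exact: cvg_cst|].
    exact: generator_diffq_cvg.
  exact: cvg_harmonic.
rewrite !mulr0 addr0 in lim; apply: (ler_cvg0 lim) => n.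
set h := t / n.+1%:R; have h0 : 0 < h by rewrite divr_gt0.
have tE : t = n.+1%:R * h by rewrite /h mulrC divfK.
clearbody h.
have -> : nrm mu (fun x => T t p x - (expR (- (t * c)))%:C * p x) = phi t by [].
rewrite [in phi t]tE; apply: le_trans (phi_iter _ c0 (ltW h0)) _.
have := T_near (expR (- (h * c))) h0; rewrite -/(phi h) => ph.
have := expRN_le_quad (mulr_ge0 (ltW h0) c0) => eh.
have {}ph : phi h <= h * diffq h + h * kappa + (h * c) ^+ 2 * nrm mu p.
  by apply: le_trans ph _; rewrite lerD2l ler_wpM2r ?nrm_ge0.
apply: le_trans (ler_wpM2l (ler0n _ _) ph) _.
by rewrite le_eqVlt; apply/orP; left; apply/eqP; rewrite tE; field; rewrite addr_eq0 gt_eqF.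
Qed.

(** Contractivity leaves no room for spectrum below zero: on an approximate
    eigenvector with negative [c] the semigroup would expand. *)
Lemma semigroup_no_growth : - c * nrm mu p <= kappa.
Proof.
have lim := generator_diffq_cvg ltr01; apply: (ler_cvg0 lim) => n.
set h := 1 / n.+1%:R; have h0 : 0 < h by rewrite divr_gt0.
have ThL := semigroup_inL2 (ltW h0) pL.
have := T_near (1 - h * c) h0; rewrite subrr normr0 mul0r addr0 => Tn.
have T1 := nrm_semigroup (ltW h0) pL.
have T2 := nrmB ThL (inL2B ThL (inL2Z (1 - h * c)%:C pL)).
have T3 : (1 - h * c) * nrm mu p <= h * diffq h + h * kappa + nrm mu p.
  apply: (@le_trans _ _ (normc (1 - h * c)%:C * nrm mu p)).
    by rewrite ler_wpM2r ?nrm_ge0// normcC ler_norm.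
  rewrite -nrmZ//; move: T2; under eq_fun do rewrite opprB addrCA subrr addr0.
  by lra.
rewrite -(ler_pM2l h0); lra.
Qed.

End ApproximateEigenvectors.
End SemigroupSpectrum.

(** * The semigroup as a spectral integral *)

Section SpectralRepresentation.
Context d (X : measurableType d) (R : realType) (mu : {measure set X -> \bar R}).
Hypothesis mu_fin : (mu setT < +oo)%E.
Variable T : R -> (X -> R[i]) -> (X -> R[i]).
Hypothesis markovT : symmetric_markovian_semigroup mu T.
Variable E : R -> (X -> R[i]) -> (X -> R[i]).
Hypothesis ET : resolution_of_generator mu E T.
Local Notation L2 := (inLp mu 2%:E).
Local Notation LS := (@lebesgue_stieltjes_measure R).
Implicit Types f g p q : X -> R[i].

Let resE : resolution_of_identity mu E := ET.1.

Lemma band_generator a b f : L2 f -> a < b ->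
  exists2 q, generator mu T (band E a b f) q &
    forall c, a <= c <= b ->
      nrm mu (fun x => q x - c%:C * band E a b f x) <= (b - a) * nrm mu (band E a b f).
Proof.
move=> fL ab; have [q pq qc] := band_spectral_id mu_fin resE fL ab.
by exists q => //; exact/ET.2.
Qed.

(** An approximate eigenvector in the band from [a] to [b] with [b < 0] would
    be expanded at rate [- a], with an error rate of only [b - a]; so it
    vanishes, and [a] can be sent to [-oo]. *)
Lemma resolution_neg b f : L2 f -> b < 0 -> nrm mu (E b f) = 0.
Proof.
move=> fL b0; have EL k := resolution_inL2 resE k fL.
have band0 a : a < b -> nrm mu (band E a b f) = 0.
  move=> ab; have [q pq qc] := band_generator fL ab.
  have aI : a <= a <= b by rewrite lexx ltW.
  have := semigroup_no_growth markovT pq (qc a aI).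
  have N0 := nrm_ge0 mu (band E a b f) => H.
  have {}H : - b * nrm mu (band E a b f) <= 0 by lra.
  apply/eqP; rewrite eq_le N0 andbT.
  by rewrite -(@ler_pM2l _ (- b)) ?mulr0 ?oppr_gt0.
have lim : nrm mu (E l f) @[l --> -oo] --> (0 : R).
  apply/cvg_cLnormP; last exact: roi_ninfty.
  by apply: nearW => l; exact: EL.
apply/eqP; rewrite eq_le nrm_ge0 andbT.
apply: (cvgr_to_ge lim); near=> a.
have ab : a < b by near: a; apply: nbhs_ninfty_lt; exact: num_real.
have := nrmD (band_inL2 resE a b fL) (EL a); rewrite band0// add0r.
by under eq_fun do rewrite /band subrK.
Unshelve. all: by end_near. Qed.

(** The exponential is kept constant on the negative half-line, which no
    spectral measure charges, so as to be bounded everywhere. *)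
Definition decay (t l : R) : R[i] := (expR (- (t * Num.max l 0)))%:C.

Lemma decayE t l : 0 <= l -> decay t l = (expR (- (t * l)))%:C.
Proof. by move=> l0; rewrite /decay max_l. Qed.

Lemma normc_decay t l : 0 <= t -> normc (decay t l) <= 1.
Proof.
move=> t0; rewrite normcC gtr0_norm ?expR_gt0//; apply: expRN_le1.
by rewrite mulr_ge0// le_max lexx orbT.
Qed.

Lemma cmeasurable_decay t : cmeasurable setT (decay t).
Proof.
apply: cmeasurable_real; apply: (measurableT_comp (@measurable_expR R)).
apply: measurable_funN; apply: measurable_funM => //.
by apply: measurable_maxr.
Qed.

Lemma ae_spectral_ge0 f (F : cumulative R R) : L2 f ->
  (forall l, F l = nrm mu (E l f) ^+ 2) -> {ae LS F, forall l : R, 0 <= l}.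
Proof.
move=> fL FE.
have : {ae LS F, forall (l : R) (n : nat), - n.+1%:R^-1 < l}.
  apply/ae_foralln => n; exists `]-oo, - n.+1%:R^-1]%classic; split => //.
    have := stieltjes_halfline resE fL FE (- n.+1%:R^-1).
    by rewrite FE resolution_neg ?expr0n//= oppr_lt0 invr_gt0.
  by move=> l /= /negP; rewrite -leNgt in_itv.
apply: ae_stieltjesS => l H.
have lim : - n.+1%:R^-1 @[n --> \oo] --> (- 0 : R) by apply: cvgN; exact: cvg_harmonic.
rewrite oppr0 in lim; apply: (cvgr_to_le lim); apply: nearW => n.
exact: ltW.
Qed.

Section GridApproximation.
Variables (f : X -> R[i]) (t : R).
Hypothesis fL : L2 f.
Hypothesis t0 : 0 <= t.

(** [k = n + 1] gives [k ^ 4] cells of width [k ^ - 3], which start just below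
    [0] so that a possible mass at [0] is covered, and end beyond [n].  With
    [theta = k ^ - 2], the inequality [x <= theta + x ^ 2 / theta] bounds the
    sum of the norms of the bands by [k ^ 2 * (1 + |f| ^ 2)], which the factor
    [k ^ - 3] of the approximate eigenvector estimate beats. *)
Let k n : R := n.+1%:R.
Let w n := (k n ^+ 3)^-1.
Let node n i := - w n + i%:R * w n.
Let ncell n := (n.+1 ^ 4)%N.
Let value n i := decay t (node n i.+1).

Let k0 n : 0 < k n. Proof. by rewrite /k ltr0n. Qed.
Let w0 n : 0 < w n. Proof. by rewrite /w invr_gt0 exprn_gt0. Qed.

Let node_lt n i : node n i < node n i.+1.
Proof. by rewrite /node -natr1 mulrDl mul1r; have := w0 n; lra. Qed.

Let nodeS n i : node n i.+1 = i%:R * w n.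
Proof. by rewrite /node -natr1; ring. Qed.

Let node0 n : node n 0 = - w n.
Proof. by rewrite /node mul0r addr0. Qed.

Let node_last n : n%:R <= node n (ncell n).
Proof.
rewrite /node /ncell natrX -/(k n).
have -> : k n ^+ 4 * w n = k n.
  by rewrite /w exprSr mulrAC divff ?mul1r// expf_neq0// gt_eqF.
have : w n <= 1 by rewrite invf_le1 ?exprn_gt0// exprn_ege1// /k ler1n.
by rewrite /k -natr1; lra.
Qed.

Let s n := grid (node n) (value n) (ncell n).

Let semigroup_grid n m :
  nrm mu (fun x => T t (band E (node n 0) (node n m) f) x -
      \sum_(0 <= i < m) value n i * band E (node n i) (node n i.+1) f x) <=
  t * w n * \sum_(0 <= i < m) nrm mu (band E (node n i) (node n i.+1) f).
Proof.
have EL l := resolution_inL2 resE l fL; have BL a b := band_inL2 resE a b fL.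
have TL g := @semigroup_inL2 _ _ _ mu T markovT t g t0.
have SL j : L2 (fun x => \sum_(0 <= i < j) value n i * band E (node n i) (node n i.+1) f x).
  by apply: inL2_sum => i; exact: inL2Z.
elim: m => [|m IH].
  rewrite big_nil mulr0 (_ : nrm _ _ = 0)// -[RHS](nrm0 mu); apply: nrm_ae.
  - by apply: inL2B => //; exact: TL.
  - exact: inL2_0.
  have := L2op0 (semigroup_op markovT t0); rewrite (_ : (fun=> 0) = band E (node n 0) (node n 0) f).
    by apply: filterS => x /(_ I) -> _; rewrite big_nil /band !subrr.
  by apply/funext => x; rewrite /band subrr.
set p := band E (node n m) (node n m.+1) f.
have pL : L2 p by exact: BL.
have -> : nrm mu (fun x => T t (band E (node n 0) (node n m.+1) f) x -
      \sum_(0 <= i < m.+1) value n i * band E (node n i) (node n i.+1) f x) =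
  nrm mu (fun x => (T t (band E (node n 0) (node n m) f) x -
      \sum_(0 <= i < m) value n i * band E (node n i) (node n i.+1) f x) +
      (T t p x - value n m * p x)).
  apply: nrm_ae.
  - by apply: inL2B => //; exact: TL.
  - by apply: inL2D; apply: inL2B => //; [exact: TL|exact: TL|exact: inL2Z].
  have := L2op_add (semigroup_op markovT t0) (BL (node n 0) (node n m)) pL.
  rewrite (_ : (fun x => _ + p x) = band E (node n 0) (node n m.+1) f).
    by apply: filterS => x /(_ I) -> _; rewrite big_nat_recr//= -/p; ring.
  by apply/funext => x; rewrite /p /band; ring.
apply: le_trans (nrmD _ _) _.
- by apply: inL2B => //; exact: TL.
- by apply: inL2B; [exact: TL|exact: inL2Z].
rewrite big_nat_recr//= mulrDr lerD// -mulrA.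
have [q pq qc] := band_generator fL (node_lt n m).
have cI : node n m <= node n m.+1 <= node n m.+1 by rewrite lexx ltW// node_lt.
have c0 : 0 <= node n m.+1 by rewrite nodeS mulr_ge0// ltW// w0.
have := semigroup_approx_eigenvector markovT pq (qc _ cI) c0 t0.
rewrite /value decayE// (_ : node n m.+1 - node n m = w n)//.
by rewrite /node -natr1; ring.
Qed.

Let band_sum_le n :
  \sum_(0 <= i < ncell n) nrm mu (band E (node n i) (node n i.+1) f) <=
  k n ^+ 2 * (1 + nrm mu f ^+ 2).
Proof.
have kn := k0 n; have EL l := resolution_inL2 resE l fL.
apply: (@le_trans _ _ (\sum_(0 <= i < ncell n) ((k n ^+ 2)^-1 + k n ^+ 2 *
   (nrm mu (E (node n i.+1) f) ^+ 2 - nrm mu (E (node n i) f) ^+ 2)))).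
  apply: ler_sum => i _; rewrite -(nrm_resolutionB resE fL (ltW (node_lt n i))).
  rewrite -/(band E (node n i) (node n i.+1) f); set y := nrm mu _.
  have y0 : 0 <= y by exact: nrm_ge0.
  have k2 : 0 < k n ^+ 2 by rewrite exprn_gt0.
  rewrite -(ler_pM2l k2) mulrDr divff ?gt_eqF//.
  have := sqr_ge0 (k n ^+ 2 * y - 1); set z := k n ^+ 2 in k2 *.
  by have := mulr_ge0 (ltW k2) y0; nra.
rewrite big_split/= -mulr_sumr telescope_sumr//.
rewrite sumr_const_nat subn0 -mulr_natl /ncell natrX -/(k n) [leRHS]mulrDr mulr1.
apply: lerD.
  by rewrite (exprD _ 2 2) mulfK// expf_neq0// gt_eqF.
rewrite ler_pM2l ?exprn_gt0//.
have h1 := nrm_resolution_le resE (node n (ncell n)) fL.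
have h2 := sqr_ge0 (nrm mu (E (node n 0) f)).
have : nrm mu (E (node n (ncell n)) f) ^+ 2 <= nrm mu f ^+ 2.
  by rewrite ler_sqr ?nnegrE ?nrm_ge0.
by move: h2; rewrite /ncell => h2 h3; lra.
Qed.

(** The step functions with the value of [decay t] at the right end of each
    cell converge to [decay t] almost everywhere for the spectral measure; and
    each band being an approximate eigenvector, their spectral integrals
    converge to [T t f]. *)
Lemma semigroup_spectral : spectral_integral mu E (decay t) f (T t f).
Proof.
have EL l := resolution_inL2 resE l fL; have BL a b := band_inL2 resE a b fL.
have TL g := @semigroup_inL2 _ _ _ mu T markovT t g t0.
have [F FE] := spectral_cumulative resE fL.
have nu_fin := stieltjes_fin resE fL FE.
have winv : w n @[n --> \oo] --> (0 : R).
  apply: (@squeeze_cvgr _ _ _ _ (fun=> 0) (fun n => n.+1%:R^-1)).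
  - apply: nearW => n; rewrite (ltW (w0 n))/= /w lef_pV2 ?posrE ?exprn_gt0//.
    by rewrite -/(k n) exprS ler_peMr ?(ltW (k0 n))// exprn_ege1// /k ler1n.
  - exact: cvg_cst.
  - exact: cvg_harmonic.
apply/(spectral_integralP resE fL FE).
  apply: (inL2_bounded nu_fin (cmeasurable_decay t) (K := 1)).
  by apply: aeW => l; exact: normc_decay.
split; first exact: TL.
exists s; split.
  apply: (@nrm_dominated_cvg _ _ _ _ _ (fun=> 2)).
  - by move=> n; apply: cmeasurableB; [exact: cmeasurable_decay|exact: cmeasurable_step_fun].
  - exact: (integrable_cst_fin nu_fin).
  - apply: aeW => l n; apply: le_trans (normcD _ _) _; rewrite normcN -[leRHS]/(1 + 1) lerD//.
      exact: normc_decay.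
    by apply: step_fun_grid_bounded => // i _; exact: normc_decay.
  have := ae_spectral_ge0 fL FE; apply: ae_stieltjesS => l l0.
  apply: (@squeeze_cvgr _ _ _ _ (fun=> 0) (fun n => t * w n)).
  - near=> n; rewrite normc_ge0/=.
    have ln : node n 0 < l <= node n (ncell n).
      rewrite node0 (lt_le_trans _ l0) ?oppr_lt0//=.
      apply: le_trans (node_last n); near: n; exact: nbhs_infty_ger.
    have [i _ [/andP[xl lx] ->]] := step_fun_grid (node_lt n) (value n) ln.
    rewrite /value !decayE//; last exact: le_trans lx.
    rewrite -rmorphB normcC (le_trans (expRN_lip _ _))//.
    + exact: mulr_ge0.
    + by rewrite ler_wpM2l.
    rewrite -mulrBr ler_wpM2l//.
    have : node n i.+1 - node n i = w n by rewrite /node -natr1; ring.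
    by lra.
  - exact: cvg_cst.
  by rewrite -(mulr0 t); apply: cvgM => //; exact: cvg_cst.
apply: (@squeeze_cvgr _ _ _ _ (fun=> 0) (fun n =>
  nrm mu (fun x => E (node n (ncell n)) f x - f x) + t * (1 + nrm mu f ^+ 2) * n.+1%:R^-1)).
- apply: nearW => n; rewrite nrm_ge0/= nrm_distC.
  have SL : L2 (step_integral E (s n) f) by exact: step_integral_inL2.
  apply: le_trans (nrm_dist (TL _ fL) (TL _ (BL (node n 0) (node n (ncell n)))) SL) _.
  apply: lerD.
    apply: le_trans (nrm_semigroupB markovT t0 fL (BL _ _)) _.
    rewrite nrm_distC /band.
    have := nrmB (inL2B (EL (node n (ncell n))) fL) (EL (node n 0)).
    rewrite (resolution_neg fL (b := node n 0)) ?addr0; last by rewrite node0 oppr_lt0.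
    by congr (nrm _ _ <= _); apply/funext => x; ring.
  rewrite (funext (step_integral_grid (node_lt n) (value n) E f (ncell n))).
  apply: le_trans (semigroup_grid n (ncell n)) _.
  apply: le_trans (ler_wpM2l _ (band_sum_le n)) _; first by rewrite mulr_ge0// ltW.
  rewrite le_eqVlt; apply/orP; left; apply/eqP; rewrite /w -/(k n).
  by field; rewrite gt_eqF.
- exact: cvg_cst.
rewrite -[X in _ --> X](addr0 0); apply: cvgD.
  have limE : nrm mu (fun x => E l f x - f x) @[l --> +oo] --> (0 : R).
    apply/cvg_cLnormP; last exact: roi_pinfty.
    by apply: nearW => l; exact: inL2B.
  have nodey : node n (ncell n) @[n --> \oo] --> +oo.
    apply: ger_cvgy; last exact: cvgr_idn.
    by apply: nearW => n; exact: node_last.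
  exact: (cvg_comp _ _ nodey limE).
rewrite -(mulr0 (t * (1 + nrm mu f ^+ 2))); apply: cvgM; first exact: cvg_cst.
exact: cvg_harmonic.
Unshelve. all: by end_near. Qed.

End GridApproximation.
End SpectralRepresentation.

(** * Riemann sums of the Laplace multiplier *)

Section LaplaceRiemannSum.
Context (R : realType).
Local Notation leb := (@lebesgue_measure R).
Implicit Types (M : R -> R) (l h a : R).

Lemma integral_decay l a : 0 < l ->
  (\int[leb]_(t in `[a, +oo[) (l * expR (- (t * l)))%:E = (expR (- (a * l)))%:E)%E.
Proof.
move=> l0; have cl : continuous (fun t : R => - (t * l)).
  by move=> t; apply: cvgN; apply: cvgM; [exact: cvg_id|exact: cvg_cst].
have ce : continuous (fun t : R => expR (- (t * l))).
  by move=> t; apply: (continuous_comp (cl t)); exact: continuous_expR.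
have dF (x : R) : is_derive x 1 (fun t => - expR (- (t * l))) (l * expR (- (x * l))).
  by apply: is_derive_eq; rewrite /GRing.scale/=; ring.
rewrite (@ge0_continuous_FTC2y _ _ (fun t => - expR (- (t * l))) a 0).
- by rewrite sub0e -EFinN opprK.
- by move=> x _; rewrite mulr_ge0// ?expR_ge0// ltW.
- apply: continuous_subspaceT => x; apply: cvgM; [exact: cvg_cst|exact: ce].
- rewrite -oppr0; apply: cvgN.
  apply: (cvg_comp (fun t : R => t * l) (fun y => expR (- y))); last exact: cvgr_expR.
  by apply: gt0_cvgMly => //; exact: cvg_id.
- by move=> x _; exact: ex_derive.
- by apply: cvg_at_right_filter; apply: cvgN; exact: ce.
- by move=> x _; rewrite derive1E; exact: derive_val.
Qed.

Lemma measurable_decay_kernel l D : measurable_fun D (fun t : R => expR (- (t * l))).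
Proof.
apply: (measurableT_comp (@measurable_expR R)).
by apply: measurable_funN; apply: measurable_funM.
Qed.

Lemma integrable_decay l a : 0 < l ->
  leb.-integrable `[a, +oo[ (EFin \o (fun t => l * expR (- (t * l)))).
Proof.
move=> l0; apply/integrableP; split.
  by apply/measurable_EFinP; apply: measurable_funM => //; exact: measurable_decay_kernel.
under eq_integral do rewrite /= ger0_norm ?mulr_ge0 ?expR_ge0 ?(ltW l0)//.
by rewrite integral_decay// ltry.
Qed.

Definition cell_average M h k : R := h^-1 * \int[leb]_(t in `]k%:R * h, k.+1%:R * h]) M t.

Section Sum.
Variables (M : R -> R) (K l h : R).
Hypothesis mM : measurable_fun (`]0, +oo[ : set R) M.
Hypothesis MK : forall t, 0 < t -> `|M t| <= K.
Hypothesis l0 : 0 < l.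
Hypothesis h0 : 0 < h.

Let K0 : 0 <= K. Proof. exact: le_trans (normr_ge0 _) (MK ltr01). Qed.

Let cell k : set R := `]k%:R * h, k.+1%:R * h]%classic.

Let mcell k : measurable (cell k). Proof. exact: measurable_itv. Qed.

Let cell_pos k t : cell k t -> 0 < t.
Proof.
rewrite /cell/= in_itv/= => /andP[kt _]; apply: le_lt_trans kt.
by rewrite mulr_ge0// ltW.
Qed.

Let cell_sub k : cell k `<=` `]0, +oo[%classic.
Proof. by move=> t /cell_pos t0; rewrite /= in_itv/= t0. Qed.

Let leb_cell k : fine (leb (cell k)) = h.
Proof.
rewrite /cell lebesgue_measure_itv/= lte_fin ltr_pM2r// ltr_nat leqnn /=.
by rewrite -natr1; ring.
Qed.

Let leb_cell_fin k : (leb (cell k) < +oo)%E.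
Proof.
rewrite /cell lebesgue_measure_itv/= lte_fin ltr_pM2r// ltr_nat leqnn /=.
by rewrite -EFinB ltry.
Qed.

Let integrable_cell (g : R -> R) C k : measurable_fun (cell k) g ->
  (forall t, cell k t -> `|g t| <= C) -> leb.-integrable (cell k) (EFin \o g).
Proof.
move=> mg gC; apply: (measurable_bounded_integrable _ (leb_cell_fin k)) => //; first exact: mcell.
exists C; split; first exact: num_real.
by move=> C' CC' t ct; apply: le_trans (gC t ct) (ltW CC').
Qed.

Let Rintegral_cell (g : R -> R) C k : measurable_fun (cell k) g ->
  (forall t, cell k t -> `|g t| <= C) -> `|\int[leb]_(t in cell k) g t| <= C * h.
Proof.
move=> mg gC; have ig := integrable_cell mg gC.
apply: le_trans (le_normr_Rintegral _ ig) _; first exact: mcell.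
rewrite -(leb_cell k) -Rintegral_cst; last exact: mcell.
apply: le_Rintegral => //.
- exact: mcell.
- exact: integrable_norm.
- by apply: (@integrable_cell _ `|C| k) => //; exact: measurable_cst.
Qed.

Let mM_cell k : measurable_fun (cell k) M.
Proof. by apply: measurable_funS mM => //; exact: cell_sub. Qed.

Lemma cell_average_le k : `|cell_average M h k| <= K.
Proof.
rewrite /cell_average normrM gtr0_norm ?invr_gt0// mulrC ler_pdivrMr//.
by apply: Rintegral_cell => // t /cell_pos; exact: MK.
Qed.

Let e k := expR (- (k%:R * h * l)).

(** The slope of the exponential over a cell lies between its derivatives at
    the two ends. *)
Let e_diff k : l * e k.+1 <= (e k - e k.+1) / h <= l * e k.
Proof.
have hl : 0 < h * l by rewrite mulr_gt0.
have E1 : e k.+1 = e k * expR (- (h * l)).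
  by rewrite /e -expRD -natr1; congr expR; ring.
have E2 : e k = e k.+1 * expR (h * l).
  by rewrite /e -expRD -natr1; congr expR; ring.
apply/andP; split.
  rewrite ler_pdivlMr// {1}E2; have := expR_ge1Dx (h * l).
  have : 0 < e k.+1 by exact: expR_gt0.
  by move=> p q; have := ler_wpM2l (ltW p) q; lra.
rewrite ler_pdivrMr// {1}E1; have := expR_ge1Dx (- (h * l)).
have : 0 < e k by exact: expR_gt0.
by move=> p q; have := ler_wpM2l (ltW p) q; lra.
Qed.


Let kernel t := M t * expR (- (t * l)).

Let kernel_cell k :
  `|l * \int[leb]_(t in cell k) kernel t - cell_average M h k * (e k - e k.+1)| <=
  K * h * l * (e k - e k.+1).
Proof.
have mk : measurable_fun (cell k) kernel.
  by apply: measurable_funM => //; exact: measurable_decay_kernel.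
have ik : leb.-integrable (cell k) (EFin \o kernel).
  apply: (@integrable_cell _ K) => // t ct; rewrite normrM -[leRHS]mulr1.
  have t0 := cell_pos ct.
  rewrite ler_pM//; first exact: MK.
  by rewrite gtr0_norm ?expR_gt0// expRN_le1// mulr_ge0// ltW.
have iM : leb.-integrable (cell k) (EFin \o M).
  by apply: (@integrable_cell _ K) => // t /cell_pos; exact: MK.
rewrite (_ : _ - _ = \int[leb]_(t in cell k) (l * kernel t - (e k - e k.+1) / h * M t)).
  rewrite (_ : K * h * l * (e k - e k.+1) = K * (l * (e k - e k.+1)) * h); last by ring.
  apply: Rintegral_cell.
    apply: measurable_funB; apply: measurable_funM => //; exact: measurable_cst.
  move=> t ct; have t0 := cell_pos ct.
  rewrite (_ : _ - _ = M t * (l * expR (- (t * l)) - (e k - e k.+1) / h)); last first.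
    by rewrite /kernel; ring.
  rewrite normrM ler_pM// ?(MK t0)//.
  have /andP[d1 d2] := e_diff k.
  move: ct; rewrite /cell/= in_itv/= => /andP[kt tk].
  have t1 : l * e k.+1 <= l * expR (- (t * l)).
    by rewrite ler_pM2l// ler_expR lerN2 ler_pM2r.
  have t2 : l * expR (- (t * l)) <= l * e k.
    by rewrite ler_pM2l// ler_expR lerN2 ler_pM2r// ltW.
  rewrite ler_norml; lra.
rewrite RintegralB//; [|exact: mcell| |].
- rewrite RintegralZl//; last exact: mcell.
  rewrite RintegralZl//; last exact: mcell.
  by rewrite /cell_average; congr (_ - _); ring.
- by rewrite (_ : _ \o _ = fun t => (l%:E * (kernel t)%:E)%E)//; apply: integrableZl => //; exact: mcell.
- by rewrite (_ : _ \o _ = fun t => (((e k - e k.+1) / h)%:E * (M t)%:E)%E)//; apply: integrableZl => //; exact: mcell.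
Qed.

Lemma integrable_laplace : leb.-integrable `]0, +oo[ (EFin \o kernel).
Proof.
have I : leb.-integrable `]0, +oo[ (fun t => ((K / l)%:E * (l * expR (- (t * l)))%:E)%E).
  apply: integrableZl => //; apply: integrableS (integrable_decay 0 l0) => //.
  by apply: subset_itvr; rewrite bnd_simp.
apply: le_integrable I => //.
  by apply/measurable_EFinP; apply: measurable_funM => //; exact: measurable_decay_kernel.
move=> t /=; rewrite in_itv/= andbT => t0; rewrite lee_fin mulrA divfK ?gt_eqF//.
by rewrite !normrM ler_pM// (le_trans (MK t0))// ler_norm.
Qed.

Let kernel_tail n : `|l * \int[leb]_(t in `]n%:R * h, +oo[) kernel t| <= K * e n.
Proof.
have nh0 : 0 <= n%:R * h by rewrite mulr_ge0// ltW.
have I1 : leb.-integrable `]n%:R * h, +oo[ (EFin \o kernel).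
  by apply: integrableS integrable_laplace => //; apply: subset_itvr; rewrite bnd_simp.
have I2 : leb.-integrable `]n%:R * h, +oo[ (EFin \o (fun t => l * expR (- (t * l)))).
  by apply: integrableS (integrable_decay (n%:R * h) l0) => //; apply: subset_itvr; rewrite bnd_simp.
have E : \int[leb]_(t in `]n%:R * h, +oo[) (l * expR (- (t * l))) = e n.
  by rewrite Rintegral_itv_obnd_cbnd// /Rintegral integral_decay.
rewrite -E -RintegralZl// -RintegralZl//.
have I3 : leb.-integrable `]n%:R * h, +oo[ (EFin \o (fun t => l * kernel t)).
  by rewrite (_ : _ \o _ = fun t => (l%:E * (kernel t)%:E)%E)//; apply: integrableZl.
have I4 : leb.-integrable `]n%:R * h, +oo[ (EFin \o (fun t => K * (l * expR (- (t * l))))).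
  by rewrite (_ : _ \o _ = fun t => (K%:E * (l * expR (- (t * l)))%:E)%E)//; apply: integrableZl.
apply: le_trans (le_normr_Rintegral _ I3) _ => //.
apply: le_Rintegral => //; first exact: integrable_norm.
move=> t /=; rewrite in_itv/= andbT => t0.
rewrite !normrM (gtr0_norm l0) (gtr0_norm (expR_gt0 _)) mulrCA ler_wpM2r//.
  by rewrite mulr_ge0 ?expR_ge0// ltW.
by apply: MK; exact: le_lt_trans t0.
Qed.

Let kernel_split n : \int[leb]_(t in `]0, +oo[) kernel t =
  \sum_(0 <= k < n) \int[leb]_(t in cell k) kernel t +
  \int[leb]_(t in `]n%:R * h, +oo[) kernel t.
Proof.
elim: n => [|n ->]; first by rewrite big_nil add0r mul0r.
have nh0 : 0 <= n%:R * h by rewrite mulr_ge0// ltW.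
have nh1 : n%:R * h <= n.+1%:R * h by rewrite ler_pM2r// ler_nat.
have I1 : leb.-integrable `]n%:R * h, +oo[ (EFin \o kernel).
  by apply: integrableS integrable_laplace => //; apply: subset_itvr; rewrite bnd_simp.
rewrite big_nat_recr//= -addrA; congr (_ + _).
by rewrite -(Rintegral_itvB (x := n.+1%:R * h) I1) ?bnd_simp// addrC subrK.
Qed.

(** Replacing [M] by its averages over the cells costs [K h l], because on a
    cell both [l expR (- t l)] and its average lie between the values at the
    end points, and these variations telescope. *)
Lemma laplace_riemann_sum n :
  `|l * \int[leb]_(t in `]0, +oo[) kernel t -
    \sum_(0 <= k < n) cell_average M h k * (e k - e k.+1)| <= K * h * l + K * e n.
Proof.
rewrite (kernel_split n) mulrDr mulr_sumr addrAC -sumrB.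
apply: le_trans (ler_normD _ _) _; apply: lerD; last exact: kernel_tail.
apply: le_trans (ler_norm_sum _ _ _) _.
apply: (@le_trans _ _ (\sum_(0 <= k < n) K * h * l * (e k - e k.+1))).
  by apply: ler_sum => k _; exact: kernel_cell.
rewrite -mulr_sumr -[leRHS]mulr1 ler_wpM2l// ?mulr_ge0 ?(ltW h0) ?(ltW l0)//.
under eq_bigr do rewrite -opprB.
rewrite sumrN telescope_sumr// opprB /e mul0r mul0r oppr0 expR0 gerBl.
exact: expR_ge0.
Qed.

End Sum.
End LaplaceRiemannSum.

(** * Riemann sums of the multiplier operator *)

Section SpectralLinear.
Context d (X : measurableType d) (R : realType) (mu : {measure set X -> \bar R}).
Variable E : R -> (X -> R[i]) -> (X -> R[i]).
Hypothesis resE : resolution_of_identity mu E.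
Local Notation L2 := (inLp mu 2%:E).
Variable f : X -> R[i].
Hypothesis fL : L2 f.
Variable F : cumulative R R.
Hypothesis FE : forall l, F l = nrm mu (E l f) ^+ 2.
Local Notation nu := (lebesgue_stieltjes_measure F).

Lemma spectral_integralZD c (phi psi : R -> R[i]) u v :
  inLp nu 2%:E phi -> inLp nu 2%:E psi ->
  spectral_integral mu E phi f u -> spectral_integral mu E psi f v ->
  spectral_integral mu E (fun l => c * phi l + psi l) f (fun x => c * u x + v x).
Proof.
move=> phiL psiL /(spectral_integralP resE fL FE _ phiL)[uL [s [s1 s2]]].
move=> /(spectral_integralP resE fL FE _ psiL)[vL [s' [s1' s2']]].
have SL t := step_integral_inL2 resE t fL; have FL t := step_fun_inL2 resE fL FE t.
have lim g g' : g n @[n --> \oo] --> (0 : R) -> g' n @[n --> \oo] --> (0 : R) ->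
    normc c * g n + g' n @[n --> \oo] --> (0 : R).
  move=> g0 g0'; rewrite -[X in _ --> X](addr0 0); apply: cvgD => //.
  by rewrite -(mulr0 (normc c)); apply: cvgM => //; exact: cvg_cst.
apply/(spectral_integralP resE fL FE).
  by apply: inL2D => //; exact: inL2Z.
split; first by apply: inL2D => //; exact: inL2Z.
exists (fun n => scale_steps c (s n) ++ s' n); split.
  apply: (@squeeze_cvgr _ _ _ _ (fun=> 0) _ _ _ _ (cvg_cst _) (lim _ _ s1 s1')).
  apply: nearW => n; rewrite nrm_ge0/=.
  have h1 := inL2B phiL (FL (s n)); have h2 := inL2B psiL (FL (s' n)).
  rewrite -(nrmZ c h1); apply: le_trans (nrmD (inL2Z c h1) h2).
  rewrite le_eqVlt; apply/orP; left; apply/eqP; congr nrm; apply/funext => l.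
  by rewrite step_fun_cat step_fun_scale; ring.
apply: (@squeeze_cvgr _ _ _ _ (fun=> 0) _ _ _ _ (cvg_cst _) (lim _ _ s2 s2')).
apply: nearW => n; rewrite nrm_ge0/=.
have h1 := inL2B (SL (s n)) uL; have h2 := inL2B (SL (s' n)) vL.
rewrite -(nrmZ c h1); apply: le_trans (nrmD (inL2Z c h1) h2).
rewrite le_eqVlt; apply/orP; left; apply/eqP; congr nrm; apply/funext => x.
by rewrite step_integral_cat step_integral_scale; ring.
Qed.

Lemma spectral_integral0 : spectral_integral mu E (fun=> 0) f (fun=> 0).
Proof.
apply/(spectral_integralP resE fL FE); first exact: inL2_0.
split; first exact: inL2_0.
exists (fun=> [::]); split.
  rewrite (_ : (fun n => _) = (fun=> 0)); first exact: cvg_cst.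
  apply/funext => n; rewrite -[RHS](nrm0 nu); congr nrm; apply/funext => l.
  by rewrite /step_fun big_nil subrr.
rewrite (_ : (fun n => _) = (fun=> 0)); first exact: cvg_cst.
apply/funext => n; rewrite -[RHS](nrm0 mu); congr nrm; apply/funext => x.
by rewrite /step_integral big_nil subrr.
Qed.

Lemma spectral_integral_sum (c : nat -> R[i]) (phi : nat -> R -> R[i]) u n :
  (forall k, inLp nu 2%:E (phi k)) ->
  (forall k, spectral_integral mu E (phi k) f (u k)) ->
  spectral_integral mu E (fun l => \sum_(0 <= k < n) c k * phi k l) f
    (fun x => \sum_(0 <= k < n) c k * u k x).
Proof.
move=> phiL phiu; elim: n => [|n IH].
  under eq_fun do rewrite big_nil; under [X in spectral_integral _ _ _ _ X]eq_fun do rewrite big_nil.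
  exact: spectral_integral0.
have SL : inLp nu 2%:E (fun l => \sum_(0 <= k < n) c k * phi k l).
  by apply: inL2_sum => k; exact: inL2Z.
have := spectral_integralZD (c n) (phiL n) SL (phiu n) IH; congr spectral_integral.
  by apply/funext => l; rewrite big_nat_recr//= addrC.
by apply/funext => x; rewrite big_nat_recr//= addrC.
Qed.

End SpectralLinear.

Section MultiplierApproximation.
Context d (X : measurableType d) (R : realType) (mu : {measure set X -> \bar R}).
Hypothesis mu_fin : (mu setT < +oo)%E.
Variable T : R -> (X -> R[i]) -> (X -> R[i]).
Hypothesis markovT : symmetric_markovian_semigroup mu T.
Variable E : R -> (X -> R[i]) -> (X -> R[i]).
Hypothesis ET : resolution_of_generator mu E T.
Variables (M : R -> R[i]) (K : R).
Hypothesis mM : cmeasurable (`]0, +oo[ : set R) M.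
Hypothesis MK : forall t, 0 < t -> normc (M t) <= K.
Local Notation L2 := (inLp mu 2%:E).

Let resE : resolution_of_identity mu E := ET.1.

Let mesh n : R := n.+1%:R^-1.
Let ncell n := (n.+1 ^ 2)%N.

Let avgRe n := cell_average (fun t => Re (M t)) (mesh n).
Let avgIm n := cell_average (fun t => Im (M t)) (mesh n).

(** With [(n + 1) ^ 2] cells of width [1 / (n + 1)], the mesh tends to [0]
    while the end point [n + 1] of the sums tends to [+oo]. *)
Definition riemann_op n f x : R[i] := \sum_(0 <= k < ncell n)
  (avgRe n k +i* avgIm n k) * (T (k.+1%:R * mesh n) f x - T (k%:R * mesh n) f x).

Let riemann_mult n l : R[i] := \sum_(0 <= k < ncell n)
  (avgRe n k +i* avgIm n k) * (decay (k.+1%:R * mesh n) l - decay (k%:R * mesh n) l).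

Let mesh0 n : 0 < mesh n. Proof. by rewrite invr_gt0. Qed.

Let ReM_le t : 0 < t -> `|Re (M t)| <= K.
Proof. by move=> /MK; apply: le_trans; exact: ler_Re_normc. Qed.

Let ImM_le t : 0 < t -> `|Im (M t)| <= K.
Proof. by move=> /MK; apply: le_trans; exact: ler_Im_normc. Qed.

Let avgRe_le n k : `|avgRe n k| <= K.
Proof. by apply: cell_average_le => //; case: mM. Qed.

Let avgIm_le n k : `|avgIm n k| <= K.
Proof. by apply: cell_average_le => //; case: mM. Qed.

Let K0 : 0 <= K. Proof. exact: le_trans (normc_ge0 _) (MK ltr01). Qed.

Let riemann_mult_bounded n l : normc (riemann_mult n l) <= 2 * K.
Proof.
pose e k : R := expR (- (k%:R * mesh n * Num.max l 0)).
apply: (@le_trans _ _ (\sum_(0 <= k < ncell n) 2 * K * (e k - e k.+1))).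
  rewrite /riemann_mult; elim: (ncell n) => [|m IH]; first by rewrite !big_nil normc0.
  rewrite !big_nat_recr//=; apply: le_trans (normcD _ _) _; apply: lerD => //.
  have -> : decay (m.+1%:R * mesh n) l - decay (m%:R * mesh n) l = (e m.+1 - e m)%:C.
    by rewrite rmorphB.
  rewrite normcM normcC distrC ger0_norm; last first.
    rewrite subr_ge0 ler_expR lerN2 ler_wpM2r ?le_max ?lexx ?orbT//.
    by rewrite ler_pM2r// ler_nat.
  apply: ler_wpM2r.
    rewrite subr_ge0 ler_expR lerN2 ler_wpM2r ?le_max ?lexx ?orbT//.
    by rewrite ler_pM2r// ler_nat.
  apply: le_trans (normc_le_ReIm _) _ => /=.
  by rewrite mulr2n mulrDl mul1r lerD.
rewrite -mulr_sumr -[leRHS]mulr1 ler_wpM2l// ?mulr_ge0//.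
under eq_bigr do rewrite -opprB.
rewrite sumrN telescope_sumr// opprB /e mul0r mul0r oppr0 expR0 gerBl.
exact: expR_ge0.
Qed.

Let riemann_mult_cvg l :
  normc (riemann_mult n l - laplace_multiplier M l) @[n --> \oo] --> (0 : R).
Proof.
have [l0|l0] := leP l 0.
  rewrite (_ : (fun n => _) = (fun=> 0)); first exact: cvg_cst.
  apply/funext => n; rewrite /laplace_multiplier ltNge l0/= subr0.
  rewrite /riemann_mult big1 ?normc0// => k _.
  by rewrite /decay max_r// !mulr0 subrr mulr0.
pose err n := K * mesh n * l + K * expR (- ((ncell n)%:R * mesh n * l)).
apply: (@squeeze_cvgr _ _ _ _ (fun=> 0) (fun n => 2 * err n)).
- apply: nearW => n; rewrite normc_ge0/=.
  have D k : decay (k.+1%:R * mesh n) l - decay (k%:R * mesh n) l =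
      (- (expR (- (k%:R * mesh n * l)) - expR (- (k.+1%:R * mesh n * l))))%:C.
    by rewrite opprB rmorphB/= /decay max_l// ltW.
  have [mR mI] := mM.
  have mult_Re : Re (riemann_mult n l - laplace_multiplier M l) =
      l * \int[lebesgue_measure]_(t in `]0, +oo[) (Re (M t) * expR (- (t * l))) -
      \sum_(0 <= k < ncell n) avgRe n k *
        (expR (- (k%:R * mesh n * l)) - expR (- (k.+1%:R * mesh n * l))).
    rewrite cReD cReN /laplace_multiplier l0 cReN opprK mulrC Re_mulrC addrC.
    rewrite /riemann_mult Re_sum -sumrN mulrC; congr (_ * _ + _).
      by apply: eq_Rintegral => t _; rewrite Re_mulrC.
    by apply: eq_bigr => k _; rewrite D Re_mulrC/= mulrN.
  have mult_Im : Im (riemann_mult n l - laplace_multiplier M l) =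
      l * \int[lebesgue_measure]_(t in `]0, +oo[) (Im (M t) * expR (- (t * l))) -
      \sum_(0 <= k < ncell n) avgIm n k *
        (expR (- (k%:R * mesh n * l)) - expR (- (k.+1%:R * mesh n * l))).
    rewrite cImD cImN /laplace_multiplier l0 cImN opprK mulrC Im_mulrC addrC.
    rewrite /riemann_mult Im_sum -sumrN mulrC; congr (_ * _ + _).
      by apply: eq_Rintegral => t _; rewrite Im_mulrC.
    by apply: eq_bigr => k _; rewrite D Im_mulrC/= mulrN.
  apply: le_trans (normc_le_ReIm _) _; rewrite mult_Re mult_Im (_ : 2 * err n = err n + err n); last by ring.
  by apply: lerD; exact: laplace_riemann_sum.
- exact: cvg_cst.
rewrite -(mulr0 2); apply: cvgM; first exact: cvg_cst.
rewrite -[X in _ --> X](addr0 0); apply: cvgD.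
  rewrite -[X in _ --> X](mul0r l); apply: cvgM; last exact: cvg_cst.
  by rewrite -[X in _ --> X](mulr0 K); apply: cvgM; [exact: cvg_cst|exact: cvg_harmonic].
rewrite -[X in _ --> X](mulr0 K); apply: cvgM; first exact: cvg_cst.
apply: (cvg_comp (fun n => (ncell n)%:R * mesh n * l) (fun y => expR (- y))); last exact: cvgr_expR.
have ly : (fun y => y * l) x @[x --> +oo] --> +oo by apply: gt0_cvgMly => //; exact: cvg_id.
apply: (cvg_comp (fun n => (ncell n)%:R * mesh n) (fun y => y * l) _ ly).
rewrite (_ : (fun n => _) = (fun n => n.+1%:R)).
  apply: ger_cvgy; last exact: cvgr_idn.
  by apply: nearW => n; rewrite ler_nat.
by apply/funext => n; rewrite /ncell /mesh natrX expr2 mulfK.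
Qed.

Let cmeasurable_riemann_mult n : cmeasurable setT (riemann_mult n).
Proof.
apply: cmeasurable_sum => k; apply: cmeasurableM; first exact: cmeasurable_cst.
by apply: cmeasurableB; exact: cmeasurable_decay.
Qed.

(** The Laplace multiplier is the pointwise limit of its Riemann sums. *)
Lemma cmeasurable_laplace_multiplier : cmeasurable setT (laplace_multiplier M).
Proof.
have cvgc (h : R[i] -> R) l : (forall z w, h (z - w) = h z - h w) ->
    (forall z, `|h z| <= normc z) ->
    h (riemann_mult n l) @[n --> \oo] --> h (laplace_multiplier M l).
  move=> hB hle; apply/cvgrPdistC_lt => e e0.
  apply: filterS ((cvgr0Pnorm_lt _).1 (riemann_mult_cvg l) _ e0) => n; rewrite ger0_norm ?normc_ge0//; apply: le_lt_trans.
  by rewrite -hB.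
split.
  apply: (@measurable_fun_cvg _ _ _ _ (fun n l => Re (riemann_mult n l))) => [n|l _].
    by case: (cmeasurable_riemann_mult n).
  by apply: cvgc; [move=> z w; rewrite cReD cReN|exact: ler_Re_normc].
apply: (@measurable_fun_cvg _ _ _ _ (fun n l => Im (riemann_mult n l))) => [n|l _].
  by case: (cmeasurable_riemann_mult n).
by apply: cvgc; [move=> z w; rewrite cImD cImN|exact: ler_Im_normc].
Qed.

Lemma normc_laplace_multiplier l : normc (laplace_multiplier M l) <= 2 * K.
Proof.
apply: (ler_cvg0 (riemann_mult_cvg l)) => n.
have := normcD (riemann_mult n l) (- (riemann_mult n l - laplace_multiplier M l)).
rewrite normcN opprB addrC subrK => /le_trans; apply.
by rewrite lerD2r.
Qed.

(** The Riemann sums [riemann_op n f] have spectral multipliers that are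
    bounded and converge pointwise to the Laplace multiplier, so they converge
    to [m(A) f] in [L^2] by dominated convergence for the spectral measure. *)
Lemma riemann_op_cvg (S : (X -> R[i]) -> (X -> R[i])) f :
  spectral_multiplier mu E (laplace_multiplier M) S -> L2 f ->
  nrm mu (fun x => riemann_op n f x - S f x) @[n --> \oo] --> (0 : R).
Proof.
move=> Smult fL; have [F FE] := spectral_cumulative resE fL.
have nu_fin := stieltjes_fin resE fL FE.
have decayL t : 0 <= t -> inLp (lebesgue_stieltjes_measure F) 2%:E (decay t).
  move=> t0; apply: (inL2_bounded nu_fin (cmeasurable_decay t) (K := 1)).
  by apply: aeW => l; exact: normc_decay.
have mL : inLp (lebesgue_stieltjes_measure F) 2%:E (laplace_multiplier M).
  apply: (inL2_bounded nu_fin cmeasurable_laplace_multiplier (K := 2 * K)).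
  by apply: aeW => l; exact: normc_laplace_multiplier.
have rL n : inLp (lebesgue_stieltjes_measure F) 2%:E (riemann_mult n).
  apply: (inL2_bounded nu_fin (cmeasurable_riemann_mult n) (K := 2 * K)).
  by apply: aeW => l; exact: riemann_mult_bounded.
have t0 n k : 0 <= k%:R * mesh n by rewrite mulr_ge0// ltW.
have rS n : spectral_integral mu E (riemann_mult n) f (riemann_op n f).
  apply: (spectral_integral_sum resE fL FE) => k.
    by apply: inL2B; exact: decayL.
  have S1 := semigroup_spectral mu_fin markovT ET fL (t0 n k.+1).
  have S0 := semigroup_spectral mu_fin markovT ET fL (t0 n k).
  have := spectral_integralZD resE fL FE (- 1) (decayL _ (t0 n k)) (decayL _ (t0 n k.+1)) S0 S1.
  by congr spectral_integral; apply/funext => y; rewrite mulN1r addrC.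
have lim : nrm (lebesgue_stieltjes_measure F)
    (fun l => riemann_mult n l - laplace_multiplier M l) @[n --> \oo] --> (0 : R).
  apply: (@nrm_dominated_cvg _ _ _ _ _ (fun=> 2 * K + 2 * K)).
  - move=> n; apply: cmeasurableB; [exact: cmeasurable_riemann_mult|].
    exact: cmeasurable_laplace_multiplier.
  - exact: (integrable_cst_fin nu_fin).
  - apply: aeW => l n; apply: le_trans (normcD _ _) _; rewrite normcN.
    by apply: lerD; [exact: riemann_mult_bounded|exact: normc_laplace_multiplier].
  by apply: aeW => l; exact: riemann_mult_cvg.
apply: (@squeeze_cvgr _ _ _ _ (fun=> 0) _ _ _ _ (cvg_cst _) lim).
apply: nearW => n; rewrite nrm_ge0/=.
exact: (spectral_integral_dist resE fL FE (rL n) mL (rS n) (Smult f fL)).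
Qed.

End MultiplierApproximation.

(** * Bounded real functions *)

Section BoundedFunctions.
Context d (X : measurableType d) (R : realType) (mu : {measure set X -> \bar R}).
Hypothesis mu_fin : (mu setT < +oo)%E.
Implicit Types (u v w : X -> R).

Definition bdd u := measurable_fun setT u /\
  exists C, {ae mu, forall x, `|u x| <= C}.

Lemma bdd_cst (c : R) : bdd (fun=> c).
Proof. by split; [exact: measurable_cst|exists `|c|; apply: aeW]. Qed.

Lemma bddD u v : bdd u -> bdd v -> bdd (fun x => u x + v x).
Proof.
move=> [mu_ [C uC]] [mv [D vD]]; split; first exact: measurable_funD.
exists (C + D); apply: filterS2 uC vD => x uC vD.
exact: le_trans (ler_normD _ _) (lerD uC vD).
Qed.

Lemma bddM u v : bdd u -> bdd v -> bdd (fun x => u x * v x).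
Proof.
move=> [mu_ [C uC]] [mv [D vD]]; split; first exact: measurable_funM.
by exists (C * D); apply: filterS2 uC vD => x uC vD; rewrite normrM ler_pM.
Qed.

Lemma bddZ c u : bdd u -> bdd (fun x => c * u x).
Proof. exact/bddM/bdd_cst. Qed.

Lemma bddN u : bdd u -> bdd (fun x => - u x).
Proof.
by move=> /(bddZ (- 1)); congr bdd; apply/funext => x; rewrite mulN1r.
Qed.

Lemma bddB u v : bdd u -> bdd v -> bdd (fun x => u x - v x).
Proof. by move=> bu /bddN; exact: bddD. Qed.

Lemma bdd_ln u : bdd u -> {ae mu, forall x, 1 <= u x} -> bdd (fun x => ln (u x)).
Proof.
move=> [mu_ [C uC]] u1; split; first exact: (measurableT_comp (@measurable_ln R)).
exists C; apply: filterS2 uC u1 => x; rewrite ler_norml => /andP[_ uC] u1.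
rewrite ger0_norm ?ln_ge0//; apply: le_trans uC.
by have := @le_ln1Dx _ (u x - 1); rewrite subrKC; lra.
Qed.

Lemma integrable_bdd u : bdd u -> mu.-integrable setT (EFin \o u).
Proof.
move=> [mu_ [C uC]]; apply/integrableP; split; first exact/measurable_EFinP.
apply: (@le_lt_trans _ _ (\int[mu]_x (`|C|)%:E)%E).
  apply: ae_ge0_le_integral => //.
  - by apply: measurableT_comp => //; exact/measurable_EFinP.
  - apply: filterS uC => x uC _ /=; rewrite lee_fin; apply: le_trans uC _.
    exact: ler_norm.
by rewrite integral_cst// lte_mul_pinfty.
Qed.

Lemma Rintegral_ae_eq u v : bdd u -> bdd v -> {ae mu, forall x, u x = v x} ->
  \int[mu]_x u x = \int[mu]_x v x.
Proof.
move=> [mu_ _] [mv _] uv; rewrite /Rintegral; congr fine; apply: ae_eq_integral => //.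
- exact/measurable_EFinP.
- exact/measurable_EFinP.
by apply: filterS uv => x -> _.
Qed.

Lemma le_Rintegral_ae u v : bdd u -> bdd v -> {ae mu, forall x, u x <= v x} ->
  \int[mu]_x u x <= \int[mu]_x v x.
Proof.
move=> bu bv uv; rewrite -subr_ge0 -RintegralB//; try exact: integrable_bdd.
have bm : bdd (fun x => Num.max (v x - u x) 0).
  have [m [C C0]] := bddB bv bu; split; first exact: measurable_maxr.
  exists C; apply: filterS C0 => x; apply: le_trans.
  by rewrite ger0_norm ?le_max ?lexx ?orbT// ge_max ler_norm normr_ge0.
rewrite (Rintegral_ae_eq (bddB bv bu) bm).
  by apply: Rintegral_ge0 => x _; rewrite le_max lexx orbT.
by apply: filterS uv => x uv; rewrite max_l// subr_ge0.
Qed.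

Lemma bdd_sum (F : nat -> X -> R) n : (forall k, bdd (F k)) ->
  bdd (fun x => \sum_(0 <= k < n) F k x).
Proof.
move=> bF; elim: n => [|n IH]; first by under eq_fun do rewrite big_nil; exact: bdd_cst.
by under eq_fun do rewrite big_nat_recr//=; exact: bddD.
Qed.

Lemma Rintegral_bdd_sum (F : nat -> X -> R) n : (forall k, bdd (F k)) ->
  \int[mu]_x (\sum_(0 <= k < n) F k x) = \sum_(0 <= k < n) \int[mu]_x F k x.
Proof.
move=> bF; elim: n => [|n IH].
  under eq_Rintegral do rewrite big_nil.
  by rewrite big_nil Rintegral_cst// mul0r.
rewrite big_nat_recr//= -IH -RintegralD//; last 2 first.
- exact/integrable_bdd/bdd_sum.
- exact: integrable_bdd.
by apply: eq_Rintegral => x _; rewrite big_nat_recr.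
Qed.

End BoundedFunctions.

(** * The Bellman function *)

Section Bellman.
Context (R : realType).
Implicit Types (x a y b eps : R).

(** The term [x * y ^+ 2] makes [bellman x y - eps * (x * y)] convex in [y],
    and a large multiple of [x ln x - x] absorbs the mixed term in [x] and [y];
    [15] comes from the completion of the square in [bellman_tangent_le]. *)
Definition bellman x y := 15 * (x * ln x - x) + x * y ^+ 2.

(** The tangent plane of [bellman x y - eps * (x * y)] at [(a, b)], sorted by
    powers of [x] and [y] so that a Markov operator can be applied to it. *)
Definition bellman_tangent eps a b x y :=
  (- 15 * a - 2 * a * b ^+ 2 + eps * a * b) +
  (15 * ln a + b ^+ 2 - eps * b) * x + (2 * a * b - eps * a) * y.

Let gap eps a b x y : bellman x y - eps * (x * y) - bellman_tangent eps a b x y =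
  15 * (x * ln x - x * ln a - x + a) +
  (2 * b - eps) * (x - a) * (y - b) + x * (y - b) ^+ 2.
Proof. by rewrite /bellman /bellman_tangent; ring. Qed.

(** The Bregman divergence of [x ln x] dominates the squared Hellinger
    distance, by [ln s <= s - 1] at [s = Num.sqrt a / Num.sqrt x]. *)
Let ln_div_ge x a : 0 < x -> 0 < a ->
  (Num.sqrt x - Num.sqrt a) ^+ 2 <= x * ln x - x * ln a - x + a.
Proof.
move=> x0 a0; set p := Num.sqrt x; set q := Num.sqrt a.
have p0 : 0 < p by rewrite sqrtr_gt0.
have q0 : 0 < q by rewrite sqrtr_gt0.
have -> : x = p ^+ 2 by rewrite sqr_sqrtr// ltW.
have -> : a = q ^+ 2 by rewrite sqr_sqrtr// ltW.
rewrite !lnXn// !mulr2n.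
have h : ln q - ln p <= q / p - 1.
  rewrite -ln_div ?posrE//; have := @le_ln1Dx _ (q / p - 1).
  by rewrite subrKC; apply; rewrite ltrBrDl subrr divr_gt0.
have : p ^+ 2 * (ln q - ln p) <= p ^+ 2 * (q / p - 1) by rewrite ler_wpM2l ?sqr_ge0.
have -> : p ^+ 2 * (q / p - 1) = p * q - p ^+ 2 by field; rewrite gt_eqF.
by move=> H; rewrite sqrrB; lra.
Qed.

(** Convexity, as a global inequality that needs no second derivatives.  With
    [r = |sqrt x - sqrt a|], [p = sqrt x] and [s = |y - b| <= 2], the mixed term
    of [gap] is at most [3 r (2 p + r) s = 6 r (p s) + 3 r^2 s], and
    [6 r (p s) <= 9 r^2 + (p s)^2] while [3 r^2 s <= 6 r^2]. *)
Lemma bellman_tangent_le eps a b x y : `|eps| <= 1 -> 0 < a -> 0 < x ->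
  `|b| <= 1 -> `|y| <= 1 ->
  bellman_tangent eps a b x y <= bellman x y - eps * (x * y).
Proof.
move=> e1 a0 x0 b1 y1; rewrite -subr_ge0 gap.
have := ln_div_ge x0 a0; set D := (_ - x + a).
set p := Num.sqrt x; set q := Num.sqrt a => HD.
have p0 : 0 <= p by exact: sqrtr_ge0.
have q0 : 0 <= q by exact: sqrtr_ge0.
have px : x = p ^+ 2 by rewrite sqr_sqrtr// ltW.
have qa : a = q ^+ 2 by rewrite sqr_sqrtr// ltW.
have cb : `|2 * b - eps| <= 3.
  apply: le_trans (ler_normB _ _) _; rewrite normrM ger0_norm//; lra.
have dle : `|y - b| <= 2 by apply: le_trans (ler_normB _ _) _; lra.
have : `|(2 * b - eps) * (x - a) * (y - b)| <=
    3 * (`|p - q| * (2 * p + `|p - q|)) * `|y - b|.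
  rewrite !normrM ler_wpM2r// ler_pM// px qa subr_sqr normrM ler_wpM2l//.
  apply: le_trans (ler_normD _ _) _.
  by have := ler_normB p (p - q); rewrite subKr (ger0_norm p0) (ger0_norm q0); lra.
rewrite ler_norml => /andP[H2 _].
have e1' : x * (y - b) ^+ 2 = (p * `|y - b|) ^+ 2.
  by rewrite exprMn -px real_normK// num_real.
have e2' : (p - q) ^+ 2 = `|p - q| ^+ 2 by rewrite real_normK// num_real.
rewrite e1'; rewrite e2' in HD.
move: HD H2 dle; set r := `|p - q|; set s := `|y - b| => HD H2 dle.
have r0 : 0 <= r by exact: normr_ge0.
have s0 : 0 <= s by exact: normr_ge0.
have h1 : 3 * (r * (2 * p + r)) * s <= 15 * r ^+ 2 + (p * s) ^+ 2.
  have := sqr_ge0 (3 * r - p * s); have : r ^+ 2 * s <= r ^+ 2 * 2 by rewrite ler_wpM2l ?sqr_ge0.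
  move=> k1 k2.
  have -> : 3 * (r * (2 * p + r)) * s = 6 * (r * (p * s)) + 3 * (r ^+ 2 * s) by ring.
  move: k2; rewrite sqrrB exprMn; lra.
lra.
Qed.

(** The tangent plane at a point close to [(x, y)] is nearly as good as the one
    at [(x, y)] itself: it is thus enough to use countably many tangent planes,
    and the exceptional null sets of a Markov operator can be collected. *)
Lemma bellman_gap_le eps a b x y N (e : R) : `|eps| <= 1 -> 1 <= a -> 1 <= x <= N ->
  `|b| <= 1 -> `|x - a| <= e -> `|y - b| <= e ->
  bellman x y - eps * (x * y) <= bellman_tangent eps a b x y + (18 + N) * e ^+ 2.
Proof.
move=> e1 a1 /andP[x1 xN] b1 xa yb; rewrite -lerBlDl gap.
have a0 : 0 < a by lra.
have x0 : 0 < x by lra.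
have e0 : 0 <= e by exact: le_trans (normr_ge0 _) xa.
have h1 : x * ln x - x * ln a - x + a <= e ^+ 2.
  have h : ln x - ln a <= x / a - 1.
    rewrite -ln_div ?posrE//; have := @le_ln1Dx _ (x / a - 1).
    by rewrite subrKC; apply; rewrite ltrBrDl subrr divr_gt0.
  have : x * (ln x - ln a) <= x * (x / a - 1) by rewrite ler_wpM2l// ltW.
  have E : x * (x / a - 1) - x + a = (x - a) ^+ 2 / a by field; rewrite gt_eqF.
  have : (x - a) ^+ 2 / a <= e ^+ 2.
    rewrite ler_pdivrMr//; apply: (@le_trans _ _ (e ^+ 2)).
      by rewrite -[leLHS]real_normK ?num_real// ler_sqr ?nnegrE.
    by rewrite ler_peMr ?sqr_ge0.
  by rewrite -E; lra.
have h2 : (2 * b - eps) * (x - a) * (y - b) <= 3 * e ^+ 2.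
  apply: le_trans (ler_norm _) _; rewrite !normrM expr2 mulrA ler_pM// ?ler_pM//.
  apply: le_trans (ler_normB _ _) _; rewrite normrM ger0_norm//; lra.
have h3 : x * (y - b) ^+ 2 <= N * e ^+ 2.
  rewrite ler_pM ?sqr_ge0 ?(ltW x0)//.
  by rewrite -[leLHS]real_normK ?num_real// ler_sqr ?nnegrE.
lra.
Qed.

Lemma bellman_ge x y : 1 <= x -> - 15 <= bellman x y.
Proof.
move=> x1; have x0 : 0 < x by lra.
have := ln_div_ge x0 (@ltr01 R); rewrite ln1 mulr0 subr0.
have := sqr_ge0 (Num.sqrt x - Num.sqrt 1).
have : 0 <= x * y ^+ 2 by rewrite mulr_ge0 ?sqr_ge0// ltW.
by rewrite /bellman; lra.
Qed.

Lemma bellman_le x y : 1 <= x -> `|y| <= 1 -> bellman x y <= 15 * (x * ln x).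
Proof.
move=> x1 y1; rewrite /bellman.
have : x * y ^+ 2 <= x * 1.
  by rewrite ler_wpM2l//; [lra|rewrite -real_normK ?num_real// exprn_ile1].
lra.
Qed.

End Bellman.

(** * Symmetric Markov operators and variation along their iterates *)

Section MarkovOperator.
Context d (X : measurableType d) (R : realType) (mu : {measure set X -> \bar R}).
Hypothesis mu_fin : (mu setT < +oo)%E.
Implicit Types (u v w : X -> R).
Local Notation bdd := (bdd mu).

(** On a finite measure space bounded functions are stable under everything
    that is needed, including the logarithm of functions that are at least [1],
    and all their integrals are finite. *)
Record markov_operator (P : (X -> R) -> (X -> R)) : Prop := {
  markov_bdd : forall u, bdd u -> bdd (P u) ;
  markov_linear : forall a u v, bdd u -> bdd v ->
    {ae mu, forall x, P (fun z => a * u z + v z) x = a * P u x + P v x} ;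
  markov_ge0 : forall u, bdd u -> {ae mu, forall x, 0 <= u x} ->
    {ae mu, forall x, 0 <= P u x} ;
  markov_one : {ae mu, forall x, P (fun=> 1) x = 1} ;
  markov_sym : forall u v, bdd u -> bdd v ->
    \int[mu]_x (P u x * v x) = \int[mu]_x (u x * P v x) }.

Variable P : (X -> R) -> (X -> R).
Hypothesis markovP : markov_operator P.

Local Hint Resolve bdd_cst : core.

(** The germ of Jensen's inequality: affine minorants are preserved. *)
Lemma markov_affine_le a b c u v w : bdd u -> bdd v -> bdd w ->
  {ae mu, forall x, c + a * u x + b * v x <= w x} ->
  {ae mu, forall x, c + a * P u x + b * P v x <= P w x}.
Proof.
move=> bu bv bw H; have b1 := bdd_cst mu 1.
have bc : bdd (fun x => c * (- 1) + w x) by apply: bddD => //; exact: bdd_cst.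
have bb : bdd (fun x => - b * v x + (- c * 1 + w x)).
  by apply: bddD; [exact: bddZ|apply: bddD => //; exact: bdd_cst].
have ba : bdd (fun x => - a * u x + (- b * v x + (- c * 1 + w x))).
  by apply: bddD => //; exact: bddZ.
have bc' : bdd (fun x => - c * 1 + w x) by apply: bddD => //; exact: bdd_cst.
have p0 : {ae mu, forall x, 0 <= P (fun x => - a * u x + (- b * v x + (- c * 1 + w x))) x}.
  by apply: markov_ge0 => //; apply: filterS H => x; lra.
have /= l1 := markov_linear markovP (- a) bu bb.
have /= l2 := markov_linear markovP (- b) bv bc'.
have /= l3 := markov_linear markovP (- c) b1 bw.
have o := markov_one markovP.
apply: filterS2 p0 (filterI (filterI l1 l2) (filterI l3 o)) => x.
by move=> p [[h1 h2] [h3 h4]]; rewrite h1 h2 h3 h4 in p; lra.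
Qed.

Lemma markov_ge u c : bdd u -> {ae mu, forall x, c <= u x} ->
  {ae mu, forall x, c <= P u x}.
Proof.
move=> bu uc.
have H : {ae mu, forall x, c + 0 * u x + 0 * u x <= u x}.
  by apply: filterS uc => x; lra.
by apply: filterS (markov_affine_le bu bu bu H) => x; lra.
Qed.

Lemma markov_le u c : bdd u -> {ae mu, forall x, u x <= c} ->
  {ae mu, forall x, P u x <= c}.
Proof.
move=> bu uc; have bc := bdd_cst mu c.
have H : {ae mu, forall x, 0 + 1 * u x + 0 * u x <= c}.
  by apply: filterS uc => x; lra.
have /= l := markov_linear markovP c (bdd_cst mu 1) (bdd_cst mu 0).
have /= l0 := markov_linear markovP 1 (bdd_cst mu 0) (bdd_cst mu 0).
have K := markov_affine_le bu bu bc H.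
have o := markov_one markovP.
rewrite (_ : (fun z => c * 1 + 0) = (fun=> c)) in l; last by apply/funext => z; ring.
rewrite (_ : (fun z => 1 * 0 + 0) = (fun=> 0)) in l0; last by apply/funext => z; ring.
apply: filterS2 K (filterI (filterI l l0) o) => x Kx [[lx l0x] ox].
by rewrite ox in lx; lra.
Qed.

Lemma Rintegral_markov u : bdd u -> \int[mu]_x P u x = \int[mu]_x u x.
Proof.
move=> bu; have b1 := bdd_cst mu 1; have bP := markov_bdd markovP bu.
have := markov_sym markovP bu b1; under eq_Rintegral do rewrite mulr1.
move=> ->; apply: Rintegral_ae_eq => //.
  by apply: bddM => //; exact: markov_bdd.
by apply: filterS (markov_one markovP) => x ->; rewrite mulr1.
Qed.

Section Jensen.
Variables (u v : X -> R) (N : R).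
Hypothesis bu : bdd u.
Hypothesis bv : bdd v.
Hypothesis u1 : {ae mu, forall x, 1 <= u x <= N}.
Hypothesis v1 : {ae mu, forall x, `|v x| <= 1}.

Lemma markov_range_u : {ae mu, forall x, 1 <= P u x <= N}.
Proof.
have l : {ae mu, forall x, 1 <= u x} by apply: filterS u1 => x /andP[].
have r : {ae mu, forall x, u x <= N} by apply: filterS u1 => x /andP[].
by apply: filterS2 (markov_ge bu l) (markov_le bu r) => x -> ->.
Qed.

Lemma markov_range_v : {ae mu, forall x, `|P v x| <= 1}.
Proof.
have l : {ae mu, forall x, - 1 <= v x} by apply: filterS v1 => x; rewrite ler_norml => /andP[].
have r : {ae mu, forall x, v x <= 1} by apply: filterS v1 => x; rewrite ler_norml => /andP[].
by apply: filterS2 (markov_ge bv l) (markov_le bv r) => x ? ?; rewrite ler_norml; apply/andP.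
Qed.

Let bdd_bellman u' v' : bdd u' -> bdd v' -> {ae mu, forall x, 1 <= u' x <= N} ->
  bdd (fun x => bellman (u' x) (v' x)).
Proof.
move=> b1 b2 l; have bl : bdd (fun x => ln (u' x)).
  by apply: bdd_ln => //; apply: filterS l => x /andP[].
rewrite /bellman; apply: bddD; first by apply: bddZ; apply: bddB => //; exact: bddM.
under eq_fun do rewrite expr2.
by apply: bddM => //; exact: bddM.
Qed.

(** A convex function is the supremum of its tangent planes, countably many of
    which suffice. *)
Let bellman_jensen_ae eps : `|eps| <= 1 ->
  {ae mu, forall x, bellman (P u x) (P v x) - eps * (P u x * P v x) <=
     P (fun z => bellman (u z) (v z) - eps * (u z * v z)) x}.
Proof.
move=> e1; set W := (fun z => _ - _).
have bW : bdd W by apply: bddB; [exact: bdd_bellman|apply: bddZ; exact: bddM].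
(* For each [n], the points of contact form a grid of mesh [1 / n.+1]. *)
pose a n i : R := 1 + i%:R / n.+1%:R.
pose b n j : R := - 1 + j%:R / n.+1%:R.
have tan : {ae mu, forall x (n i j : nat), `|b n j| <= 1 ->
    bellman_tangent eps (a n i) (b n j) (P u x) (P v x) <= P W x}.
  apply/ae_foralln => n; apply/ae_foralln => i; apply/ae_foralln => j.
  have [bj|bj] := boolP (`|b n j| <= 1); last by apply: aeW => x.
  have H : {ae mu, forall x, bellman_tangent eps (a n i) (b n j) (u x) (v x) <= W x}.
    apply: filterS2 u1 v1 => x /andP[ux _] vx; apply: bellman_tangent_le => //.
      by rewrite /a ltr_pwDl.
    exact: lt_le_trans ltr01 ux.
  by apply: filterS (markov_affine_le bu bv bW H) => x ? _.
apply: filterS3 tan markov_range_u markov_range_v => x tan ux vx.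
have lim : (18 + N) * n.+1%:R^-1 @[n --> \oo] --> (0 : R).
  by rewrite -(mulr0 (18 + N)); apply: cvgM; [exact: cvg_cst|exact: cvg_harmonic].
apply: (ler_cvg0 lim) => n; have n0 : 0 < n.+1%:R :> R by rewrite ltr0n.
have near (y : R) : 0 <= y -> exists i : nat, i%:R / n.+1%:R <= y < i%:R / n.+1%:R + n.+1%:R^-1.
  move=> y0; exists (Num.truncn (y * n.+1%:R)).
  have ym : 0 <= y * n.+1%:R by rewrite mulr_ge0// ltW.
  rewrite ler_pdivrMr// truncn_le ym/= -[X in _ < _ + X]mul1r -mulrDl.
  by rewrite ltr_pdivlMr// natr1 truncnS_gt.
have /andP[ux1 uxN] := ux.
have [|i /andP[i1 i2]] := near (P u x - 1); first by rewrite subr_ge0.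
move: (vx); rewrite ler_norml => /andP[vx1 vx2].
have [|j /andP[j1 j2]] := near (P v x + 1); first by lra.
have a1 : 1 <= a n i by rewrite /a lerDl divr_ge0.
have b1 : `|b n j| <= 1.
  have j0 : 0 <= j%:R / n.+1%:R :> R by rewrite divr_ge0.
  by rewrite ler_norml /b; move: (_ / _) j0 j1 => q j0 j1; lra.
have ua : `|P u x - a n i| <= n.+1%:R^-1 by rewrite ler_norml /a; move: i1 i2; move: (i%:R / _) => q; move: (_^-1) => r i1 i2; lra.
have vb : `|P v x - b n j| <= n.+1%:R^-1.
  by rewrite ler_norml /b; move: j1 j2; move: (j%:R / _) => q; move: (_^-1) => r j1 j2; lra.
have := bellman_gap_le e1 a1 ux b1 ua vb => /le_trans; apply; apply: lerD.
  exact: tan.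
rewrite ler_wpM2l//; first by lra.
by rewrite expr2; apply: ler_piMr; rewrite ?invr_ge0// invf_le1// ler1n.
Qed.

(** Jensen's inequality for [P] and the convex functions
    [bellman x y - eps * (x * y)], with [eps = 1] and [eps = - 1]. *)
Lemma bellman_step :
  `|\int[mu]_x (u x * v x) - \int[mu]_x (P u x * P v x)| <=
  \int[mu]_x bellman (u x) (v x) - \int[mu]_x bellman (P u x) (P v x).
Proof.
have bPu := markov_bdd markovP bu; have bPv := markov_bdd markovP bv.
have bB := bdd_bellman bu bv u1; have bPB := bdd_bellman bPu bPv markov_range_u.
have bM := bddM bu bv; have bPM := bddM bPu bPv.
have H eps : `|eps| <= 1 ->
    \int[mu]_x bellman (P u x) (P v x) - eps * \int[mu]_x (P u x * P v x) <=
    \int[mu]_x bellman (u x) (v x) - eps * \int[mu]_x (u x * v x).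
  move=> e1; rewrite -!RintegralZl//; try exact: integrable_bdd.
  have bE := bddZ eps bM; have bPE := bddZ eps bPM.
  rewrite -!RintegralB//; try exact: integrable_bdd.
  rewrite -[leRHS]Rintegral_markov; last exact: bddB.
  apply: le_Rintegral_ae; [exact: mu_fin|exact: bddB|apply: markov_bdd => //; exact: bddB|].
  exact: bellman_jensen_ae.
have H1 := H 1 ltac:(by rewrite normr1).
have H2 := H (- 1) ltac:(by rewrite normrN1).
by rewrite ler_norml; lra.
Qed.

End Jensen.

Lemma markov_sym_iter k u v : bdd u -> bdd v ->
  \int[mu]_x (iter (2 * k) P u x * v x) = \int[mu]_x (iter k P u x * iter k P v x).
Proof.
have biter n w : bdd w -> bdd (iter n P w).
  by move=> bw; elim: n => //= n; exact: markov_bdd.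
elim: k u v => [|k IH] u v bu bv //.
rewrite mulnS -[(2 + 2 * k)%N]/((2 * k).+2) iterS markov_sym//; last exact: biter.
rewrite iterSr IH//; [|exact: markov_bdd|exact: markov_bdd].
by rewrite -!iterSr.
Qed.

(** By symmetry [int (P^(2 k) u) v = int (P^k u) (P^k v)]: the even iterates
    are those for which both arguments of [bellman] evolve, and its integral
    drops by at least the increment at each step.  Adding [1] to [w] changes
    the integrals by a constant and keeps the first argument away from [0],
    where the logarithm is unbounded. *)
Lemma markov_variation w v n : bdd w -> bdd v ->
  {ae mu, forall x, 0 <= w x} -> {ae mu, forall x, `|v x| <= 1} ->
  \sum_(0 <= k < n) `|\int[mu]_x (iter (2 * k.+1) P w x * v x) -
                      \int[mu]_x (iter (2 * k) P w x * v x)| <=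
  15 * \int[mu]_x ((1 + w x) * ln (1 + w x)) + 15 * fine (mu setT).
Proof.
move=> bw bv w0 v1; pose u := fun x => 1 * 1 + w x.
have b1 := bdd_cst mu 1.
have bu : bdd u by apply: bddD => //; exact: bdd_cst.
have biter m z : bdd z -> bdd (iter m P z).
  by move=> bz; elim: m => //= m; exact: markov_bdd.
have [N uN] : exists N, {ae mu, forall x, 1 <= u x <= N}.
  have [_ [C wC]] := bw; exists (1 + C); apply: filterS2 w0 wC => x x0.
  by rewrite /u ler_norml => /andP[_ h]; lra.
have ru k : {ae mu, forall x, 1 <= iter k P u x <= N}.
  by elim: k => //= k IH; apply: markov_range_u => //; exact: biter.
have rv k : {ae mu, forall x, `|iter k P v x| <= 1}.
  by elim: k => //= k IH; apply: markov_range_v => //; exact: biter.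
have uw m : {ae mu, forall x, iter m P u x = 1 + iter m P w x}.
  elim: m => [|m IH]; first by apply: aeW => x; rewrite /u mulr1.
  have bm := biter m u bu; have bm' := biter m w bw.
  have /= H1 := markov_linear markovP 1 b1 bm'.
  have /= H2 := markov_linear markovP (- 1) bm (bddD (bddZ 1 b1) bm').
  have H3 : {ae mu, forall x, P (fun z => - 1 * iter m P u z + (1 * 1 + iter m P w z)) x = 0}.
    have bz := bddD (bddZ (- 1) bm) (bddD (bddZ 1 b1) bm').
    have z0 : {ae mu, forall x, - 1 * iter m P u x + (1 * 1 + iter m P w x) = 0}.
      by apply: filterS IH => x ->; ring.
    have z1 : {ae mu, forall x, 0 <= - 1 * iter m P u x + (1 * 1 + iter m P w x)}.
      by apply: filterS z0 => x ->.
    have z2 : {ae mu, forall x, - 1 * iter m P u x + (1 * 1 + iter m P w x) <= 0}.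
      by apply: filterS z0 => x ->.
    apply: filterS2 (markov_ge bz z1) (markov_le bz z2) => x h1 h2.
    by apply/eqP; rewrite eq_le h1 h2.
  apply: filterS2 (filterI H1 H2) (filterI H3 (markov_one markovP)) => x /=.
  by move=> [h1 h2] [h3 h4]; rewrite h3 h1 h4 in h2; lra.
have E k : \int[mu]_x (iter (2 * k.+1) P w x * v x) - \int[mu]_x (iter (2 * k) P w x * v x) =
    \int[mu]_x (iter k.+1 P u x * iter k.+1 P v x) - \int[mu]_x (iter k P u x * iter k P v x).
  rewrite -!markov_sym_iter//.
  have F m : \int[mu]_x (iter m P u x * v x) = \int[mu]_x v x + \int[mu]_x (iter m P w x * v x).
    rewrite -RintegralD//; [|exact: integrable_bdd|exact/integrable_bdd/bddM/bv/biter].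
    apply: Rintegral_ae_eq => //; [exact/bddM/bv/biter|exact/bddD/bddM/bv/biter|].
    by apply: filterS (uw m) => x ->; ring.
  by rewrite !F; ring.
pose B k := \int[mu]_x bellman (iter k P u x) (iter k P v x).
have bB k : bdd (fun x => bellman (iter k P u x) (iter k P v x)).
  have b2 := biter k u bu; have b3 := biter k v bv.
  have bl : bdd (fun x => ln (iter k P u x)).
    by apply: bdd_ln => //; apply: filterS (ru k) => x /andP[].
  rewrite /bellman; apply: bddD; first by apply: bddZ; apply: bddB => //; exact: bddM.
  under eq_fun do rewrite expr2.
  by apply: bddM => //; exact: bddM.
apply: (@le_trans _ _ (\sum_(0 <= k < n) (B k - B k.+1))).
  apply: ler_sum => k _; rewrite E distrC.
  by apply: (bellman_step (N := N)) => //; exact: biter.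
under eq_bigr do rewrite -opprB.
rewrite sumrN telescope_sumr// opprB; apply: lerD.
  have bl : bdd (fun x => ln (u x)) by apply: bdd_ln => //; apply: filterS uN => x /andP[].
  have bul := bddM bu bl.
  rewrite -RintegralZl//; last first.
    by have := integrable_bdd mu_fin bul; congr integrable; apply/funext => x /=; rewrite /u mulr1.
  rewrite (_ : (fun x => 15 * ((1 + w x) * ln (1 + w x))) = (fun x => 15 * (u x * ln (u x)))); last first.
    by apply/funext => x; rewrite /u mulr1.
  apply: le_Rintegral_ae => //; first exact: bddZ.
  by apply: filterS2 uN v1 => x /andP[ux _] vx; exact: bellman_le.
rewrite lerNl -mulNr -Rintegral_cst//.
apply: le_Rintegral_ae => //.
by apply: filterS (ru n) => x /andP[ux _]; exact: bellman_ge.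
Qed.

End MarkovOperator.

(** * The semigroup on bounded real functions *)

Lemma ge0_complexP (R : realType) (z : R[i]) : 0 <= z -> Im z = 0 /\ 0 <= Re z.
Proof. by case: z => a b; rewrite lecE/= => /andP[/eqP -> ->]. Qed.

Section RealSemigroup.
Context d (X : measurableType d) (R : realType) (mu : {measure set X -> \bar R}).
Hypothesis mu_gt0 : (0 < mu setT)%E.
Hypothesis mu_fin : (mu setT < +oo)%E.
Variable T : R -> (X -> R[i]) -> (X -> R[i]).
Hypothesis markovT : symmetric_markovian_semigroup mu T.
Local Notation L2 := (inLp mu 2%:E).
Local Notation bdd := (bdd mu).
Implicit Types (u v w : X -> R).

Definition cplx u x : R[i] := (u x)%:C.

Lemma cplx_inL2 u : bdd u -> L2 (cplx u).
Proof.
move=> [mu_ [C uC]]; apply: (inL2_bounded mu_fin (K := C)).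
  exact: cmeasurable_real.
by apply: filterS uC => x; rewrite normcC.
Qed.

Definition real_semigroup t u x := Re (T t (cplx u) x).

Variable t : R.
Hypothesis t0 : 0 <= t.

Let opT := semigroup_op markovT t0.

Let T_ge0 u : bdd u -> {ae mu, forall x, 0 <= u x} ->
  {ae mu, forall x, Im (T t (cplx u) x) = 0 /\ 0 <= real_semigroup t u x}.
Proof.
move=> bu u0; have uL := cplx_inL2 bu.
have : ae_nonneg mu (cplx u) by apply: filterS u0 => x; rewrite ler0c.
by move=> /(smsg_positivity markovT t0 uL); apply: filterS => x /ge0_complexP.
Qed.

Let T_linear a u v : bdd u -> bdd v ->
  {ae mu, forall x, T t (cplx (fun z => a * u z + v z)) x =
                    a%:C * T t (cplx u) x + T t (cplx v) x}.
Proof.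
move=> bu bv; have := L2op_linear opT a%:C (cplx_inL2 bu) (cplx_inL2 bv).
rewrite (_ : (fun x => a%:C * cplx u x + cplx v x) = cplx (fun z => a * u z + v z)).
  by apply: filterS => x /(_ I).
by apply/funext => x; rewrite /cplx rmorphD rmorphM.
Qed.

(** [T t 1] has modulus at most [1] by contractivity on [L^oo] and real part at
    least [1] by positivity and conservation of mass. *)
Lemma semigroup_one : {ae mu, forall x, T t (cplx (fun=> 1)) x = 1}.
Proof.
have b1 := bdd_cst mu 1; have oneL := cplx_inL2 b1.
have T1L := semigroup_inL2 markovT t0 oneL.
have le1 : {ae mu, forall x, normc (T t (cplx (fun=> 1)) x) <= 1}.
  have oneoo : (cLnorm mu +oo (cplx (fun=> 1%R)) <= 1)%E.
    rewrite /cLnorm unlock mu_gt0; apply/ess_supP; apply: aeW => x.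
    by rewrite -[leLHS]/(`|normc (cplx (fun=> 1%R) x)|%:E)%E lee_fin normcC !normr1.
  have one_oo : inLp mu +oo%E (cplx (fun=> 1)).
    by split; [exact: inL2_meas oneL|exact: le_lt_trans oneoo (ltry _)].
  have := smsg_contraction markovT (leey _) t0 oneL one_oo.
  move=> /le_trans /(_ oneoo); rewrite {1}/cLnorm unlock mu_gt0 => /ess_supP.
  by apply: filterS => x /=; rewrite lee_fin ger0_norm ?normc_ge0.
have [A [mA ndA UA AL supA]] := smsg_conservation markovT t0.
have ge1 : {ae mu, forall x (n : nat),
    Re (T t (cindic R (A n)) x) <= Re (T t (cplx (fun=> 1)) x)}.
  apply/ae_foralln => n.
  have bA : bdd (\1_(A n)).
    split; first exact: measurable_indic.
    by exists 1; apply: aeW => x; rewrite indicE; case: (_ \in _); rewrite ?normr1 ?normr0.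
  have bD : bdd (fun x => - 1 * \1_(A n) x + 1) by apply: bddD => //; exact: bddZ.
  have D0 : {ae mu, forall x, 0 <= - 1 * \1_(A n) x + 1 :> R}.
    by apply: aeW => x; rewrite indicE; case: (_ \in _); rewrite ?mulr1n ?mulr0n; lra.
  apply: filterS2 (T_ge0 bD D0) (T_linear (- 1) bA b1) => x.
  by rewrite /real_semigroup => -[_ +] E; rewrite E cReD mulrC Re_mulrC; rewrite -/(cplx _) /cindic; lra.
apply: filterS3 le1 ge1 supA => x le1 ge1 supA.
set z := T t _ x in le1 ge1 *.
have z1 : 1 <= Re z.
  rewrite -lee_fin -supA; apply: ge_ereal_sup => _ [n _ <-].
  by rewrite lee_fin; exact: ge1.
have := sqr_normcE z; have := normc_ge0 z => n0 nE.
have n1 : normc z ^+ 2 <= 1 by rewrite exprn_ile1.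
have im0 := sqr_ge0 (Im z).
have re1 : Re z <= 1 by nra.
have re : Re z = 1 by lra.
have im : Im z ^+ 2 = 0 by rewrite re in nE; lra.
apply: complexP; rewrite ?re//=.
by apply/eqP; rewrite -sqrf_eq0 im.
Qed.

(** [C + u >= 0] for a bound [C] of [|u|], and [T t] fixes constants. *)
Lemma semigroup_real u : bdd u ->
  T t (cplx u) = cplx (real_semigroup t u) %[ae mu].
Proof.
move=> bu; have [_ [C uC]] := bu; have bC := bdd_cst mu C.
have b1 := bdd_cst mu 1.
have bs : bdd (fun x => C * 1 + u x) by apply: bddD => //; exact: bdd_cst.
have s0 : {ae mu, forall x, 0 <= C * 1 + u x}.
  by apply: filterS uC => x; rewrite ler_norml => /andP[]; lra.
apply: filterS3 (T_ge0 bs s0) (T_linear C b1 bu) semigroup_one => x [i0 _] lin one _.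
rewrite lin one mulr1 cImD /= add0r in i0.
by apply: complexP.
Qed.

Lemma real_semigroup_markov : markov_operator mu (real_semigroup t).
Proof.
have b1 := bdd_cst mu 1.
have mP u : bdd u -> measurable_fun setT (real_semigroup t u).
  by move=> bu; have [] := inL2_meas (semigroup_inL2 markovT t0 (cplx_inL2 bu)).
have lin a u v : bdd u -> bdd v -> {ae mu, forall x,
    real_semigroup t (fun z => a * u z + v z) x = a * real_semigroup t u x + real_semigroup t v x}.
  move=> bu bv; apply: filterS (T_linear a bu bv) => x.
  by rewrite /real_semigroup => ->; rewrite cReD mulrC Re_mulrC mulrC.
have one : {ae mu, forall x, real_semigroup t (fun=> 1) x = 1}.
  by apply: filterS semigroup_one => x; rewrite /real_semigroup => ->.
have pos u : bdd u -> {ae mu, forall x, 0 <= u x} -> {ae mu, forall x, 0 <= real_semigroup t u x}.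
  by move=> bu u0; apply: filterS (T_ge0 bu u0) => x [].
split => //.
- move=> u bu; split; first exact: mP.
  have [_ [C uC]] := bu; exists C.
  have bN := bddZ (- 1) bu.
  have bs : bdd (fun x => C * 1 + u x) by apply: bddD => //; exact: bdd_cst.
  have bs' : bdd (fun x => C * 1 + - 1 * u x) by apply: bddD => //; exact: bdd_cst.
  have s0 : {ae mu, forall x, 0 <= C * 1 + u x}.
    by apply: filterS uC => x; rewrite ler_norml => /andP[]; lra.
  have s0' : {ae mu, forall x, 0 <= C * 1 + - 1 * u x}.
    by apply: filterS uC => x; rewrite ler_norml => /andP[]; lra.
  have l1 := lin C _ _ b1 bu; have l2 := lin C _ _ b1 bN.
  have b0 := bdd_cst mu 0.
  have l3 := lin (- 1) _ _ bu b0; have l4 := lin 1 _ _ b0 b0.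
  rewrite (_ : (fun z => - 1 * u z + 0) = (fun z => - 1 * u z)) in l3; last by apply/funext => z; rewrite addr0.
  rewrite (_ : (fun z => 1 * 0 + 0) = (fun=> 0)) in l4; last by apply/funext => z; ring.
  apply: filterS3 (filterI (pos _ bs s0) (pos _ bs' s0')) (filterI (filterI l1 l2) (filterI l3 l4)) one.
  move=> x [p1 p2] [[h1 h2] [h3 h4]] o.
  by rewrite h1 o in p1; rewrite h2 o h3 in p2; rewrite ler_norml; lra.
- move=> u v bu bv; have uL := cplx_inL2 bu; have vL := cplx_inL2 bv.
  have Re_cinner f g : Re (cinner mu f g) = \int[mu]_x Re (f x * (g x)^*) by [].
  transitivity (Re (cinner mu (T t (cplx u)) (cplx v))).
    by rewrite Re_cinner; apply: eq_Rintegral => x _; rewrite cReM cRe_conj cIm_conj /= mulrC oppr0 mulr0 subr0 mulrC.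
  rewrite (smsg_symmetry markovT t0 uL vL) Re_cinner; apply: eq_Rintegral => x _.
  by rewrite /cplx mulrC Re_mulrC cRe_conj mulrC.
Qed.

End RealSemigroup.

(** [ln (1 + w) <= w <= w * ln (expR 1 + w)]. *)
Lemma xlnx_le_LlogL (R : realType) (w : R) : 0 <= w ->
  (1 + w) * ln (1 + w) <= 2 * (w * ln (expR 1 + w)).
Proof.
move=> w0; have e1 : 1 <= expR 1 :> R by rewrite -expR0 ler_expR.
have w1 : 0 < 1 + w by lra.
have l1 : ln (1 + w) <= w.
  by have := @le_ln1Dx _ w; apply; lra.
have l2 : ln (1 + w) <= ln (expR 1 + w) by rewrite ler_ln ?posrE//; lra.
have l3 : 1 <= ln (expR 1 + w) by rewrite -[leLHS](expRK 1) ler_ln ?posrE ?expR_gt0//; lra.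
have := ler_wpM2l w0 l2; have := ler_wpM2l w0 l3.
by rewrite mulr1 mulrDl mul1r; lra.
Qed.

Section VariationL1.
Context d (X : measurableType d) (R : realType) (mu : {measure set X -> \bar R}).
Hypothesis mu_gt0 : (0 < mu setT)%E.
Hypothesis mu_fin : (mu setT < +oo)%E.
Variable T : R -> (X -> R[i]) -> (X -> R[i]).
Hypothesis markovT : symmetric_markovian_semigroup mu T.
Local Notation L2 := (inLp mu 2%:E).
Local Notation bdd := (bdd mu).
Implicit Types (u v w : X -> R).

Lemma semigroup_iter h k u : 0 <= h -> bdd u ->
  T (k%:R * h) (cplx u) = cplx (iter k (real_semigroup T h) u) %[ae mu].
Proof.
move=> h0 bu; have mk := real_semigroup_markov mu_gt0 mu_fin markovT h0.
have biter m : bdd (iter m (real_semigroup T h) u).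
  by elim: m => //= m; exact: markov_bdd.
elim: k => [|k IH].
  by rewrite mul0r; exact: (sg_zero (smsg_semigroup markovT) (cplx_inL2 mu_fin bu)).
have kh0 : 0 <= k%:R * h by rewrite mulr_ge0.
have uL := cplx_inL2 mu_fin bu.
have H1 := sg_add (smsg_semigroup markovT) h0 kh0 uL.
have H2 := L2op_ae (semigroup_op markovT h0) (semigroup_inL2 markovT kh0 uL)
  (cplx_inL2 mu_fin (biter k)) IH.
have H3 := semigroup_real mu_gt0 mu_fin markovT h0 (biter k).
have -> : k.+1%:R * h = h + k%:R * h by rewrite -natr1; ring.
by apply: filterS3 H1 H2 H3 => x /(_ I) -> /(_ I) -> /(_ I) ->.
Qed.

(** Duality with the sign of the (real) function under the norm turns the
    bound on the variation into an [L^1] bound. *)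
Lemma variation_L1 h n (alpha : nat -> R) K w : 0 <= h ->
  (forall k, `|alpha k| <= K) -> bdd w -> {ae mu, forall x, 0 <= w x} ->
  \int[mu]_x normc (\sum_(0 <= k < n) (alpha k)%:C *
      (T (k.+1%:R * h) (cplx w) x - T (k%:R * h) (cplx w) x)) <=
  K * (15 * \int[mu]_x ((1 + w x) * ln (1 + w x)) + 15 * fine (mu setT)).
Proof.
move=> h0 aK bw w0; pose P := real_semigroup T (h / 2).
have h20 : 0 <= h / 2 by rewrite divr_ge0.
have mk : markov_operator mu P := real_semigroup_markov mu_gt0 mu_fin markovT h20.
have biter m z : bdd z -> bdd (iter m P z).
  by move=> bz; elim: m => //= m; exact: markov_bdd.
pose Dk k x := alpha k * (iter (2 * k.+1) P w x - iter (2 * k) P w x).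
pose D x := \sum_(0 <= k < n) Dk k x.
have bDk k : bdd (Dk k) by apply: bddZ; apply: bddB; exact: biter.
have bD : bdd D by exact: bdd_sum.
pose v x : R := if 0 <= D x then 1 else - 1.
have v1 x : `|v x| <= 1 by rewrite /v; case: ifP; rewrite ?normrN1 ?normr1.
have bv : bdd v.
  split; last by exists 1; apply: aeW.
  apply: measurable_fun_ifT; [|exact: measurable_cst|exact: measurable_cst].
  by apply: measurable_fun_ler; [exact: measurable_cst|case: bD].
have Dv x : `|D x| = D x * v x.
  rewrite /v; case: ifPn => [D0|]; first by rewrite mulr1 ger0_norm.
  by rewrite -ltNge => D0; rewrite mulrN1 ltr0_norm.
have TP m : T (m%:R * h) (cplx w) = cplx (iter (2 * m) P w) %[ae mu].
  have := semigroup_iter (2 * m) h20 bw; rewrite natrM.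
  by rewrite (_ : 2 * m%:R * (h / 2) = m%:R * h); last by field.
have DE : {ae mu, forall x, normc (\sum_(0 <= k < n) (alpha k)%:C *
      (T (k.+1%:R * h) (cplx w) x - T (k%:R * h) (cplx w) x)) = D x * v x}.
  have : {ae mu, forall x (m : nat), T (m%:R * h) (cplx w) x = cplx (iter (2 * m) P w) x}.
    by apply/ae_foralln => m; apply: filterS (TP m) => x /(_ I).
  apply: filterS => x H; rewrite -Dv -normcC; congr normc.
  rewrite /D rmorph_sum/=; apply: eq_bigr => k _.
  by rewrite !H /Dk rmorphM rmorphB.
have bDv := bddM bD bv.
have wL := cplx_inL2 mu_fin bw.
have TL m : L2 (T (m%:R * h) (cplx w)) by apply: semigroup_inL2 => //; rewrite mulr_ge0.
have SL : L2 (fun x => \sum_(0 <= k < n) (alpha k)%:C *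
      (T (k.+1%:R * h) (cplx w) x - T (k%:R * h) (cplx w) x)).
  by apply: inL2_sum => k; apply/inL2Z/inL2B; exact: TL.
have -> : \int[mu]_x normc (\sum_(0 <= k < n) (alpha k)%:C *
      (T (k.+1%:R * h) (cplx w) x - T (k%:R * h) (cplx w) x)) = \int[mu]_x (D x * v x).
  apply: Rintegral_ae_eq => //; split; last first.
    by have [_ [C bC]] := bDv; exists C; apply: filterS2 DE bC => x ->.
  exact: (measurable_normc (inL2_meas SL)).
have bDkv k : bdd (fun x => Dk k x * v x) by exact: bddM.
have -> : \int[mu]_x (D x * v x) = \sum_(0 <= k < n) \int[mu]_x (Dk k x * v x).
  by rewrite -Rintegral_bdd_sum//; apply: eq_Rintegral => x _; rewrite /D mulr_suml.
apply: (@le_trans _ _ (\sum_(0 <= k < n) K * `|\int[mu]_x (iter (2 * k.+1) P w x * v x) -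
                      \int[mu]_x (iter (2 * k) P w x * v x)|)).
  apply: ler_sum => k _; have b2 := bddM (biter (2 * k.+1) w bw) bv.
  have b3 := bddM (biter (2 * k) w bw) bv.
  rewrite -RintegralB//; try exact: integrable_bdd.
  have -> : \int[mu]_x (Dk k x * v x) =
      alpha k * \int[mu]_x (iter (2 * k.+1) P w x * v x - iter (2 * k) P w x * v x).
    rewrite -RintegralZl//; last exact: (integrable_bdd mu_fin (bddB b2 b3)).
    by apply: eq_Rintegral => x _; rewrite /Dk; ring.
  by apply: le_trans (ler_norm _) _; rewrite normrM ler_wpM2r.
rewrite -mulr_sumr ler_wpM2l//; first exact: le_trans (normr_ge0 _) (aK 0).
by apply: markov_variation => //; apply: aeW.
Qed.

End VariationL1.

(** * The bound on nonnegative functions and on general ones *)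

Section L1.
Context d (X : measurableType d) (R : realType) (mu : {measure set X -> \bar R}).
Hypothesis mu_fin : (mu setT < +oo)%E.
Local Notation L2 := (inLp mu 2%:E).
Implicit Types f g : X -> R[i].

Definition nrm1 f : R := \int[mu]_x normc (f x).

Lemma cLnorm1E f : L2 f -> cLnorm mu 1 f = (nrm1 f)%:E.
Proof.
move=> fL; rewrite /cLnorm Lnorm1 /nrm1 /Rintegral fineK.
  by apply: eq_integral => x _; rewrite abse_EFin ger0_norm ?normc_ge0.
exact: integrable_fin_num (integrable_normc mu_fin fL).
Qed.

Lemma nrm1D f g : L2 f -> L2 g -> nrm1 (fun x => f x + g x) <= nrm1 f + nrm1 g.
Proof.
move=> fL gL; have fi := integrable_normc mu_fin fL; have gi := integrable_normc mu_fin gL.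
rewrite /nrm1 -RintegralD//; apply: le_Rintegral => //.
- exact: (integrable_normc mu_fin (inL2D fL gL)).
- rewrite (_ : EFin \o _ = (fun x => ((normc (f x))%:E + (normc (g x))%:E)%E))//.
  exact: integrableD.
by move=> x _; exact: normcD.
Qed.

Lemma nrm1Z c f : L2 f -> nrm1 (fun x => c * f x) = normc c * nrm1 f.
Proof.
move=> fL; rewrite /nrm1 -RintegralZl//; last exact: integrable_normc.
by apply: eq_Rintegral => x _; rewrite normcM.
Qed.

Lemma nrm1_ae f g : L2 f -> L2 g -> f = g %[ae mu] -> nrm1 f = nrm1 g.
Proof.
move=> fL gL fg; rewrite /nrm1 /Rintegral; congr fine; apply: ae_eq_integral => //.
- exact/measurable_EFinP/(measurable_normc (inL2_meas fL)).
- exact/measurable_EFinP/(measurable_normc (inL2_meas gL)).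
by apply: filterS fg => x /[apply] ->.
Qed.

Lemma L2_operator_sum (c : nat -> R[i]) (S S' : nat -> (X -> R[i]) -> (X -> R[i])) n :
  (forall k, L2_operator mu (S k)) -> (forall k, L2_operator mu (S' k)) ->
  L2_operator mu (fun f x => \sum_(0 <= k < n) c k * (S k f x - S' k f x)).
Proof.
move=> opS opS'; split.
- by move=> f fL; apply: inL2_sum => k; apply/inL2Z/inL2B; exact: L2op_stable.
- move=> f g fL gL fg.
  have H : {ae mu, forall x (k : nat), S k f x = S k g x /\ S' k f x = S' k g x}.
    apply/ae_foralln => k.
    apply: filterS2 (L2op_ae (opS k) fL gL fg) (L2op_ae (opS' k) fL gL fg) => x.
    by move=> /(_ I) ? /(_ I) ?.
  by apply: filterS H => x H _; apply: eq_bigr => k _; have [-> ->] := H k.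
move=> a f g fL gL.
have H : {ae mu, forall x (k : nat),
    S k (fun x => a * f x + g x) x = a * S k f x + S k g x /\
    S' k (fun x => a * f x + g x) x = a * S' k f x + S' k g x}.
  apply/ae_foralln => k.
  apply: filterS2 (L2op_linear (opS k) a fL gL) (L2op_linear (opS' k) a fL gL) => x.
  by move=> /(_ I) ? /(_ I) ?.
apply: filterS H => x H _; rewrite mulr_sumr -big_split/=; apply: eq_bigr => k _.
by have [-> ->] := H k; ring.
Qed.

End L1.

Section Truncation.
Context d (X : measurableType d) (R : realType) (mu : {measure set X -> \bar R}).
Hypothesis mu_fin : (mu setT < +oo)%E.
Local Notation L2 := (inLp mu 2%:E).

(** Positive part and truncation at once, so that [y] is the limit of
    [trunc_pos n y - trunc_pos n (- y)]. *)
Definition trunc_pos (n : nat) (y : R) : R := Num.min (Num.max y 0) n%:R.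

Lemma trunc_pos_ge0 n y : 0 <= trunc_pos n y.
Proof. by rewrite /trunc_pos le_min ler0n le_max lexx orbT. Qed.

Lemma trunc_pos_le n y : trunc_pos n y <= `|y|.
Proof. by rewrite /trunc_pos ge_min ge_max ler_norm normr_ge0. Qed.

Lemma trunc_pos_bdd n (u : X -> R) : measurable_fun setT u ->
  bdd mu (fun x => trunc_pos n (u x)).
Proof.
move=> mu_; split.
  by apply: measurable_minr => //; exact: measurable_maxr.
exists n%:R; apply: aeW => x; rewrite ger0_norm ?trunc_pos_ge0//.
by rewrite /trunc_pos ge_min lexx orbT.
Qed.

Lemma trunc_pos_sub n y : `|y - (trunc_pos n y - trunc_pos n (- y))| <= `|y|.
Proof.
rewrite /trunc_pos; have n0 := ler0n R n.
have [y0|] := boolP (0 <= y); last rewrite -ltNge => y0.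
  rewrite (max_l y0) (@max_r _ _ (- y)) ?oppr_le0// (min_l n0) subr0.
  rewrite (ger0_norm y0) ler_norml /Order.min; case: ltP; lra.
rewrite (max_r (ltW y0)) (@max_l _ _ (- y)) ?oppr_ge0 ?(ltW y0)// (min_l n0) sub0r opprK.
by rewrite (ltr0_norm y0) ler_norml /Order.min; case: ltP; lra.
Qed.

Lemma trunc_pos_id n y : `|y| <= n%:R -> trunc_pos n y - trunc_pos n (- y) = y.
Proof.
rewrite /trunc_pos; have n0 := ler0n R n.
have [y0|] := boolP (0 <= y); last rewrite -ltNge => y0.
  rewrite (ger0_norm y0) => yn.
  by rewrite (max_l y0) (@max_r _ _ (- y)) ?oppr_le0// (min_l n0) subr0 min_l.
rewrite (ltr0_norm y0) => yn.
by rewrite (max_r (ltW y0)) (@max_l _ _ (- y)) ?oppr_ge0 ?(ltW y0)// (min_l n0) sub0r min_l// opprK.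
Qed.

Variable f : X -> R[i].

Definition piece (j n : nat) (x : X) : R :=
  trunc_pos n (match j with 0%N => Re (f x) | 1%N => - Re (f x)
               | 2%N => Im (f x) | _ => - Im (f x) end).

(** Nested, and ended by [0], in order to fit the form [c * u + g] of the
    linearity axiom once for each piece. *)
Definition truncation n x : R[i] :=
  1 * cplx (piece 0 n) x + (- 1 * cplx (piece 1 n) x +
  ('i * cplx (piece 2 n) x + (- 'i * cplx (piece 3 n) x + 0))).

Lemma piece_ge0 j n x : 0 <= piece j n x.
Proof. exact: trunc_pos_ge0. Qed.

Lemma piece_le j n x : piece j n x <= normc (f x).
Proof.
apply: le_trans (trunc_pos_le _ _) _.
by case: j => [|[|[|j]]]; rewrite ?normrN; [exact: ler_Re_normc|exact: ler_Re_normc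
  |exact: ler_Im_normc|exact: ler_Im_normc].
Qed.

Lemma piece_bdd j n : cmeasurable setT f -> bdd mu (piece j n).
Proof.
move=> [mR mI]; apply: trunc_pos_bdd.
by case: j => [|[|[|j]]] //; exact: measurable_funN.
Qed.

Lemma ReIm_truncation n x : Re (truncation n x) = piece 0 n x - piece 1 n x /\
  Im (truncation n x) = piece 2 n x - piece 3 n x.
Proof. by rewrite /truncation !ReImE /=; split; ring. Qed.

Lemma cmeasurable_truncation n : cmeasurable setT f -> cmeasurable setT (truncation n).
Proof.
move=> mf; have mp j : cmeasurable setT (cplx (piece j n)).
  by apply: cmeasurable_real; case: (piece_bdd j n mf).
by do ![apply: cmeasurableD; first (apply: cmeasurableM => //; exact: cmeasurable_cst)];
  exact: cmeasurable_cst.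
Qed.

Lemma truncation_cvg : L2 f -> nrm mu (fun x => f x - truncation n x) @[n --> \oo] --> (0 : R).
Proof.
move=> fL; have mf := inL2_meas fL.
apply: (@nrm_dominated_cvg _ _ _ _ _ (fun x => 2 * normc (f x))).
- by move=> n; apply: cmeasurableB => //; exact: cmeasurable_truncation.
- have [_ fi] := (inL2P mu f).1 fL.
  rewrite (_ : EFin \o _ = (fun x => (4%:E * (normc (f x) ^+ 2)%:E)%E)).
    exact: integrableZl.
  by apply/funext => x /=; congr EFin; ring.
- apply: aeW => x n; apply: le_trans (normc_le_ReIm _) _.
  have [E1 E2] := ReIm_truncation n x; rewrite !cReD !cImD !cReN !cImN E1 E2.
  rewrite mulr2n mulrDl mul1r; apply: lerD.
    exact: le_trans (trunc_pos_sub _ _) (ler_Re_normc _).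
  exact: le_trans (trunc_pos_sub _ _) (ler_Im_normc _).
apply: aeW => x; have near0 : \forall n \near \oo, normc (f x - truncation n x) = 0.
  near=> n; have fn : normc (f x) <= n%:R by near: n; exact: nbhs_infty_ger.
  have [E1 E2] := ReIm_truncation n x.
  rewrite (_ : f x - truncation n x = 0) ?normc0//; apply: complexP.
    by rewrite cReD cReN E1 trunc_pos_id ?subrr// (le_trans (ler_Re_normc _)).
  by rewrite cImD cImN E2 trunc_pos_id ?subrr// (le_trans (ler_Im_normc _)).
apply: cvg_near_cst; exact: near0.
Unshelve. all: by end_near. Qed.

End Truncation.

Section Main.
Context d (X : measurableType d) (R : realType) (mu : {measure set X -> \bar R}).
Hypothesis mu_gt0 : (0 < mu setT)%E.
Hypothesis mu_fin : (mu setT < +oo)%E.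
Variable T : R -> (X -> R[i]) -> (X -> R[i]).
Hypothesis markovT : symmetric_markovian_semigroup mu T.
Variables (M : R -> R[i]) (K : R).
Hypothesis mM : cmeasurable (`]0, +oo[ : set R) M.
Hypothesis MK : forall t, 0 < t -> normc (M t) <= K.
Local Notation L2 := (inLp mu 2%:E).
Local Notation m := (fine (mu setT)).

Let K0 : 0 <= K. Proof. exact: le_trans (normc_ge0 _) (MK ltr01). Qed.

Let mesh0 (n : nat) : 0 <= n.+1%:R^-1 :> R. Proof. by rewrite invr_ge0. Qed.

Lemma riemann_op_operator n : L2_operator mu (riemann_op T M n).
Proof.
by apply: L2_operator_sum => k; apply: (semigroup_op markovT); rewrite mulr_ge0.
Qed.

Lemma riemann_op_bounded n : exists2 C : R, 0 <= C &
  forall g, L2 g -> nrm mu (riemann_op T M n g) <= C * nrm mu g.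
Proof.
pose c k := cell_average (fun t => Re (M t)) n.+1%:R^-1 k +i*
            cell_average (fun t => Im (M t)) n.+1%:R^-1 k.
exists (\sum_(0 <= k < (n.+1 ^ 2)%N) normc (c k) * 2).
  by apply: sumr_ge0 => k _; rewrite mulr_ge0 ?normc_ge0.
move=> g gL; have TL k : L2 (T (k%:R * n.+1%:R^-1) g).
  by apply: (semigroup_inL2 markovT) => //; rewrite mulr_ge0.
apply: le_trans (nrm_sum _ _) _ => [k|]; first by apply/inL2Z/inL2B; exact: TL.
rewrite mulr_suml; apply: ler_sum => k _.
rewrite nrmZ; last by apply: inL2B; exact: TL.
rewrite -mulrA ler_wpM2l ?normc_ge0//.
apply: le_trans (nrmB (TL _) (TL _)) _; rewrite mulr2n mulrDl mul1r.
by apply: lerD; apply: (nrm_semigroup markovT) => //; rewrite mulr_ge0.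
Qed.

(** After division by [kappa], the [L log L] integral of [w] is at most [m],
    and the bound of [variation_L1] is at most [45 K m], once for the averages
    of the real part of [M] and once for those of its imaginary part. *)
Lemma riemann_op_pos n w kappa : bdd mu w -> (forall x, 0 <= w x) -> 0 < kappa ->
  \int[mu]_x (w x / kappa * ln (expR 1 + w x / kappa)) <= m ->
  nrm1 mu (riemann_op T M n (cplx w)) <= 90 * K * kappa * m.
Proof.
move=> bw w0 kappa0 wm; have op := riemann_op_operator n.
pose w' x := kappa^-1 * w x; have bw' : bdd mu w' by exact: bddZ.
have w'0 x : 0 <= w' x by rewrite /w' mulr_ge0// invr_ge0 ltW.
have wL' := cplx_inL2 mu_fin bw'.
have wE : cplx w = (fun x => kappa%:C * cplx w' x).
  by apply/funext => x; rewrite /cplx -rmorphM mulrA mulfV ?gt_eqF// mul1r.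
have RL := L2op_stable op wL'.
have -> : nrm1 mu (riemann_op T M n (cplx w)) = kappa * nrm1 mu (riemann_op T M n (cplx w')).
  have nk : normc kappa%:C = kappa by rewrite normcC gtr0_norm.
  rewrite -[X in X * nrm1 _ _]nk -nrm1Z//; apply: nrm1_ae.
  - by apply: L2op_stable op _ _; rewrite wE; exact: inL2Z.
  - exact: inL2Z.
  by rewrite wE; exact: L2op_scale.
rewrite (_ : 90 * K * kappa * m = kappa * (90 * K * m)); last by ring.
rewrite ler_pM2l//.
pose N := (n.+1 ^ 2)%N.
pose a := cell_average (fun s => Re (M s)) n.+1%:R^-1.
pose b := cell_average (fun s => Im (M s)) n.+1%:R^-1.
pose dT k x := T (k.+1%:R * n.+1%:R^-1) (cplx w') x - T (k%:R * n.+1%:R^-1) (cplx w') x.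
have dTL k : L2 (dT k).
  by apply: inL2B; apply: (semigroup_inL2 markovT) => //; rewrite mulr_ge0.
have SL c : L2 (fun x => \sum_(0 <= k < N) (c k)%:C * dT k x).
  by apply: inL2_sum => k; exact: inL2Z.
have -> : riemann_op T M n (cplx w') = (fun x =>
    \sum_(0 <= k < N) (a k)%:C * dT k x + 'i * \sum_(0 <= k < N) (b k)%:C * dT k x).
  apply/funext => x; rewrite mulr_sumr -big_split/=; apply: eq_bigr => k _.
  rewrite -/(dT k x) mulrA -mulrDl; congr (_ * _).
  by apply: complexP; rewrite !ReImE /= -/(a k) -/(b k); ring.
apply: le_trans (nrm1D mu_fin (SL a) (inL2Z _ (SL b))) _; rewrite nrm1Z//.
have -> : normc 'i = 1 :> R by rewrite normcE /= expr0n expr1n add0r sqrtr1.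
have cell_le (h : R -> R) k : measurable_fun (`]0, +oo[ : set R) h ->
    (forall s, 0 < s -> `|h s| <= K) -> `|cell_average h n.+1%:R^-1 k| <= K.
  by move=> mh hK; apply: cell_average_le => //; rewrite invr_gt0.
have aK k : `|a k| <= K.
  by apply: cell_le; [case: mM|move=> s /MK; apply: le_trans; exact: ler_Re_normc].
have bK k : `|b k| <= K.
  by apply: cell_le; [case: mM|move=> s /MK; apply: le_trans; exact: ler_Im_normc].
have w'0' : {ae mu, forall x, 0 <= w' x} by apply: aeW.
have H1 := variation_L1 mu_gt0 mu_fin markovT N (mesh0 n) aK bw' w'0'.
have H2 := variation_L1 mu_gt0 mu_fin markovT N (mesh0 n) bK bw' w'0'.
have blog : bdd mu (fun x => w' x * ln (expR 1 + w' x)).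
  apply: bddM => //; apply: bdd_ln; first by apply: bddD => //; exact: bdd_cst.
  apply: aeW => x; have e1 : 1 <= expR 1 :> R by rewrite -expR0 ler_expR.
  by apply: le_trans e1 _; rewrite lerDl.
have bl1 : bdd mu (fun x => (1 + w' x) * ln (1 + w' x)).
  have b1 : bdd mu (fun x => 1 + w' x) by apply: bddD => //; exact: bdd_cst.
  apply: bddM => //; apply: bdd_ln => //.
  by apply: aeW => x; rewrite lerDl.
have LL : \int[mu]_x ((1 + w' x) * ln (1 + w' x)) <= 2 * m.
  apply: (@le_trans _ _ (2 * \int[mu]_x (w' x * ln (expR 1 + w' x)))).
    rewrite -RintegralZl//; last exact: (integrable_bdd mu_fin blog).
    apply: le_Rintegral_ae => //; first exact: bddZ.
    by apply: aeW => x; exact: xlnx_le_LlogL.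
  rewrite ler_pM2l//; apply: le_trans wm.
  rewrite le_eqVlt; apply/orP; left; apply/eqP; apply: eq_Rintegral => x _.
  by rewrite /w' [w x / _]mulrC.
have : K * (15 * \int[mu]_x ((1 + w' x) * ln (1 + w' x)) + 15 * m) <= K * (45 * m).
  rewrite ler_wpM2l// (_ : 45 * m = 15 * (2 * m) + 15 * m); last by ring.
  by rewrite lerD2r ler_pM2l.
rewrite mul1r /nrm1 => H3.
apply: le_trans (lerD (le_trans H1 H3) (le_trans H2 H3)) _.
by rewrite le_eqVlt; apply/orP; left; apply/eqP; ring.
Qed.

(** Each of the four nonnegative pieces of [f] is dominated by [|f|], hence has
    a smaller [L log L] integral; the rest of the truncation is small in [L^2],
    where [riemann_op] is bounded. *)
Lemma riemann_op_LlogL n f kappa : L2 f -> 0 < kappa ->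
  ((m^-1)%:E * \int[mu]_x ((normc (f x) / kappa) *
     ln (expR 1 + normc (f x) / kappa))%:E <= 1)%E ->
  nrm1 mu (riemann_op T M n f) <= 360 * K * kappa * m.
Proof.
move=> fL kappa0 fk; have op := riemann_op_operator n.
have mf := inL2_meas fL.
have m0 : 0 < m by rewrite fine_gt0// mu_gt0.
have e0 : 0 < expR 1 :> R by exact: expR_gt0.
have e1 : 1 <= expR 1 :> R by rewrite -expR0 ler_expR.
have fk' : (\int[mu]_x ((normc (f x) / kappa) *
     ln (expR 1 + normc (f x) / kappa))%:E <= m%:E)%E.
  by move: fk; rewrite muleC lee_pdivrMr// mul1e.
have piece_int j N : \int[mu]_x (piece f j N x / kappa * ln (expR 1 + piece f j N x / kappa)) <= m.
  rewrite -lee_fin /Rintegral fineK; last first.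
    apply: integrable_fin_num => //; apply: (integrable_bdd mu_fin).
    have bp : bdd mu (fun x => piece f j N x / kappa).
      by apply: bddM; [exact: piece_bdd|exact: bdd_cst].
    apply: bddM => //; apply: bdd_ln; first by apply: bddD => //; exact: bdd_cst.
    apply: aeW => x; have : 0 <= piece f j N x / kappa by rewrite divr_ge0 ?piece_ge0// ltW.
    by lra.
  apply: le_trans fk'; apply: ge0_le_integral => //.
  - move=> x _; rewrite lee_fin mulr_ge0// ?divr_ge0 ?piece_ge0 ?(ltW kappa0)//.
    apply: ln_ge0; have : 0 <= piece f j N x / kappa by rewrite divr_ge0 ?piece_ge0// ltW.
    by lra.
  - apply/measurable_EFinP; have mp : measurable_fun setT (fun x => piece f j N x / kappa).
      by apply: measurable_funM; [case: (piece_bdd mu j N mf)|exact: measurable_cst].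
    apply: measurable_funM => //; apply: (measurableT_comp (@measurable_ln R)).
    by apply: measurable_funD => //; exact: measurable_cst.
  - apply/measurable_EFinP; have mp : measurable_fun setT (fun x => normc (f x) / kappa).
      by apply: measurable_funM; [exact: measurable_normc|exact: measurable_cst].
    apply: measurable_funM => //; apply: (measurableT_comp (@measurable_ln R)).
    by apply: measurable_funD => //; exact: measurable_cst.
  - move=> x _; rewrite lee_fin.
    have h1 : 0 <= piece f j N x / kappa by rewrite divr_ge0 ?piece_ge0// ltW.
    have h2 : piece f j N x / kappa <= normc (f x) / kappa.
      by rewrite ler_pM2r ?invr_gt0//; exact: piece_le.
    apply: ler_pM => //; first by apply: ln_ge0; lra.
    by rewrite ler_ln ?posrE; lra.
have [C C0 RC] := riemann_op_bounded n.
have lim : Num.sqrt m * (C * nrm mu (fun x => f x - truncation f N x)) @[N --> \oo] --> (0 : R).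
  rewrite -[X in _ --> X](mulr0 (Num.sqrt m)); apply: cvgM; first exact: cvg_cst.
  rewrite -[X in _ --> X](mulr0 C); apply: cvgM; first exact: cvg_cst.
  exact: truncation_cvg.
apply: (ler_cvg0 lim) => N.
have pL j := cplx_inL2 mu_fin (piece_bdd mu j N mf).
have RpL j := L2op_stable op (pL j).
have zL := inL2_0 mu.
have step c j g : L2 g -> nrm1 mu (riemann_op T M n (fun x => c * cplx (piece f j N) x + g x)) <=
    normc c * (90 * K * kappa * m) + nrm1 mu (riemann_op T M n g).
  move=> gL; have RgL := L2op_stable op gL.
  have -> : nrm1 mu (riemann_op T M n (fun x => c * cplx (piece f j N) x + g x)) =
    nrm1 mu (fun x => c * riemann_op T M n (cplx (piece f j N)) x + riemann_op T M n g x).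
    apply: nrm1_ae; [|by apply: inL2D => //; exact: inL2Z|exact: L2op_linear].
    by apply: L2op_stable op _ _; apply: inL2D => //; exact: inL2Z.
  apply: le_trans (nrm1D mu_fin (inL2Z c (RpL j)) RgL) _; rewrite lerD2r nrm1Z//.
  rewrite ler_wpM2l ?normc_ge0//; apply: riemann_op_pos => //.
  - exact: piece_bdd.
  - by move=> x; exact: piece_ge0.
have tL : L2 (truncation f N).
  by do ![apply: inL2D; first exact: inL2Z].
have ni : normc 'i = 1 :> R by rewrite normcE /= expr0n expr1n add0r sqrtr1.
have R0 : nrm1 mu (riemann_op T M n (fun=> 0)) = 0.
  have R00 := L2op0 op; rewrite (nrm1_ae (L2op_stable op zL) zL R00).
  by rewrite /nrm1; under eq_Rintegral do rewrite normc0; rewrite Rintegral_cst// mul0r.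
have tb : nrm1 mu (riemann_op T M n (truncation f N)) <= 360 * K * kappa * m.
  have L3 := inL2D (inL2Z (- 'i) (pL 3)) zL.
  have L2' := inL2D (inL2Z 'i (pL 2)) L3.
  have L1' := inL2D (inL2Z (- 1) (pL 1)) L2'.
  apply: le_trans (step 1 0 _ L1') _; rewrite normc1 mul1r.
  apply: le_trans (lerD (lexx _) (step (- 1) 1 _ L2')) _; rewrite normcN normc1 mul1r.
  apply: le_trans (lerD (lexx _) (lerD (lexx _) (step 'i 2 _ L3))) _; rewrite ni mul1r.
  apply: le_trans (lerD (lexx _) (lerD (lexx _) (lerD (lexx _) (step (- 'i) 3 _ zL)))) _.
  rewrite normcN ni mul1r R0 le_eqVlt; apply/orP; left; apply/eqP; ring.
have RfL := L2op_stable op fL; have RtL := L2op_stable op tL.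
have ftL := inL2B fL tL; have RftL := L2op_stable op ftL.
have split_le : nrm1 mu (riemann_op T M n f) <=
    nrm1 mu (riemann_op T M n (truncation f N)) +
    nrm1 mu (riemann_op T M n (fun x => f x - truncation f N x)).
  apply: le_trans (nrm1D mu_fin RtL RftL).
  rewrite le_eqVlt; apply/orP; left; apply/eqP; apply: nrm1_ae => //; first exact: inL2D.
  have := L2op_add op tL ftL.
  rewrite (_ : (fun x => truncation f N x + (f x - truncation f N x)) = f)//.
  by apply/funext => x; ring.
apply: le_trans split_le _; apply: lerD => //.
apply: le_trans (integral_normc_le mu_fin RftL) _.
by rewrite ler_wpM2l ?sqrtr_ge0//; exact: RC.
Qed.

End Main.

Theorem corollary4 (R : realType) :
  exists c : R, 0 < c /\
  forall (d : measure_display) (X : measurableType d)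
    (mu : {measure set X -> \bar R})
    (mu_gt0 : (0 < mu [set: X])%E) (mu_fin : (mu [set: X] < +oo)%E)
    (T : R -> (X -> R[i]) -> (X -> R[i]))
    (T_markov : symmetric_markovian_semigroup mu T)
    (E : R -> (X -> R[i]) -> (X -> R[i]))
    (E_res : resolution_of_generator mu E T)
    (M : R -> R[i]) (M_bdd : bounded_borel M)
    (Tm : (X -> R[i]) -> (X -> R[i]))
    (Tm_mult : spectral_multiplier mu E (laplace_multiplier M) Tm)
    (f : X -> R[i]) (f_L2 : inLp mu 2%:E f),
  (cLnorm mu 1 (Tm f) <=
     c%:E * mu [set: X] * (sup_norm M)%:E * LlogL_norm mu f)%E.
Proof.
exists 360; split=> [|d X mu mu_gt0 mu_fin T T_markov E E_res M [mM [B MB]] Tm Tm_mult f f_L2].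
  by rewrite ltr0n.
set K := sup_norm M; set m := fine (mu [set: X]).
have MK t : 0 < t -> normc (M t) <= K.
  move=> t0; apply: ub_le_sup; last by exists t => //; rewrite /= in_itv/= t0.
  by exists B => _ [s + <-]; rewrite /= in_itv/= andbT; exact: MB.
have K0 : 0 <= K := le_trans (normc_ge0 _) (MK 1 ltr01).
have m0 : 0 < m by rewrite fine_gt0// mu_gt0.
have mE : mu [set: X] = m%:E by rewrite /m fineK// ge0_fin_numE.
have [_ TmL _] := Tm_mult f f_L2.
have RL n := L2op_stable (riemann_op_operator T_markov M n) f_L2.
have Rcvg := riemann_op_cvg mu_fin T_markov E_res mM MK Tm_mult f_L2.
have lim : Num.sqrt m * nrm mu (fun x => riemann_op T M n f x - Tm f x) @[n --> \oo] --> (0 : R).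
  by rewrite -[X in _ --> X](mulr0 (Num.sqrt m)); apply: cvgM => //; exact: cvg_cst.
rewrite cLnorm1E// mE.
have approx b : (forall n, nrm1 mu (riemann_op T M n f) <= b) -> nrm1 mu (Tm f) <= b.
  move=> Rb; apply: (ler_cvg0 lim) => n.
  have dL := inL2B TmL (RL n).
  have := nrm1D mu_fin (RL n) dL; under eq_fun do rewrite subrKC.
  move=> /le_trans; apply; apply: lerD => //.
  by rewrite nrm_distC; exact: integral_normc_le.
have main kappa : 0 < kappa -> _ -> nrm1 mu (Tm f) <= 360 * K * kappa * m :=
  fun k0 fk => approx _ (fun n => riemann_op_LlogL mu_gt0 mu_fin T_markov mM MK n f_L2 k0 fk).
(* When [K = 0] the right-hand side is [0], even against an infinite
   [L log L] norm, and one cannot divide by [K] to reach the infimum. *)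
move: K0; rewrite le_eqVlt => /predU1P[K_eq0|Kpos].
  rewrite -K_eq0 mule0 mul0e lee_fin; apply: approx => n.
  rewrite /nrm1 (@eq_Rintegral _ _ _ _ _ (cst 0)); first by rewrite Rintegral_cst// mul0r.
  move=> x _; rewrite /riemann_op big1 ?normc0// => k _.
  have c0 (h : R -> R) : measurable_fun (`]0, +oo[ : set R) h ->
      (forall s, 0 < s -> `|h s| <= 0) -> cell_average h n.+1%:R^-1 k = 0.
    by move=> mh hK; apply/eqP; rewrite -normr_le0; apply: cell_average_le.
  have [mR mI] := mM.
  rewrite !c0 ?mul0r//.
  - by move=> s /MK; rewrite -K_eq0; apply: le_trans; exact: ler_Im_normc.
  - by move=> s /MK; rewrite -K_eq0; apply: le_trans; exact: ler_Re_normc.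
have c0 : 0 < 360 * m * K.
  by apply: mulr_gt0 Kpos; apply: mulr_gt0 m0; rewrite ltr0n.
rewrite -!EFinM -(lee_pdivrMl _ _ c0).
apply: le_ereal_inf_tmp => _ [kappa [k0 fk] <-].
rewrite -EFinM lee_fin (ler_pdivrMl _ _ c0).
apply: le_trans (main kappa k0 fk) _.
by rewrite le_eqVlt; apply/orP; left; apply/eqP; ring.
Qed.
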